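(* Let $\{Y(t):t\in[0,1]\}$ be the LMSM with Hurst function $H(\cdot)$, where $H(\cdot)$ satisfies the Hölder condition $|H(t_1)-H(t_2)|\le c_H|t_1-t_2|^{\rho_H}$ for all $t_1,t_2\in[0,1]$, for some constant $c_H$ and some $\rho_H$ with $1\ge\rho_H>\sup_{t\in[0,1]}H(t)$. Let the real number $\beta\in(0,1/4]$ and the integer $L\ge 2$ be arbitrary. Then there is a positive deterministic constant $c$ such that the following holds for every compact interval $I\subseteq[0,1]$ with non-empty interior, every integer $N\ge 3$ satisfying $$\lambda(I)\ge 4(L+1)N^{-1}(\log N)^2,$$ and every real number $p\in(0,4]$ (in particular $c$ does not depend on $N$, $I$ and $p$): setting $$\widehat H_N^\beta(I)=\beta^{-1}\log_2\Big(\mathcal T_\beta\Big(\frac{V_N^\beta(I)}{V_{2N}^\beta(I)}\Big)\Big)\quad\text{and}\quad \Lambda(L,\beta,p)=\frac{2\beta(L-1)}{(p+4)\beta(L-1)+2(p+1)},$$ one has $$c\,\mathbb E\Big(\big|\widehat H_N^\beta(I)-\min_{t\in I}H(t)\big|^p\Big)\le \min\Big\{\Big(\frac{\log\log N}{\log N}\Big)^p,\lambda(I)^{p\rho_H}\Big\}+N^{-p\beta(\rho_H-\sup_{t\in[0,1]}H(t))}$$ $$\qquad+N^{-p\Lambda(L,\beta,p)}(\log N)^{8(1-\Lambda(L,\beta,p))}\lambda(I)^{-4(1-\Lambda(L,\beta,p))}\max\Big\{\lambda(I)^2,N^{-(p+4)\Lambda(L,\beta,p)}\Big\}.$$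
   Context: Setting: $\alpha\in(1,2)$ is fixed and $(\Omega,\mathcal F,\mathbb P)$ is a probability space carrying an independently scattered symmetric $\alpha$-stable ($S\alpha S$) random measure $Z_\alpha(ds)$ on $\mathbb R$ with Lebesgue control measure: for $f\in L^\alpha(\mathbb R)$, $\int_{\mathbb R}f(s)Z_\alpha(ds)$ is the real $S\alpha S$ random variable with characteristic function $\xi\mapsto\exp(-|\sigma\xi|^\alpha)$, where $\sigma=\|f\|_{L^\alpha(\mathbb R)}$, and integrals of functions with (a.e.) disjoint supports are independent. For $x,\kappa\in\mathbb R$, $(x)_+^\kappa=x^\kappa$ if $x>0$ and $0$ otherwise. For $(u,v)\in[0,1]\times(1/\alpha,1)$, $$X(u,v)=\int_{\mathbb R}\{(u-s)_+^{v-1/\alpha}-(-s)_+^{v-1/\alpha}\}Z_\alpha(ds),$$ identified with its version with continuous sample paths. The Hurst function $H:[0,1]\to(1/\alpha,1)$ takes values in a compact subinterval of $(1/\alpha,1)$. The Linear Multifractional Stable Motion (LMSM) with Hurst function $H$ is $Y(t)=X(t,H(t))$, $t\in[0,1]$. Notation: $\log$ is the natural logarithm, $\log_2$ the logarithm to base 2, $\lambda$ Lebesgue measure. For an integer $L\ge2$ and $l\in\{0,\dots,L\}$, $a_l=(-1)^{L-l}\binom{L}{l}$. For $N\ge L$ and $k\in\{0,\dots,N-L\}$, $d_{N,k}=\sum_{l=0}^L a_l Y((k+l)/N)$. For a compact interval $I\subseteq[0,1]$ with non-empty interior and $N\ge(L+1)\lambda(I)^{-1}$, $\nu_N(I)=\{k\in\{0,\dots,N-L\}:k/N\in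 I\}$, $|\nu_N(I)|$ is its cardinality, and $V_N^\beta(I)=|\nu_N(I)|^{-1}\sum_{k\in\nu_N(I)}|d_{N,k}|^\beta$. For $x\ge0$, $\mathcal T_\beta(x)=\min\{2^\beta,\max\{x,2^{\beta/2}\}\}$. *)

(* Defs.v *)
From HB Require Import structures.
From mathcomp Require Import all_boot all_order all_algebra.
From mathcomp Require Import all_classical all_reals all_analysis.
From mathcomp Require Import complex.

Set Implicit Arguments.
Unset Strict Implicit.
Unset Printing Implicit Defensive.

Import Order.TTheory GRing.Theory Num.Theory.
Import numFieldNormedType.Exports.

Local Open Scope classical_set_scope.
Local Open Scope ring_scope.

Section stable_integral.
Context (R : realType) (d : measure_display) (T : measurableType d).
Variables (P : probability T R) (alpha : R).

(* E(exp(i xi X)) = E(cos(xi X)) + i E(sin(xi X)); both integrands are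
   bounded. *)
Definition char_fun (X : T -> R) (xi : R) : R[i] :=
  Complex (fine 'E_P[fun w => cos (xi * X w)])
          (fine 'E_P[fun w => sin (xi * X w)]).

Definition is_SaS (sigma : R) (X : T -> R) :=
  forall xi : R,
    char_fun X xi = Complex (expR (- (`|sigma * xi| `^ alpha))) 0.

(* Mutual independence. The product rule for subfamilies is the case
   B i = setT for some i. *)
Definition independent_RVs (n : nat) (X : 'I_n -> T -> R) :=
  forall B : 'I_n -> set R, (forall i, measurable (B i)) ->
    (P (\bigcap_(i in [set: 'I_n]) (X i @^-1` B i)) =
     \prod_(i < n) P (X i @^-1` B i))%E.

Definition ae_disjoint_supports (f g : R -> R) :=
  {ae (@lebesgue_measure R), forall s, f s = 0 \/ g s = 0}.

Definition Lalpha (f : R -> R) := f \in Lfun (@lebesgue_measure R) alpha%:E.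

(* [I f] is the integral of [f] against Z_alpha. The random measure itself is
   A |-> I \1_A on the Borel sets of finite Lebesgue measure; by linearity and
   [stable_integral_law], f |-> I f is continuous from L^alpha to convergence
   in probability, so I is determined up to null events by this measure. The
   values of I outside L^alpha are irrelevant. *)
Record is_stable_integral (I : (R -> R) -> {RV P >-> R}) : Prop := {
  stable_integral_linear : forall (a b : R) (f g : R -> R),
    Lalpha f -> Lalpha g ->
    {ae P, forall w,
      I (fun s => a * f s + b * g s) w = a * I f w + b * I g w} ;
  stable_integral_law : forall f : R -> R, Lalpha f ->
    is_SaS (fine 'N[@lebesgue_measure R]_(alpha%:E)[EFin \o f]) (I f) ;
  stable_integral_scattered : forall (n : nat) (f : 'I_n -> R -> R),
    (forall i, Lalpha (f i)) ->
    (forall i j, i != j -> ae_disjoint_supports (f i) (f j)) ->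
    independent_RVs (fun i => I (f i) : T -> R) }.

Definition pos_pow (x kappa : R) : R := if 0 < x then x `^ kappa else 0.

Definition kernel_X (u v s : R) : R :=
  pos_pow (u - s) (v - alpha^-1) - pos_pow (- s) (v - alpha^-1).

Definition dom_X : set (R * R) := `[0, 1] `*` `]alpha^-1, 1[.

Record is_field_X (I : (R -> R) -> {RV P >-> R}) (X : R -> R -> {RV P >-> R})
    : Prop := {
  field_X_version : forall u v : R, dom_X (u, v) ->
    {ae P, forall w, X u v w = I (kernel_X u v) w} ;
  field_X_continuous : forall w : T,
    {within dom_X, continuous (fun z : R * R => X z.1 z.2 w)} }.

Definition LMSM (X : R -> R -> {RV P >-> R}) (H : R -> R) (t : R) : T -> R :=
  X t (H t).

End stable_integral.

Section estimator.
Context (R : realType) (T : Type).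
Variable Y : R -> T -> R.

Definition log2 (x : R) : R := ln x / ln 2.

Definition coef_a (L l : nat) : R := (-1) ^+ (L - l) * 'C(L, l)%:R.

Definition incr_d (L N k : nat) (w : T) : R :=
  \sum_(l < L.+1) coef_a L l * Y ((k + l)%:R / N%:R) w.

(* Indices range over {0, ..., N - L}; meant for L <= N. *)
Definition nu (L N : nat) (I : set R) : {set 'I_(N - L).+1} :=
  [set k : 'I_(N - L).+1 | (k%:R / N%:R) \in I]%SET.

Definition power_var (L : nat) (beta : R) (N : nat) (I : set R) (w : T) : R :=
  #|nu L N I|%:R^-1 * \sum_(k in nu L N I) `|incr_d L N k w| `^ beta.

Definition trunc_T (beta x : R) : R :=
  Num.min (2 `^ beta) (Num.max x (2 `^ (beta / 2))).

(* x / 0 = 0 here; for the LMSM the denominator is almost surely positive as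
   soon as nu L (2 * N) I is nonempty. *)
Definition H_hat (L : nat) (beta : R) (N : nat) (I : set R) (w : T) : R :=
  beta^-1 * log2 (trunc_T beta
    (power_var L beta N I w / power_var L beta (2 * N) I w)).

End estimator.

Definition len (R : realType) (I : set R) : R :=
  fine (@lebesgue_measure R I).

Definition Lambda_exp (R : realType) (L : nat) (beta p : R) : R :=
  (2 * beta * (L%:R - 1)) /
  ((p + 4) * beta * (L%:R - 1) + 2 * (p + 1)).

(* The infimum is a minimum for continuous H on a segment, see
   [min_on_attained]; a Hoelder function is continuous. *)
Definition min_on (R : realType) (H : R -> R) (I : set R) : R := inf (H @` I).

Lemma min_on_attained (R : realType) (H : R -> R) (a b : R) : a <= b ->
  {within `[a, b], continuous H} ->
  exists2 t, `[a, b]%classic t &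
    H t = min_on H `[a, b] /\ forall s, `[a, b]%classic s -> H t <= H s.
Proof.
move=> ab cH; have [t tab Ht] := EVT_min ab cH.
exists t => //; split => //.
apply/eqP; rewrite eq_le; apply/andP; split.
- apply: lb_le_inf; first by exists (H t), t.
  by move=> _ [s sab <-]; exact: Ht.
- apply: ge_inf; last by exists t.
  by exists (H t) => _ [s sab <-]; exact: Ht.
Qed.

(* Main.v *)
Require Import Defs.
From HB Require Import structures.
From mathcomp Require Import all_boot all_order all_algebra.
From mathcomp Require Import all_classical all_reals all_analysis.
From mathcomp Require Import measurable_realfun.
From mathcomp Require Import ring lra zify.

Set Implicit Arguments.
Unset Strict Implicit.
Unset Printing Implicit Defensive.

Import Order.TTheory GRing.Theory Num.Theory.
Import numFieldNormedType.Exports.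

Local Open Scope classical_set_scope.
Local Open Scope ring_scope.

(** Freezing the Hurst function at [k / N] turns the increment [d_(N,k)] into a stable
    integral whose kernel is, up to translation, dilation and the factor [N^(-H)], one
    fixed profile: the [L]-th difference of a power. By the moment formula for stable
    variables, the power variation [V_N(I)] should therefore be close to the average
    [R_N] over the grid of the weights [psi (H t) * N^(- beta * H t)], where [psi] is
    bounded, bounded below and Hoelder continuous. Halving the mesh multiplies each weight
    by [2^(- beta * H t)]. Since the largest weights sit where [H] is close to its minimum
    [h], the ratio [V_N / V_(2 N)] is close to [2^(beta * h)], and the truncated logarithm
    recovers [h].

    The error has three sources.

    - Bias ([log_ratio_bias]). The logarithm of [R_N / R_(2 N)] differs from
      [beta * h * ln 2] by the share of the weights at points where [H] exceeds [h]. That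
      share is controlled by the oscillation of [H] on [I], and also by [ln (ln N) / ln N],
      because the points where [H - h] exceeds a multiple of this quantity have weights
      smaller by a power of [ln N]. The comparison of the sums over the two grids costs
      [mesh_error].

    - Freezing ([freezing_error]). The kernels depend on the Hurst index in a Lipschitz way
      ([kernel_lipschitz_envelope]), so the error is an [alpha]-stable variable of scale
      [N^(- rho)], against a main term of order at least [N^(- sup H)]. As
      [beta * 4 <= 1 < alpha], its power [beta] has a moment of order four.

    - Fluctuation ([power_variation_approximation]). An [L]-th difference of a power decays
      fast ([stencil_tail_bound]). Cutting the kernel [m] mesh steps in the past leaves near
      parts that are independent once their indices are [m + L] apart, and far parts of
      relative size [m^(- (L - 1))]. The variance of the average of the near parts is of
      order [m / (N * lambda(I))], and the choice of [m] that balances the two terms gives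
      [dispersion].

    [relative_fluctuation] divides the last two errors by [R_N]. The fluctuation is of the
    order of the largest weights, [N^(- beta * h)], and [R_N] is smaller by the factor [gain]
    at most ([weight_mean_ge]). [estimator_error] adds the three
    contributions through the logarithm, and falls back on the trivial bound, by one, where
    a relative error is not small. For the same reason second moments of the fluctuation
    are enough for every exponent [p <= 4]: the error is at most one, so its power [p] is
    at most its power [min p 2] ([error_moment]). [variance_rate_le] finally
    compares the resulting rate with the third term of the bound. *)

(** * Affine changes of variables *)

Section affine_change_of_variables.
Context {R : realType}.
Local Notation mu := (@lebesgue_measure R).

Let affine (a b x : R) : measurableTypeR R := a * x + b.

Let affine_measurable a b : measurable_fun [set: measurableTypeR R] (affine a b).
Proof. by apply: measurable_funD => //; exact: measurable_funM. Qed.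

Let affine_preimage a b c d : 0 < a ->
  affine a b @^-1` `]c, d] = `](c - b) / a, (d - b) / a]%classic.
Proof.
move=> a0; apply/seteqP; split => x /=; rewrite /affine !in_itv /=;
  by rewrite ltr_pdivrMr// ler_pdivlMr// lerBrDr ltrBlDr mulrC.
Qed.

Let affine_image a b : {measure set (measurableTypeR R) -> \bar R} :=
  measure_function_pushforward__canonical__measure_function_Measure mu
    (affine_measurable a b).

(** Lebesgue measure is determined by its values on half-open intervals, hence it is a
    multiple of its own image by an affine map. *)
Let lebesgue_measure_affine (a b : R) (a0 : 0 < a) (A : set R) :
  measurable A -> mu A = mscale (NngNum (ltW a0)) (affine_image a b) A.
Proof.
move=> mA.
apply: (@lebesgue_measure_unique R (mscale (NngNum (ltW a0)) (affine_image a b))) => //.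
move=> _ [[c d] _ <-].
transitivity (a%:E * mu (affine a b @^-1` `]c, d]))%E; last by [].
rewrite affine_preimage//.
rewrite !lebesgue_measure_itv /= !lte_fin ltr_pM2r ?invr_gt0// ltrD2r.
case: ifPn => // _; last by rewrite mule0.
by rewrite -!EFinB -EFinM; congr EFin; field; rewrite gt_eqF.
Qed.

Lemma ge0_integral_affine (a b : R) (f : R -> \bar R) : 0 < a ->
  measurable_fun [set: R] f -> (forall x, 0 <= f x)%E ->
  (\int[mu]_x f (a * x + b)%R = (a^-1)%:E * \int[mu]_x f x)%E.
Proof.
move=> a0 mf f0.
have -> : (\int[mu]_x f x =
   \int[mscale (NngNum (ltW a0)) (affine_image a b)]_x f x)%E.
  by apply: eq_measure_integral => A mA _; exact: lebesgue_measure_affine.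
rewrite ge0_integral_mscale//= ge0_integral_pushforward//.
by rewrite preimage_setT muleA -EFinM mulVf ?gt_eqF// mul1e.
Qed.

Lemma ge0_integral_oppr (f : R -> \bar R) :
  measurable_fun [set: R] f -> (forall x, 0 <= f x)%E ->
  (\int[mu]_x f (- x)%R = \int[mu]_x f x)%E.
Proof.
move=> mf f0.
have mN : measurable_fun [set: R] (-%R : R -> measurableTypeR R).
  exact: oppr_measurable.
pose m := measure_function_pushforward__canonical__measure_function_Measure mu mN.
have -> : (\int[mu]_x f x = \int[m]_x f x)%E.
  by apply: eq_measure_integral => A mA _; exact/esym/lebesgue_measureN.
by rewrite ge0_integral_pushforward// preimage_setT.
Qed.

End affine_change_of_variables.

(** * Integrals of powers *)

Section power_integrals.
Context {R : realType}.
Local Notation mu := (@lebesgue_measure R).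

Lemma continuous_powR (r x : R) : 0 < x -> {for x, continuous (@powR R ^~ r)}.
Proof.
move=> x0; apply: differentiable_continuous; apply/derivable1_diffP.
exact: (@ex_derive _ _ _ _ _ _ _ (is_derive1_powR r x0)).
Qed.

Lemma powR_cvg_pinfty (r : R) : 0 < r -> x `^ (- r) @[x --> +oo] --> (0 : R).
Proof.
move=> r0; apply/cvgrPdist_lt => e e0; near=> x.
have x0 : 0 < x by near: x; exact: nbhs_pinfty_gt.
have xe : e `^ (- r^-1) < x by near: x; exact: nbhs_pinfty_gt.
rewrite sub0r normrN ger0_norm ?powR_ge0// powRN -ltf_pV2 ?posrE ?invr_gt0 ?powR_gt0//.
rewrite invrK; have -> : e^-1 = (e `^ (- r^-1)) `^ r.
  by rewrite -powRrM mulNr mulVf ?gt_eqF// powR_inv1// ltW.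
by rewrite gt0_ltr_powR ?nnegrE ?powR_ge0// ltW.
Unshelve. all: by end_near. Qed.

Lemma integral_powR_tail (a m : R) : 0 < a -> 0 < m ->
  (\int[mu]_(x in `[m, +oo[) (x `^ (- a - 1))%:E = (m `^ (- a) / a)%:E)%E.
Proof.
move=> a0 m0; pose F (x : R) := - a^-1 * x `^ (- a).
have dF (x : R) : 0 < x -> is_derive x 1 F (x `^ (- a - 1)).
  move=> x0; have dx := is_derive1_powR (- a) x0.
  apply: is_derive_eq.
  by rewrite /GRing.scale /= mulrA mulrNN mulVf ?gt_eqF// mul1r.
rewrite (@ge0_continuous_FTC2y _ _ F m 0).
- by rewrite /F -EFinB sub0r mulNr opprK mulrC.
- by move=> x _; exact: powR_ge0.
- apply: continuous_in_subspaceT => x; rewrite inE/= in_itv/= andbT => mx.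
  by apply: continuous_powR; exact: lt_le_trans mx.
- have -> : 0 = - a^-1 * 0 :> R by rewrite mulr0.
  by apply: cvgMr; exact: powR_cvg_pinfty.
- move=> x mx; have x0 : 0 < x by exact: lt_trans mx.
  exact: (@ex_derive _ _ _ _ _ _ _ (dF _ x0)).
- apply: cvg_at_right_filter; apply: differentiable_continuous.
  by apply/derivable1_diffP; exact: (@ex_derive _ _ _ _ _ _ _ (dF _ m0)).
- move=> x; rewrite in_itv/= andbT => mx; rewrite derive1E.
  by apply: (@derive_val _ _ _ _ _ _ _ (dF _ _)); exact: lt_trans mx.
Qed.

Lemma integral_powR_near0 (a : R) : 0 < a ->
  (\int[mu]_(x in `]0%R, 1%R]) (x `^ (a - 1))%:E <= (a^-1)%:E)%E.
Proof.
move=> a0; pose F (x : R) := a^-1 * x `^ a.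
have dF (x : R) : 0 < x -> is_derive x 1 F (x `^ (a - 1)).
  move=> x0; have dx := is_derive1_powR a x0.
  apply: is_derive_eq.
  by rewrite /GRing.scale /= mulrA mulVf ?gt_eqF// mul1r.
have cF (x : R) : 0 < x -> {for x, continuous F}.
  move=> x0; apply: differentiable_continuous; apply/derivable1_diffP.
  exact: (@ex_derive _ _ _ _ _ _ _ (dF _ x0)).
(* The derivative of [F] may be unbounded at 0: the fundamental theorem of calculus is
   applied on the segments from [1 / (n + 2)] to 1, which exhaust the interval. *)
have small n : (\int[mu]_(x in `[(n.+2%:R^-1)%R, 1%R]) (x `^ (a - 1))%:E <= (a^-1)%:E)%E.
  have e0 : 0 < n.+2%:R^-1 :> R by rewrite invr_gt0.
  rewrite (@continuous_FTC2 _ _ F).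
  - rewrite -EFinB lee_fin /F powR1 mulr1 lerBlDr lerDl mulr_ge0 ?powR_ge0//.
    by rewrite invr_ge0 ltW.
  - by rewrite invf_lt1// ltr1n.
  - apply: continuous_in_subspaceT => x; rewrite inE/= in_itv/= => /andP[ex _].
    by apply: continuous_powR; exact: lt_le_trans ex.
  - split; [move=> x|apply: cvg_at_right_filter; exact: cF
      |apply: cvg_at_left_filter; exact: cF].
    rewrite in_itv/= => /andP[ex _].
    by apply: (@ex_derive _ _ _ _ _ _ _ (dF _ _)); exact: lt_trans ex.
  - move=> x; rewrite in_itv/= => /andP[ex _]; rewrite derive1E.
    by apply: (@derive_val _ _ _ _ _ _ _ (dF _ _)); exact: lt_trans ex.
have -> : `]0, 1]%classic = \bigcup_n `[n.+2%:R^-1, 1]%classic :> set R.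
  apply/seteqP; split => x /=; rewrite in_itv/=.
    move=> /andP[x0 x1]; exists (Num.truncn x^-1) => //=; rewrite in_itv/= x1 andbT.
    rewrite -[leRHS]invrK lef_pV2 ?posrE ?invr_gt0//.
    by apply/ltW/(lt_trans (truncnS_gt _)); rewrite ltr_nat.
  move=> [n _] /=; rewrite in_itv/= => /andP[nx ->]; rewrite andbT.
  by apply: lt_le_trans nx; rewrite invr_gt0.
have mE n : measurable `[n.+2%:R^-1 : R, 1]%classic by exact: measurable_itv.
have mf n : measurable_fun `[n.+2%:R^-1 : R, 1]%classic (fun x => (x `^ (a - 1))%:E).
  by apply/measurable_EFinP; apply: measurable_funTS; exact: measurable_powR.
apply: (cvge_to_le (ge0_nondecreasing_set_cvg_integral (mu := mu) _ mE mf _)).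
- move=> n m nm; apply/subsetPset => x /=; rewrite !in_itv/= => /andP[nx ->].
  rewrite andbT; apply: le_trans nx; rewrite lef_pV2 ?posrE ?ltr0n// ler_nat.
  by rewrite !ltnS.
- by move=> n x _; rewrite lee_fin powR_ge0.
- by apply: nearW => n; exact: small.
Qed.

End power_integrals.

(** * Fractional moments of stable variables *)

Section sine_bounds.
Context {R : realType}.

Lemma one_minus_cos_le_sqr (x : R) : 0 <= x -> 1 - cos x <= x ^+ 2.
Proof.
have sinle (y : R) : 0 <= y -> sin y <= y.
  rewrite le_eqVlt => /predU1P[<-|y0]; first by rewrite sin0.
  have [|c _] := @MVT _ (@sin R) (@cos R) 0 y y0 (fun x _ => is_derive_sin x).
    exact/continuous_subspaceT/continuous_sin.
  rewrite sin0 !subr0 => ->.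
  by rewrite -[leRHS]mul1r ler_wpM2r ?cos_le1// ltW.
rewrite le_eqVlt => /predU1P[<-|x0]; first by rewrite cos0 subrr expr0n.
have [|c] := @MVT _ (@cos R) (fun x => - sin x) 0 x x0 (fun x _ => is_derive_cos x).
  exact/continuous_subspaceT/continuous_cos.
rewrite in_itv /= => /andP[c0 cx].
rewrite cos0 subr0 -[_ - 1]opprB mulNr => /oppr_inj ->.
rewrite expr2 ler_wpM2r ?(ltW x0)//.
by apply: (le_trans (sinle _ (ltW c0))); exact: ltW.
Qed.

Lemma one_minus_expN_le (x : R) : 1 - expR (- x) <= x.
Proof. by rewrite lerBlDr -lerBlDl; exact: expR_ge1Dx. Qed.

End sine_bounds.

Section two_pieces.
Context {R : realType}.
Local Notation mu := (@lebesgue_measure R).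

Lemma le_integral_two_pieces (f f1 f2 : R -> R) (A B : set R) :
  measurable A -> measurable B -> measurable_fun setT f ->
  measurable_fun A f1 -> measurable_fun B f2 ->
  (forall x, 0 <= f x) -> (forall x, 0 <= f1 x) -> (forall x, 0 <= f2 x) ->
  (forall x, A x -> f x <= f1 x) -> (forall x, B x -> f x <= f2 x) ->
  (forall x, ~ A x -> ~ B x -> f x = 0) ->
  (\int[mu]_x (f x)%:E <=
   \int[mu]_(x in A) (f1 x)%:E + \int[mu]_(x in B) (f2 x)%:E)%E.
Proof.
move=> mA mB mf mf1 mf2 f0 f10 f20 fA fB fAB.
rewrite [X in (_ <= X + _)%E]integral_mkcond [X in (_ <= _ + X)%E]integral_mkcond.
rewrite -ge0_integralD//=.
- apply: ge0_le_integral => //=.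
  + by move=> x _; rewrite lee_fin.
  + exact/measurable_EFinP.
  + apply: emeasurable_funD; rewrite -measurable_restrictT//; exact/measurable_EFinP.
  move=> x _; rewrite !restrict_EFin lee_fin /patch.
  case: ifPn => [|nA]; first rewrite inE => Ax.
    by rewrite (le_trans (fA _ Ax))// lerDl; case: ifP.
  case: ifPn => [|nB]; first by rewrite inE => Bx; rewrite add0r fB.
  by rewrite addr0 fAB//; [move: nA|move: nB]; rewrite notin_setE.
- by move=> x _; apply: erestrict_ge0 => y _; rewrite lee_fin.
- by rewrite -measurable_restrictT//; exact/measurable_EFinP.
- by move=> x _; apply: erestrict_ge0 => y _; rewrite lee_fin.
- by rewrite -measurable_restrictT//; exact/measurable_EFinP.
Qed.

End two_pieces.

Section levy_weight.
Context {R : realType}.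
Local Notation mu := (@lebesgue_measure R).
Implicit Types (phi : R -> R) (g : R).

Lemma measurable_pos_pow (k : R) : measurable_fun [set: R] (fun x : R => pos_pow x k).
Proof.
have m1 : measurable_fun [set: R] (fun x : R => 0 < x).
  by apply: measurable_fun_ltr; [exact: measurable_cst|exact: measurable_id].
have m2 := @measurable_powR R k.
rewrite /pos_pow; apply: measurable_fun_ifT; [exact: m1|exact: m2|exact: measurable_cst].
Qed.

Lemma pos_pow_ge0 (x k : R) : 0 <= pos_pow x k.
Proof. by rewrite /pos_pow; case: ifP => // _; exact: powR_ge0. Qed.

Lemma pos_powM (a x k : R) : 0 < a -> pos_pow (a * x) k = a `^ k * pos_pow x k.
Proof.
move=> a0; rewrite /pos_pow pmulr_rgt0//; case: ifPn => [x0|_]; last by rewrite mulr0.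
by rewrite powRM// ltW.
Qed.

(** The integral of [phi] against the density [x^(- g - 1)] of the Levy measure of a
    one-sided [g]-stable law. *)
Definition levy_integral phi g : \bar R :=
  (\int[mu]_x (phi x * pos_pow x (- g - 1))%:E)%E.

Lemma measurable_levy phi g : measurable_fun setT phi ->
  measurable_fun setT (fun x => (phi x * pos_pow x (- g - 1))%:E).
Proof.
move=> mphi; apply/measurable_EFinP; apply: measurable_funM => //.
exact: measurable_pos_pow.
Qed.

(** The density is homogeneous, so a dilation of the argument only rescales the integral.
    Applied to [1 - cos], this makes [a^g] appear out of trigonometric functions. *)
Lemma levy_integralZ phi g a : measurable_fun setT phi -> (forall x, 0 <= phi x) ->
  phi 0 = 0 -> 0 < g -> 0 <= a ->
  levy_integral (fun x => phi (a * x)) g = ((a `^ g)%:E * levy_integral phi g)%E.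
Proof.
move=> mphi phi0 phi00 g0; rewrite le_eqVlt => /predU1P[<-|a0].
  rewrite powR0 ?gt_eqF// mul0e /levy_integral.
  by under eq_integral do rewrite mul0r phi00 mul0r; rewrite integral0.
have fge0 x : (0 <= (phi x * pos_pow x (- g - 1))%:E)%E.
  by rewrite lee_fin mulr_ge0// pos_pow_ge0.
have mf := measurable_levy g mphi.
transitivity ((a `^ (g + 1))%:E *
    \int[mu]_x (phi (a * x + 0) * pos_pow (a * x + 0) (- g - 1))%:E)%E.
  rewrite -ge0_integralZl_EFin ?powR_ge0//; last first.
    have ma : measurable_fun [set: R] (fun x : R => a * x + 0).
      by apply: measurable_funD => //; exact: measurable_funM.
    exact: (measurableT_comp mf ma).
  apply: eq_integral => x _; rewrite addr0 -EFinM; congr EFin.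
  rewrite pos_powM// [RHS]mulrCA; congr *%R.
  rewrite mulrA -powRD; last by rewrite (gt_eqF a0) implybT.
  by rewrite (_ : g + 1 + (- g - 1) = 0) ?powRr0 ?mul1r//; ring.
rewrite (ge0_integral_affine 0 a0 mf)// muleA -EFinM; congr (_%:E * _)%E.
by rewrite powRD ?(gt_eqF a0) ?implybT// powRr1 ?(ltW a0)// mulfK// gt_eqF.
Qed.

(** Near zero the bound by [x^b] compensates the singularity because [g < b], and far from
    zero boundedness is enough because [0 < g]. *)
Lemma levy_integral_lty phi g b : measurable_fun setT phi ->
  (forall x, 0 <= phi x <= 2) -> 0 < g < b ->
  (forall x, 0 < x -> phi x <= x `^ b) ->
  (levy_integral phi g < +oo)%E.
Proof.
move=> mphi phi02 /andP[g0 gb] phib.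
have fge0 x : (0 <= (phi x * pos_pow x (- g - 1))%:E)%E.
  by rewrite lee_fin mulr_ge0// ?pos_pow_ge0//; case/andP: (phi02 x).
have mf := measurable_levy g mphi.
apply: (@le_lt_trans _ _ (\int[mu]_(x in `]0%R, 1%R]) (x `^ (b - g - 1))%:E +
   \int[mu]_(x in `[1%R, +oo[) (2 * x `^ (- g - 1))%:E)%E).
  apply: le_integral_two_pieces => //.
  - by apply/measurable_EFinP.
  - by apply: measurable_funTS; exact: measurable_powR.
  - by apply: measurable_funTS; apply: measurable_funM => //; exact: measurable_powR.
  - by move=> x; exact: powR_ge0.
  - by move=> x; rewrite mulr_ge0// powR_ge0.
  - move=> x /=; rewrite in_itv/= => /andP[x0 _].
    rewrite /pos_pow x0 (_ : b - g - 1 = b + (- g - 1)); last by ring.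
    by rewrite powRD ?(gt_eqF x0) ?implybT// ler_wpM2r ?powR_ge0// phib.
  - move=> x /=; rewrite in_itv/= andbT => x1.
    rewrite /pos_pow (lt_le_trans ltr01 x1) ler_wpM2r ?powR_ge0//.
    by case/andP: (phi02 x).
  - move=> x /=; rewrite !in_itv/= andbT /pos_pow => nA nB.
    case: ifPn => [x0|]; last by rewrite mulr0.
    by exfalso; case: (leP x 1) => x1; [apply: nA; rewrite x0|apply: nB; exact: ltW].
apply: lte_add_pinfty.
  by apply: le_lt_trans (integral_powR_near0 _) (ltry _); rewrite subr_gt0.
under eq_integral do rewrite EFinM.
rewrite ge0_integralZl_EFin//; last 2 first.
- by move=> x _; rewrite lee_fin powR_ge0.
- by apply/measurable_EFinP; apply: measurable_funTS; exact: measurable_powR.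
by rewrite integral_powR_tail// -EFinM ltry.
Qed.

Lemma levy_integral_gt0 phi g e : measurable_fun setT phi ->
  (forall x, 0 <= phi x) -> 0 < g -> 0 < e ->
  (forall x, 2^-1 <= x <= 1 -> e <= phi x) ->
  (0 < levy_integral phi g)%E.
Proof.
move=> mphi phi0 g0 e0 phie.
have fge0 x : (0 <= (phi x * pos_pow x (- g - 1))%:E)%E.
  by rewrite lee_fin mulr_ge0// pos_pow_ge0.
have mf := measurable_levy g mphi.
apply: (@lt_le_trans _ _ (\int[mu]_(x in `[(2^-1)%R, 1%R]) e%:E)%E).
  rewrite integral_cst//= lebesgue_measure_itv/= lte_fin invf_lt1// ltr1n/=.
  by rewrite -EFinB -EFinM lte_fin mulr_gt0// subr_gt0 invf_lt1// ltr1n.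
apply: (@le_trans _ _ (\int[mu]_(x in `[(2^-1)%R, 1%R]) (phi x * pos_pow x (- g - 1))%:E)%E).
  apply: ge0_le_integral => //.
  - by move=> x _; rewrite lee_fin ltW.
  - exact: measurable_funTS.
  move=> x /=; rewrite in_itv/= => /andP[x2 x1]; rewrite lee_fin.
  have x0 : 0 < x by apply: lt_le_trans x2; rewrite invr_gt0.
  rewrite -[leLHS]mulr1; apply: ler_pM => //; [exact: ltW|by rewrite phie// x2|].
  rewrite /pos_pow x0 -[leLHS](powRr0 x); apply: ger_powR; first by rewrite x0.
  by lra.
by apply: ge0_subset_integral.
Qed.

End levy_weight.

Section stable_moments.
Context {R : realType} (d : measure_display) (T : measurableType d).
Variables (P : probability T R) (alpha : R).
Hypothesis alpha12 : 1 < alpha < 2.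
Local Notation mu := (@lebesgue_measure R).

Definition cos_defect (x : R) := 1 - cos x.
Definition stable_defect (x : R) := 1 - expR (- (`|x| `^ alpha)).

Let measurable_cosR : measurable_fun [set: R] (@cos R).
Proof. by apply: continuous_measurable_fun; exact: continuous_cos. Qed.

Let mcos : measurable_fun setT cos_defect.
Proof. exact: measurable_funB. Qed.

Let mstable : measurable_fun setT stable_defect.
Proof.
have h1 : measurable_fun [set: R] (fun x : R => `|x|) by exact: normr_measurable.
have h2 := measurableT_comp (@measurable_powR R alpha) h1.
have h3 := measurableT_comp (@measurable_expR R) (measurable_funN h2).
exact: (measurable_funB (@measurable_cst _ _ _ _ _ (1 : R)) h3).
Qed.

Let cos_ge0 x : 0 <= cos_defect x.
Proof. by rewrite subr_ge0 cos_le1. Qed.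

Let stable_ge0 x : 0 <= stable_defect x.
Proof. by rewrite subr_ge0 expR_le1 oppr_le0 powR_ge0. Qed.

Let cos_levy_fin g : 0 < g <= 1 -> (0 < levy_integral cos_defect g < +oo)%E.
Proof.
move=> /andP[g0 g1]; apply/andP; split; last first.
  apply: (@levy_integral_lty _ _ _ 2) => //.
  - move=> x; rewrite cos_ge0 /cos_defect lerBlDr -lerBlDl.
    by apply: le_trans (cos_geN1 x); lra.
  - by rewrite g0; lra.
  - move=> x x0; rewrite powR_mulrn ?(ltW x0)// /cos_defect.
    by apply: one_minus_cos_le_sqr; exact: ltW.
have pi2 : (1 : R) < pi by apply: lt_le_trans (pi_ge2 R); rewrite ltr1n.
apply: (levy_integral_gt0 (e := 1 - cos (2^-1)) mcos cos_ge0 g0).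
  rewrite subr_gt0 -[ltRHS]cos0 ltr_cos ?in_itv/=; lra.
move=> x /andP[x2 x1]; rewrite lerB//; move: x2.
by rewrite le_eqVlt => /predU1P[->//|x2]; rewrite ltW// ltr_cos ?in_itv/=; lra.
Qed.

Let stable_levy_fin g : 0 < g <= 1 -> (0 < levy_integral stable_defect g < +oo)%E.
Proof.
move=> /andP[g0 g1]; case/andP: alpha12 => a1 a2; apply/andP; split; last first.
  apply: (@levy_integral_lty _ _ _ alpha) => //.
  - move=> x; rewrite stable_ge0 /stable_defect.
    by have := expR_ge0 (- (`|x| `^ alpha)); lra.
  - by rewrite g0; lra.
  - by move=> x x0; apply: (le_trans (one_minus_expN_le _)); rewrite gtr0_norm.
apply: (levy_integral_gt0 (e := stable_defect 2^-1) mstable stable_ge0 g0).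
  by rewrite subr_gt0 expR_lt1 oppr_lt0 powR_gt0 ?normr_gt0 ?invr_eq0 ?pnatr_eq0.
move=> x /andP[x2 x1]; rewrite /stable_defect lerB// ler_expR lerN2.
rewrite !ger0_norm ?invr_ge0//; last by lra.
by rewrite ge0_ler_powR ?nnegrE//; lra.
Qed.

(** The moment of order [g] of the absolute value of a symmetric [alpha]-stable variable of
    scale one. *)
Definition stable_moment g : R :=
  fine (levy_integral stable_defect g) / fine (levy_integral cos_defect g).

Lemma stable_moment_gt0 g : 0 < g <= 1 -> 0 < stable_moment g.
Proof. by move=> g01; rewrite divr_gt0// fine_gt0 ?cos_levy_fin ?stable_levy_fin. Qed.

Let expectation_cos_defect (sigma xi : R) (X : {RV P >-> R}) :
  is_SaS P alpha sigma X ->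
  (\int[P]_w (cos_defect (X w * xi))%:E = (stable_defect (sigma * xi))%:E)%E.
Proof.
move=> /(_ xi) [] cosE _.
have mX : measurable_fun setT (fun w => cos (xi * X w)).
  apply: measurableT_comp => //; exact: measurable_funM.
have iX : P.-integrable setT (EFin \o (fun w => cos (xi * X w))).
  apply: measurable_bounded_integrable => //.
    by rewrite -ge0_fin_numE// fin_num_measure.
  exists 1; split; first exact: num_real.
  by move=> M M1 w _ /=; apply: le_trans (cos_max _) (ltW M1).
rewrite /cos_defect /stable_defect -cosE.
under eq_integral do rewrite EFinB mulrC.
rewrite integralB_EFin//; last exact: finite_measure_integrable_cst.
rewrite integral_cst//= probability_setT mul1e EFinB; congr (_ - _)%E.
by rewrite expectation.unlock fineK//; exact: (integrable_fin_num measurableT iX).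
Qed.

(** Integrating [1 - cos (x * xi)] in [xi] against [xi^(- g - 1)] gives [`|x|^g] up to a
    constant. By Tonelli's theorem the expectation can be taken first, and it is then a
    value of the characteristic function. *)
Lemma SaS_moment (sigma g : R) (X : {RV P >-> R}) : 0 <= sigma ->
  is_SaS P alpha sigma X -> 0 < g <= 1 ->
  (\int[P]_w (`|X w| `^ g)%:E = (stable_moment g * sigma `^ g)%:E)%E.
Proof.
move=> sigma0 SX g01; have /andP[g0 g1] := g01.
have /andP[c0 coo] := cos_levy_fin g01; have /andP[s0 soo] := stable_levy_fin g01.
have cfin : levy_integral cos_defect g \is a fin_num.
  by rewrite ge0_fin_numE// ltW.
have sfin : levy_integral stable_defect g \is a fin_num.
  by rewrite ge0_fin_numE// ltW.
have cne0 : fine (levy_integral cos_defect g) != 0.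
  by rewrite gt_eqF// fine_gt0// c0.
have mXg : measurable_fun setT (fun w => `|X w| `^ g).
  apply: (measurableT_comp (@measurable_powR R g)).
  exact: measurableT_comp.
pose f (z : T * R) := (cos_defect (X z.1 * z.2) * pos_pow z.2 (- g - 1))%:E.
have mf : measurable_fun setT f.
  apply/measurable_EFinP; apply: measurable_funM; last first.
    exact: (measurableT_comp (@measurable_pos_pow R (- g - 1)) measurable_snd).
  apply: (measurableT_comp mcos); apply: measurable_funM => //.
  by apply: measurableT_comp => //; exact: measurable_fst.
have f0 z : (0 <= f z)%E.
  by rewrite lee_fin mulr_ge0// pos_pow_ge0.
(* Both sides are the double integral of [f]. *)
have key : (\int[P]_w (`|X w| `^ g)%:E * levy_integral cos_defect g =
    (sigma `^ g)%:E * levy_integral stable_defect g)%E.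
  rewrite -ge0_integralZr//; last 2 first.
  - exact/measurable_EFinP.
  - exact: ltW.
  rewrite -levy_integralZ//; last first.
    by rewrite /stable_defect normr0 powR0 ?oppr0 ?expR0 ?subrr// gt_eqF//; case/andP: alpha12; lra.
  transitivity (\int[P]_w \int[mu]_x f (w, x))%E.
    apply: eq_integral => w _.
    rewrite -levy_integralZ ?normr_ge0//; last by rewrite /cos_defect cos0 subrr.
    apply: eq_integral => x _; rewrite /f /= /cos_defect; congr (((_ - _) * _)%:E).
    by case: (ger0P (X w)) => // _; rewrite mulNr cosN.
  rewrite (fubini_tonelli (m1 := P) (m2 := mu) f)//; apply: eq_integral => x _.
  rewrite /f /= EFinM -(expectation_cos_defect x SX) -ge0_integralZr//.
  - apply/measurable_EFinP; apply: (measurableT_comp mcos).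
    exact: measurable_funM.
  - by move=> w _; rewrite lee_fin.
  - by rewrite lee_fin pos_pow_ge0.
rewrite /stable_moment -(fineK sfin) -(fineK cfin) -EFinM in key *.
have cpos : (0 < (fine (levy_integral cos_defect g))%:E)%E.
  by rewrite lte_fin fine_gt0// c0.
have ifin : (\int[P]_w (`|X w| `^ g)%:E \is a fin_num)%E.
  by move: key; case: (\int[P]_w _)%E => [//||]; rewrite ?gt0_mulye ?gt0_mulNye.
move: key; rewrite -(fineK ifin) -EFinM => -[] key; congr EFin.
by apply: (mulIf cne0); rewrite key; field.
Qed.

End stable_moments.

(** * The norm of the space of integrands *)

Section alpha_norm.
Context {R : realType}.
Variable alpha : R.
Hypothesis alpha1 : 1 < alpha.
Local Notation mu := (@lebesgue_measure R).
Implicit Types f g : R -> R.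

Definition alpha_norm (f : R -> R) : R := fine 'N[mu]_(alpha%:E)[EFin \o f].

Let alpha_neq0 : alpha != 0.
Proof. by rewrite gt_eqF// (lt_trans _ alpha1). Qed.

Lemma alpha_norm_ge0 f : 0 <= alpha_norm f.
Proof. by apply: fine_ge0; exact: Lnorm_ge0. Qed.

Lemma Lalpha_measurable f : Lalpha alpha f -> measurable_fun setT f.
Proof. by move=> Lf; exact: (set_mem (sub_Lfun_mfun Lf)). Qed.

Let Lalpha_finite f : Lalpha alpha f -> ('N[mu]_(alpha%:E)[EFin \o f])%E \is a fin_num.
Proof.
move=> Lf; have := set_mem (sub_Lfun_finLfun Lf).
rewrite /= /finite_norm => h; rewrite ge0_fin_numE; [exact: h|exact: Lnorm_ge0].
Qed.

Lemma measurable_normr_powR (f : R -> R) :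
  measurable_fun [set: R] f -> measurable_fun setT (fun x : R => `|f x| `^ alpha).
Proof.
move=> mf; apply: (measurableT_comp (@measurable_powR R alpha)).
exact: measurableT_comp.
Qed.

Lemma alpha_normE f : Lalpha alpha f ->
  (\int[mu]_x (`|f x| `^ alpha)%:E = (alpha_norm f `^ alpha)%:E)%E.
Proof.
move=> Lf; rewrite -poweR_EFin /alpha_norm fineK ?Lalpha_finite//.
by rewrite poweR_Lnorm//; under [RHS]eq_integral do rewrite /= poweR_EFin.
Qed.

Lemma Lalpha_norm_le f (C : R) : measurable_fun [set: R] f -> 0 <= C ->
  (\int[mu]_x (`|f x| `^ alpha)%:E <= (C `^ alpha)%:E)%E ->
  Lalpha alpha f /\ alpha_norm f <= C.
Proof.
move=> mf C0 Hf.
have N : ('N[mu]_(alpha%:E)[EFin \o f] <= C%:E)%E.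
  have : ('N[mu]_(alpha%:E)[EFin \o f] `^ alpha <= C%:E `^ alpha)%E.
    by rewrite poweR_Lnorm// poweR_EFin.
  case E : ('N[mu]_(alpha%:E)[EFin \o f])%E (Lnorm_ge0 mu alpha%:E (EFin \o f)) => [r| |]//.
    rewrite !poweR_EFin !lee_fin => r0.
    rewrite !leNgt; apply: contra => Cr.
    by rewrite gt0_ltr_powR ?nnegrE// (lt_trans _ alpha1).
  by move=> _; rewrite poweRyr// poweR_EFin.
have Noo : ('N[mu]_(alpha%:E)[EFin \o f] < +oo)%E by apply: le_lt_trans N (ltry _).
have Lf : Lalpha alpha f.
  by apply/andP; split; apply: mem_set; [exact: mf|exact: Noo].
by split => //; rewrite -lee_fin /alpha_norm fineK// Lalpha_finite.
Qed.

Lemma Lalpha_dominated f g (C : R) : measurable_fun [set: R] f -> 0 <= C ->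
  Lalpha alpha g -> (forall x, `|f x| <= C * `|g x|) ->
  Lalpha alpha f /\ alpha_norm f <= C * alpha_norm g.
Proof.
move=> mf C0 Lg fg; apply: Lalpha_norm_le => //.
  by rewrite mulr_ge0 ?alpha_norm_ge0.
rewrite powRM ?alpha_norm_ge0// EFinM -alpha_normE//.
have mg := measurable_normr_powR (Lalpha_measurable Lg).
rewrite -ge0_integralZl_EFin ?powR_ge0//; last exact/measurable_EFinP.
apply: ge0_le_integral => //.
- by apply/measurable_EFinP; exact: measurable_normr_powR.
- by apply/measurable_EFinP; exact: measurable_funM.
move=> x _; rewrite -EFinM lee_fin -powRM//.
by rewrite ge0_ler_powR ?nnegrE ?mulr_ge0// ltW// (lt_trans _ alpha1).
Qed.

Lemma LalphaZD (a b : R) f g : Lalpha alpha f -> Lalpha alpha g ->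
  Lalpha alpha (fun s => a * f s + b * g s).
Proof.
move=> Lf Lg.
have a1 : (1 <= alpha%:E)%E by rewrite lee_fin ltW.
have [L0 Llin] := @Lfun_submod_closed _ _ R mu _ a1.
have Lbg : b *: (g : R -> R^o) + (0 : R -> R^o) \in Lfun mu alpha%:E by apply: Llin.
rewrite addr0 in Lbg; exact: (Llin a f _ Lf Lbg).
Qed.

Lemma LalphaB f g : Lalpha alpha f -> Lalpha alpha g ->
  Lalpha alpha (fun s => f s - g s).
Proof.
move=> Lf Lg; rewrite (_ : (fun s => _) = (fun s => 1 * f s + -1 * g s)).
  exact: LalphaZD.
by apply/funext => s; rewrite mul1r mulN1r.
Qed.

(** The reverse triangle inequality in the form used to transfer Lipschitz bounds from
    kernels to norms. *)
Lemma alpha_norm_triangle f g : Lalpha alpha f -> Lalpha alpha g ->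
  alpha_norm f <= alpha_norm g + alpha_norm (fun s => f s - g s).
Proof.
move=> Lf Lg; have Lfg := LalphaB Lf Lg.
rewrite -lee_fin /alpha_norm EFinD !fineK ?Lalpha_finite//.
have -> : EFin \o f = EFin \o (g \+ (fun s => f s - g s)).
  by apply/funext => s /=; congr EFin; ring.
by apply: minkowski_EFin; [exact: Lalpha_measurable..|exact: ltW].
Qed.

Lemma alpha_norm_affine f (c a b : R) : 0 < a -> Lalpha alpha f ->
  Lalpha alpha (fun s => c * f (a * s + b)) /\
  alpha_norm (fun s => c * f (a * s + b)) = `|c| * a `^ (- alpha^-1) * alpha_norm f.
Proof.
move=> a0 Lf; have mf := Lalpha_measurable Lf.
have ma : measurable_fun [set: R] (fun s : R => a * s + b).
  by apply: measurable_funD => //; exact: measurable_funM.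
have mg : measurable_fun [set: R] (fun s => c * f (a * s + b)).
  by apply: measurable_funM => //; exact: (measurableT_comp mf ma).
pose D := `|c| * a `^ (- alpha^-1) * alpha_norm f.
have D0 : 0 <= D by rewrite !mulr_ge0 ?powR_ge0// alpha_norm_ge0.
have E : (\int[mu]_s (`|c * f (a * s + b)%R| `^ alpha)%:E = (D `^ alpha)%:E)%E.
  have mfa : measurable_fun setT (fun x => (`|f x| `^ alpha)%:E).
    by apply/measurable_EFinP; exact: measurable_normr_powR.
  transitivity ((`|c| `^ alpha)%:E * \int[mu]_s (`|f (a * s + b)%R| `^ alpha)%:E)%E.
    rewrite -ge0_integralZl_EFin ?powR_ge0//.
    - by apply: eq_integral => s _; rewrite normrM powRM// EFinM.
    - exact: (measurableT_comp mfa ma).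
  rewrite (ge0_integral_affine b a0 mfa); last by move=> x; rewrite lee_fin powR_ge0.
  rewrite alpha_normE// -!EFinM; congr EFin.
  rewrite /D !powRM ?mulr_ge0 ?powR_ge0 ?alpha_norm_ge0// -mulrA; congr (_ * (_ * _)).
  by rewrite -powRrM mulNr mulVf// powR_inv1// ltW.
have [Lg gD] := Lalpha_norm_le mg D0 (eq_ind_r (fun x => (x <= _)%E) (lexx _) E).
split => //; apply/eqP; rewrite eq_le gD /=.
move: E; rewrite alpha_normE// => -[E].
rewrite leNgt; apply/negP => lt.
have : alpha_norm (fun s => c * f (a * s + b)) `^ alpha < D `^ alpha.
  by rewrite gt0_ltr_powR ?nnegrE ?alpha_norm_ge0// (lt_trans _ alpha1).
by rewrite E ltxx.
Qed.

Lemma alpha_norm_lower f (c a b : R) : Lalpha alpha f -> 0 <= c -> a <= b ->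
  (forall x, a <= x <= b -> c <= `|f x|) ->
  c * (b - a) `^ (alpha^-1) <= alpha_norm f.
Proof.
move=> Lf c0 ab cf; have mf := Lalpha_measurable Lf.
have al0 : 0 < alpha by exact: lt_trans alpha1.
have : (((c * (b - a) `^ (alpha^-1)) `^ alpha)%:E <= (alpha_norm f `^ alpha)%:E)%E.
  rewrite -alpha_normE//.
  apply: (@le_trans _ _ (\int[mu]_(x in `[a, b]) (c `^ alpha)%:E)%E).
    rewrite integral_cst//= lebesgue_measure_itv/=; case: ifPn => [_|].
      rewrite -EFinB -EFinM lee_fin powRM ?powR_ge0// -powRrM mulVf// powRr1//.
      by rewrite subr_ge0.
    rewrite -leNgt lee_fin => ba; have -> : b - a = 0 by apply/eqP; rewrite subr_eq0 eq_le ba.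
    by rewrite powR0 ?invr_neq0// mulr0 powR0// mule0.
  have mfa : measurable_fun setT (fun x => (`|f x| `^ alpha)%:E).
    by apply/measurable_EFinP; exact: measurable_normr_powR.
  apply: (@le_trans _ _ (\int[mu]_(x in `[a, b]) (`|f x| `^ alpha)%:E)%E).
    apply: ge0_le_integral => //.
    - by move=> x _; rewrite lee_fin powR_ge0.
    - exact: measurable_funTS.
    move=> x /=; rewrite in_itv/= lee_fin => xab.
    by rewrite ge0_ler_powR ?nnegrE// ?(ltW al0)// cf.
  exact: ge0_subset_integral.
rewrite lee_fin !leNgt; apply: contra => lt.
by rewrite gt0_ltr_powR ?nnegrE ?alpha_norm_ge0// mulr_ge0 ?powR_ge0.
Qed.

End alpha_norm.

(** * Elementary estimates on powers *)

Section power_estimates.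
Context {R : realType}.
Implicit Types (x y k e : R).

Lemma expR_diff_le (a b : R) : `|expR a - expR b| <= `|a - b| * (expR a + expR b).
Proof.
have half (x y : R) : y <= x -> expR x - expR y <= (x - y) * expR x.
  move=> yx; have -> : expR y = expR x * expR (- (x - y)) by rewrite -expRD; congr expR; ring.
  rewrite -[X in X - _]mulr1 -mulrBr mulrC ler_wpM2r ?expR_ge0//.
  exact: one_minus_expN_le.
have [ab|/ltW ba] := leP b a.
  rewrite !ger0_norm ?subr_ge0 ?ler_expR//; apply: le_trans (half _ _ ab) _.
  by rewrite ler_wpM2l ?subr_ge0// lerDl expR_ge0.
rewrite distrC (distrC a) !ger0_norm ?subr_ge0 ?ler_expR//; apply: le_trans (half _ _ ba) _.
by rewrite ler_wpM2l ?subr_ge0// lerDr expR_ge0.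
Qed.

(** The mean value inequality in the exponent, at the price of a logarithm. *)
Lemma powR_exponent_diff x k1 k2 : 0 < x ->
  `|x `^ k1 - x `^ k2| <= `|k1 - k2| * (`|ln x| * (x `^ k1 + x `^ k2)).
Proof.
move=> x0; rewrite /powR (gt_eqF x0); apply: le_trans (expR_diff_le _ _) _.
by rewrite -mulrBl normrM mulrA.
Qed.

Lemma ln_le_powR x e : 0 < x -> 0 < e -> ln x <= e^-1 * x `^ e.
Proof.
move=> x0 e0; rewrite ler_pdivlMl// /powR gt_eqF//.
by apply: le_trans (expR_ge1Dx _); rewrite lerDr.
Qed.

(** The logarithm is absorbed by the power [x^k0] near zero, and is bounded by [W]
    elsewhere. *)
Lemma normr_ln_powR_le x k k0 (W : R) : 0 < x -> x <= W -> 1 <= W ->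
  0 < k0 -> k0 <= k <= 1 -> `|ln x| * x `^ k <= k0^-1 + W ^+ 2.
Proof.
move=> x0 xW W1 k00 /andP[k0k k1].
have [x1|/ltW x1] := leP x 1.
  rewrite ler0_norm ?ln_le0// -lnV ?posrE//.
  apply: (@le_trans _ _ (k0^-1 * x^-1 `^ k0 * x `^ k0)).
    apply: ler_pM; rewrite ?powR_ge0 ?ln_ge0 ?invf_ge1//.
      by apply: ln_le_powR => //; rewrite invr_gt0.
    by apply: ger_powR => //; rewrite x0.
  rewrite -mulrA -powRM ?invr_ge0 ?(ltW x0)// mulVf ?gt_eqF// powR1 mulr1.
  by rewrite lerDl sqr_ge0.
rewrite ger0_norm ?ln_ge0//; apply: (@le_trans _ _ (W * W)); last first.
  by rewrite -expr2 lerDr invr_ge0 ltW.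
apply: ler_pM; rewrite ?powR_ge0 ?ln_ge0//.
  apply: le_trans (ln_le_powR x0 ltr01) _.
  by rewrite invr1 mul1r powRr1// ltW.
by apply: le_trans xW; rewrite ler1_powR.
Qed.

Lemma pos_pow_exponent_lipschitz x k1 k2 k0 (W : R) : x <= W -> 1 <= W -> 0 < k0 ->
  k0 <= k1 <= 1 -> k0 <= k2 <= 1 ->
  `|pos_pow x k1 - pos_pow x k2| <= 2 * (k0^-1 + W ^+ 2) * `|k1 - k2|.
Proof.
move=> xW W1 k00 k1P k2P; rewrite /pos_pow; case: ifPn => [x0|_]; last first.
  rewrite subrr normr0 mulr_ge0// mulr_ge0// addr_ge0 ?sqr_ge0//.
  by rewrite invr_ge0 ltW.
apply: le_trans (powR_exponent_diff _ _ x0) _; rewrite mulrC ler_wpM2r//.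
by rewrite mulrDr mulrDl mul1r lerD// normr_ln_powR_le.
Qed.

Lemma pos_pow_le x k (W : R) : x <= W -> 1 <= W -> 0 <= k <= 1 -> pos_pow x k <= W.
Proof.
move=> xW W1 /andP[k0 k1]; rewrite /pos_pow; case: ifPn => [x0|_]; last exact: le_trans W1.
apply: (@le_trans _ _ (W `^ k)); last by rewrite ler1_powR.
by rewrite ge0_ler_powR// nnegrE ?(ltW x0)// (le_trans _ W1).
Qed.

Lemma powR_base_anti x y k : 0 < x -> x <= y -> k <= 0 -> y `^ k <= x `^ k.
Proof.
move=> x0 xy k0; rewrite -[k]opprK !(powRN _ (- k)).
rewrite lef_pV2 ?posrE ?powR_gt0//; last exact: lt_le_trans xy.
by rewrite ge0_ler_powR ?oppr_ge0// nnegrE ?(le_trans _ xy)// ltW.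
Qed.

Lemma powR_base_diff y u k : 0 < y -> 0 <= u -> exists2 c, y <= c &
  (y + u) `^ k - y `^ k = u * (k * c `^ (k - 1)).
Proof.
move=> y0; rewrite le_eqVlt => /predU1P[<-|u0].
  by exists y => //; rewrite addr0 subrr mul0r.
have yu : y < y + u by rewrite ltrDl.
have [x||c] := @MVT _ (@powR R ^~ k) (fun x => k * x `^ (k - 1)) y (y + u) yu.
- by rewrite in_itv/= => /andP[yx _]; apply: is_derive1_powR; exact: lt_trans yx.
- apply: continuous_in_subspaceT => x; rewrite inE/= in_itv/= => /andP[yx _].
  by apply: continuous_powR; exact: lt_le_trans yx.
rewrite in_itv/= => /andP[yc _] E; exists c; first exact: ltW.
by rewrite E [y + u]addrC addrK mulrC.
Qed.

(** Applying the mean value theorem to the difference of the two powers, instead of each of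
    them, gains one order of decay while keeping a factor that vanishes with [k1 - k2]. *)
Lemma powR_base_exponent_diff y u k1 k2 : 0 < y -> 0 <= u -> exists2 c, y <= c &
  ((y + u) `^ k1 - (y + u) `^ k2) - (y `^ k1 - y `^ k2) =
  u * (k1 * c `^ (k1 - 1) - k2 * c `^ (k2 - 1)).
Proof.
move=> y0; rewrite le_eqVlt => /predU1P[<-|u0].
  by exists y => //; rewrite addr0 subrr mul0r.
have yu : y < y + u by rewrite ltrDl.
have [x||c] := @MVT _ (fun x => x `^ k1 - x `^ k2)
    (fun x => k1 * x `^ (k1 - 1) - k2 * x `^ (k2 - 1)) y (y + u) yu.
- rewrite in_itv/= => /andP[yx _]; have x0 : 0 < x by exact: lt_trans yx.
  have d1 := is_derive1_powR k1 x0; have d2 := is_derive1_powR k2 x0.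
  exact: is_deriveB.
- apply: continuous_in_subspaceT => x; rewrite inE/= in_itv/= => /andP[yx _].
  have x0 : 0 < x by exact: lt_le_trans yx.
  exact: (continuousB (continuous_powR (r := k1) x0) (continuous_powR (r := k2) x0)).
rewrite in_itv/= => /andP[yc _] E; exists c; first exact: ltW.
by rewrite E [y + u]addrC addrK mulrC.
Qed.

(** The exponent [e] pays for the logarithm that comes from the variation in [k]. *)
Lemma power_derivative_lipschitz c k1 k2 kmax e : 1 <= c -> 0 < e ->
  0 <= k1 <= kmax -> 0 <= k2 <= kmax -> kmax <= 1 ->
  `|k1 * c `^ (k1 - 1) - k2 * c `^ (k2 - 1)| <=
  (1 + 2 * e^-1) * `|k1 - k2| * c `^ (kmax - 1 + e).
Proof.
move=> c1 e0 /andP[k10 k1m] /andP[k20 k2m] m1.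
have c0 : 0 < c by exact: lt_le_trans c1.
have mono k : k <= kmax -> c `^ (k - 1) <= c `^ (kmax - 1).
  by move=> km; rewrite ler_powR// lerB.
have -> : k1 * c `^ (k1 - 1) - k2 * c `^ (k2 - 1) =
    (k1 - k2) * c `^ (k1 - 1) + k2 * (c `^ (k1 - 1) - c `^ (k2 - 1)) by ring.
apply: le_trans (ler_normD _ _) _; rewrite !normrM (ger0_norm k20) (ger0_norm (powR_ge0 _ _)).
have pe : c `^ (kmax - 1 + e) = c `^ (kmax - 1) * c `^ e.
  by rewrite powRD// (gt_eqF c0) implybT.
have ce1 : 1 <= c `^ e by rewrite -(powRr0 c) ler_powR// ltW.
have t1 : `|k1 - k2| * c `^ (k1 - 1) <= `|k1 - k2| * c `^ (kmax - 1 + e).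
  rewrite ler_wpM2l// pe; apply: le_trans (mono _ k1m) _.
  by rewrite ler_peMr// powR_ge0.
have t2 : k2 * `|c `^ (k1 - 1) - c `^ (k2 - 1)| <=
    2 * e^-1 * `|k1 - k2| * c `^ (kmax - 1 + e).
  apply: (@le_trans _ _ (`|c `^ (k1 - 1) - c `^ (k2 - 1)|)).
    by rewrite ler_piMl// (le_trans k2m).
  apply: le_trans (powR_exponent_diff _ _ c0) _.
  rewrite (_ : k1 - 1 - (k2 - 1) = k1 - k2); last by ring.
  rewrite [2 * _ * _]mulrC -[in leRHS]mulrA ler_wpM2l// ger0_norm ?ln_ge0// pe.
  rewrite [leRHS](_ : _ = (e^-1 * c `^ e) * (c `^ (kmax - 1) + c `^ (kmax - 1))); last by ring.
  apply: ler_pM; rewrite ?ln_ge0// ?addr_ge0 ?powR_ge0//.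
    exact: ln_le_powR.
  by rewrite lerD// mono.
apply: le_trans (lerD t1 t2) _.
by rewrite le_eqVlt; apply/orP; left; apply/eqP; ring.
Qed.

End power_estimates.

(** * Kernels of the field *)

Section power_tail.
Context {R : realType}.
Variable alpha : R.
Hypothesis alpha1 : 1 < alpha.
Local Notation mu := (@lebesgue_measure R).

Let alpha_gt0 : 0 < alpha. Proof. exact: lt_trans alpha1. Qed.

(** The threshold [1 < alpha * q] is the integrability of [x^(- alpha * q)] at infinity. *)
Lemma Lalpha_tail (f : R -> R) (D q m : R) : measurable_fun [set: R] f ->
  0 <= D -> 0 < m -> 1 < alpha * q ->
  (forall x, x <= - m -> `|f x| <= D * (- x) `^ (- q)) ->
  (forall x, - m < x -> f x = 0) ->
  Lalpha alpha f /\
  alpha_norm alpha f <= D * (alpha * q - 1)^-1 `^ (alpha^-1) * m `^ (- (q - alpha^-1)).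
Proof.
move=> mf D0 m0 aq fq f0.
have aq0 : 0 < alpha * q - 1 by rewrite subr_gt0.
apply: (Lalpha_norm_le alpha1 mf); first by rewrite !mulr_ge0 ?powR_ge0.
have mfa := measurable_normr_powR alpha mf.
rewrite -(ge0_integral_oppr (f := fun x => (`|f x| `^ alpha)%:E)); last 2 first.
- exact/measurable_EFinP.
- by move=> x; rewrite lee_fin powR_ge0.
have E : (D * (alpha * q - 1)^-1 `^ alpha^-1 * m `^ (- (q - alpha^-1))) `^ alpha =
    D `^ alpha * (m `^ (- (alpha * q - 1)) / (alpha * q - 1)).
  rewrite !powRM ?mulr_ge0 ?powR_ge0// -!powRrM mulVf ?gt_eqF// powRr1 ?invr_ge0 ?ltW//.
  rewrite -mulrA; congr (_ * _); rewrite mulrC; congr (_ `^ _ * _).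
  by rewrite mulNr mulrBl mulVf ?gt_eqF// mulrC.
rewrite E EFinM -integral_powR_tail// -ge0_integralZl_EFin ?powR_ge0//; last 2 first.
- by move=> x _; rewrite lee_fin powR_ge0.
- by apply/measurable_EFinP; apply: measurable_funTS; exact: measurable_powR.
rewrite [X in (_ <= X)%E]integral_mkcond; apply: ge0_le_integral => //.
- apply/measurable_EFinP.
  exact: (measurableT_comp mfa (@oppr_measurable R setT)).
- rewrite -measurable_restrictT//; apply/measurable_EFinP.
  apply: measurable_funM => //.
  by apply: measurable_funTS; exact: measurable_powR.
move=> x _; rewrite /patch; case: ifPn => [|].
  rewrite inE /= in_itv/= andbT => mx; have x0 : 0 < x by exact: lt_le_trans mx.
  rewrite -EFinM lee_fin.
  have := fq (- x); rewrite lerN2 opprK => /(_ mx) fx.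
  rewrite (_ : - (alpha * q - 1) - 1 = - q * alpha); last by ring.
  rewrite powRrM -powRM ?powR_ge0// ge0_ler_powR// ?nnegrE ?mulr_ge0 ?powR_ge0//.
  exact: ltW.
rewrite notin_setE/= in_itv/= andbT => /negP; rewrite -ltNge => xm.
by rewrite f0 ?ltrN2// normr0 powR0// gt_eqF.
Qed.

End power_tail.

Section kernel_estimates.
Context {R : realType}.
Variables alpha hlo hhi U : R.
Hypothesis alpha1 : 1 < alpha.
Hypothesis hlo_gt : alpha^-1 < hlo.
Hypothesis hhi_lt1 : hhi < 1.
Hypothesis U1 : 1 <= U.
Local Notation mu := (@lebesgue_measure R).

(** A common integrable envelope of all kernels: the decay exponent lies strictly
    between the order [1 + alpha^-1 - hhi] of the increments of the powers and the
    integrability threshold [alpha^-1], which leaves room for a logarithm. *)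
Definition envelope_exponent : R := alpha^-1 + (1 - hhi) / 2.
Definition envelope (s : R) : R :=
  if s <= - 1 then (- s) `^ (- envelope_exponent) else if s <= U then 1 else 0.

Let alpha_gt0 : 0 < alpha. Proof. exact: lt_trans alpha1. Qed.
Let alphaV0 : 0 < alpha^-1. Proof. by rewrite invr_gt0. Qed.

Lemma envelope_ge0 s : 0 <= envelope s.
Proof. by rewrite /envelope; case: ifP => _; [exact: powR_ge0|case: ifP]. Qed.

Lemma measurable_if_le (c : R) (f g : R -> R) : measurable_fun [set: R] f ->
  measurable_fun [set: R] g ->
  measurable_fun [set: R] (fun s : R => if s <= c then f s else g s).
Proof.
move=> mf mg.
have m1 : measurable_fun [set: R] (fun x : R => x <= c).
  by apply: measurable_fun_ler; [exact: measurable_id|exact: measurable_cst].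
by apply: measurable_fun_ifT; [exact: m1|exact: mf|exact: mg].
Qed.

Let measurable_tail_power : measurable_fun [set: R] (fun s : R => (- s) `^ (- envelope_exponent)).
Proof.
exact: (measurableT_comp (@measurable_powR R _) (@oppr_measurable R setT)).
Qed.

Lemma Lalpha_envelope : Lalpha alpha envelope.
Proof.
have aE : 1 < alpha * envelope_exponent.
  rewrite /envelope_exponent mulrDr divff ?gt_eqF// ltrDl.
  by rewrite mulr_gt0// divr_gt0// subr_gt0.
pose f1 (s : R) := if s <= - 1 then (- s) `^ (- envelope_exponent) else 0.
pose f2 (s : R) := if s <= -1 then 0 else if s <= U then 1 else 0 : R.
have [||||x x1|x|L1 _] := @Lalpha_tail R alpha alpha1 f1 1 envelope_exponent 1 => //.
- exact: measurable_if_le.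
- by rewrite /f1 x1 mul1r ger0_norm// powR_ge0.
- by rewrite ltNge /f1 => /negbTE ->.
have [L2 _] : Lalpha alpha f2 /\ alpha_norm alpha f2 <= (U + 1) `^ (alpha^-1).
  apply: Lalpha_norm_le => //.
  - apply: measurable_if_le => //; apply: measurable_if_le => //.
  - exact: powR_ge0.
  - rewrite -powRrM mulVf ?gt_eqF// powRr1; last by rewrite addr_ge0// (le_trans _ U1).
    rewrite (_ : (\int[mu]_x (`|f2 x| `^ alpha)%:E = \int[mu]_x ((\1_(`]-1, U] : set R) x : R))%:E)%E).
      rewrite integral_indic//= setIT lebesgue_measure_itv/=; case: ifPn => _.
        by rewrite -EFinB opprK lexx.
      by rewrite lee_fin addr_ge0// (le_trans _ U1).
    apply: eq_integral => x _; rewrite indicE /f2; congr EFin.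
    have -> : (x \in `]-1, U]%classic) = (-1 < x <= U).
      by apply/idP/idP; rewrite inE/= in_itv.
    rewrite ltNge; case: (x <= -1) => /=; first by rewrite normr0 powR0// gt_eqF.
    by case: (x <= U) => /=; rewrite ?normr1 ?powR1// normr0 powR0// gt_eqF.
rewrite (_ : envelope = (fun s => 1 * f1 s + 1 * f2 s)); first exact: LalphaZD.
apply/funext => s.
by rewrite /envelope /f1 /f2; case: ifP => _; rewrite ?mulr0 !mul1r ?addr0 ?add0r.
Qed.

Definition in_range (v : R) := hlo <= v <= hhi.

Let exponent_range v : in_range v ->
  hlo - alpha^-1 <= v - alpha^-1 <= hhi - alpha^-1.
Proof. by move=> /andP[v1 v2]; rewrite !lerB. Qed.

Let exponent_le1 v : in_range v -> hlo - alpha^-1 <= v - alpha^-1 <= 1.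
Proof.
by move=> /exponent_range /andP[-> h] /=; apply: le_trans h _; move: hhi_lt1 alphaV0; lra.
Qed.

Let exponent0 : 0 < hlo - alpha^-1. Proof. by rewrite subr_gt0. Qed.

Definition kernel_size : R := 2 * (U + 1).

Definition kernel_lipschitz : R :=
  4 * ((hlo - alpha^-1)^-1 + (U + 1) ^+ 2) + U * (1 + 2 * ((1 - hhi) / 2)^-1).

Lemma kernel_size_ge0 : 0 <= kernel_size.
Proof. by rewrite /kernel_size; move: U1; lra. Qed.

Lemma kernel_lipschitz_ge0 : 0 <= kernel_lipschitz.
Proof.
have U0 : 0 <= U by apply: le_trans U1.
have h1 : 0 <= (hlo - alpha^-1)^-1 by rewrite invr_ge0 ltW.
have h2 : 0 <= ((1 - hhi) / 2)^-1 by rewrite invr_ge0 divr_ge0// subr_ge0 ltW.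
by rewrite /kernel_lipschitz !(addr_ge0, mulr_ge0)// exprn_ge0// addr_ge0.
Qed.

Let decay c y v : 1 <= y -> y <= c -> in_range v ->
  c `^ (v - alpha^-1 - 1) <= y `^ (- envelope_exponent).
Proof.
move=> y1 yc /exponent_range /andP[_ v2]; apply: (@le_trans _ _ (c `^ (- envelope_exponent))).
  rewrite ler_powR ?(le_trans y1)// /envelope_exponent; move: v2 hhi_lt1; lra.
apply: powR_base_anti => //; first exact: lt_le_trans y1.
by rewrite oppr_le0 /envelope_exponent; move: hhi_lt1 alphaV0; lra.
Qed.

(** Before time -1 the kernel is an increment of a power, bounded by the mean value theorem;
    between -1 and [U] each of its two terms is bounded; after [U] it vanishes. *)
Lemma kernel_le_envelope u v s : 0 <= u <= U -> in_range v ->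
  `|kernel_X alpha u v s| <= kernel_size * envelope s.
Proof.
move=> /andP[u0 uU] vr; rewrite /kernel_X /envelope.
have U0 : 0 <= U by apply: le_trans U1.
have /andP[k0 k1] := exponent_le1 vr; have k00 := le_trans (ltW exponent0) k0.
have [s1|s1] := leP s (-1).
  rewrite /pos_pow !ifT; [|lra|lra].
  rewrite (_ : u - s = - s + u); last by ring.
  have [|c yc ->] := @powR_base_diff R (- s) u (v - alpha^-1) _ u0; first lra.
  rewrite normrM (ger0_norm u0) normrM ger0_norm// (ger0_norm (powR_ge0 _ _)).
  apply: (@le_trans _ _ (U * (1 * (- s) `^ (- envelope_exponent)))).
    by rewrite ler_pM ?mulr_ge0 ?powR_ge0// ler_pM ?powR_ge0// decay//; lra.
  by rewrite mul1r ler_wpM2r ?powR_ge0// /kernel_size; move: U1; lra.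
have [sU|sU] := leP s U; last first.
  by rewrite /pos_pow !ifF ?subrr ?normr0 ?mulr0//; apply/negbTE; rewrite -leNgt; lra.
apply: le_trans (ler_normB _ _) _; rewrite !ger0_norm ?pos_pow_ge0//.
by rewrite mulr1 /kernel_size mulrDl mul1r lerD// pos_pow_le//; move: U1; lra.
Qed.

(** The regions are those of [kernel_le_envelope]. Far in the past the variable varies and the
    exponent with it, whence [powR_base_exponent_diff]; near the origin only the exponent
    varies. *)
Lemma kernel_lipschitz_envelope u v1 v2 s : 0 <= u <= U -> in_range v1 -> in_range v2 ->
  `|kernel_X alpha u v1 s - kernel_X alpha u v2 s| <=
  kernel_lipschitz * `|v1 - v2| * envelope s.
Proof.
move=> /andP[u0 uU] v1r v2r; rewrite /kernel_X /envelope.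
have U0 : 0 <= U by apply: le_trans U1.
have k1r := exponent_le1 v1r; have k2r := exponent_le1 v2r.
have /andP[v1a v1b] := exponent_range v1r; have /andP[v2a v2b] := exponent_range v2r.
have e0 : 0 < (1 - hhi) / 2 by rewrite divr_gt0// subr_gt0.
have dv : v1 - alpha^-1 - (v2 - alpha^-1) = v1 - v2 by ring.
have t0 : 0 <= 4 * ((hlo - alpha^-1)^-1 + (U + 1) ^+ 2).
  by rewrite mulr_ge0// addr_ge0 ?sqr_ge0// invr_ge0 ltW.
have t1 : 0 <= U * (1 + 2 * ((1 - hhi) / 2)^-1).
  by rewrite mulr_ge0// addr_ge0// mulr_ge0// invr_ge0 ltW.
have [s1|s1] := leP s (-1).
  rewrite /pos_pow !ifT; [|lra|lra|lra|lra].
  rewrite (_ : u - s = - s + u); last by ring.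
  rewrite opprB addrACA -opprD [X in `|X|](_ : _ = ((- s + u) `^ (v1 - alpha^-1) - (- s + u) `^ (v2 - alpha^-1)) -
    ((- s) `^ (v1 - alpha^-1) - (- s) `^ (v2 - alpha^-1))); last by ring.
  have [|c yc ->] := @powR_base_exponent_diff R (- s) u (v1 - alpha^-1) (v2 - alpha^-1) _ u0.
    by lra.
  have c1 : 1 <= c by lra.
  rewrite normrM (ger0_norm u0).
  apply: (@le_trans _ _ (U * ((1 + 2 * ((1 - hhi) / 2)^-1) * `|v1 - v2| *
      (- s) `^ (- envelope_exponent)))).
    apply: ler_pM => //.
    apply: le_trans (@power_derivative_lipschitz R c _ _ (hhi - alpha^-1) ((1 - hhi) / 2) c1 e0 _ _ _) _.
    - by rewrite v1b (le_trans _ v1a)// ltW.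
    - by rewrite v2b (le_trans _ v2a)// ltW.
    - by move: hhi_lt1 alphaV0; lra.
    rewrite dv ler_wpM2l//; first by rewrite mulr_ge0// addr_ge0// mulr_ge0// invr_ge0 ltW.
    rewrite (_ : hhi - alpha^-1 - 1 + (1 - hhi) / 2 = - envelope_exponent); last first.
      by rewrite /envelope_exponent; lra.
    apply: powR_base_anti => //; first by lra.
    by rewrite oppr_le0 /envelope_exponent; move: hhi_lt1 alphaV0; lra.
  rewrite !mulrA ler_wpM2r ?powR_ge0// ler_wpM2r// /kernel_lipschitz.
  by rewrite lerDr.
have [sU|sU] := leP s U; last first.
  by rewrite /pos_pow !ifF ?subrr ?normr0 ?mulr0//; apply/negbTE; rewrite -leNgt; lra.
rewrite mulr1 opprB addrACA -opprD [X in `|X|](_ : _ = (pos_pow (u - s) (v1 - alpha^-1) - pos_pow (u - s) (v2 - alpha^-1)) -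
    (pos_pow (- s) (v1 - alpha^-1) - pos_pow (- s) (v2 - alpha^-1))); last by ring.
apply: le_trans (ler_normB _ _) _.
have W1 : 1 <= U + 1 by lra.
have l1 : u - s <= U + 1 by lra.
have l2 : - s <= U + 1 by lra.
apply: le_trans (lerD (pos_pow_exponent_lipschitz l1 W1 exponent0 k1r k2r)
  (pos_pow_exponent_lipschitz l2 W1 exponent0 k1r k2r)) _.
rewrite dv -mulrDl ler_wpM2r// /kernel_lipschitz -[leLHS]addr0 lerD//.
by rewrite le_eqVlt; apply/orP; left; apply/eqP; ring.
Qed.

Lemma measurable_kernel u v : measurable_fun [set: R] (kernel_X alpha u v).
Proof.
apply: measurable_funB.
  apply: (measurableT_comp (@measurable_pos_pow R _)).
  by apply: measurable_funB.
exact: (measurableT_comp (@measurable_pos_pow R _) (@oppr_measurable R setT)).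
Qed.

Lemma Lalpha_kernel u v : 0 <= u <= U -> in_range v -> Lalpha alpha (kernel_X alpha u v).
Proof.
move=> uU vr; have [] // := Lalpha_dominated alpha1 (measurable_kernel u v)
  kernel_size_ge0 Lalpha_envelope _.
by move=> x; rewrite (ger0_norm (envelope_ge0 x)); exact: kernel_le_envelope.
Qed.

End kernel_estimates.

(** * Iterated differences of powers *)

Section finite_differences.
Context {R : realType}.

Fixpoint iterated_difference (n : nat) (f : R -> R) (y : R) : R :=
  if n is n'.+1 then iterated_difference n' f (y + 1) - iterated_difference n' f y
  else f y.

Lemma iterated_differenceE n f y :
  iterated_difference n f y = \sum_(l < n.+1) coef_a R n l * f (y + l%:R).
Proof.
elim: n y => [|n IH] y /=.
  by rewrite big_ord1 /coef_a subn0 expr0 bin0 !mul1r addr0.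
rewrite !IH [RHS]big_ord_recl [X in X - _]big_ord_recr [X in _ - X]big_ord_recl /=.
rewrite [in RHS]big_ord_recr /=.
have c0 : coef_a R n.+1 0 = - coef_a R n 0.
  by rewrite /coef_a !subn0 !bin0 exprS; ring.
have cn : coef_a R n.+1 n.+1 = coef_a R n n.
  by rewrite /coef_a !subnn !binn.
rewrite c0 cn /bump /=.
have -> : \sum_(i < n) coef_a R n.+1 (1 + i) * f (y + (1 + i)%:R) =
   \sum_(i < n) coef_a R n i * f (y + 1 + i%:R) -
   \sum_(i < n) coef_a R n (1 + i) * f (y + (1 + i)%:R).
  rewrite -sumrB; apply: eq_bigr => i _.
  rewrite natrD addrA -mulrBl; congr (_ * _).
  rewrite /coef_a add1n subSS binS natrD mulrDr.
  rewrite (_ : (n - i)%N = (n - i.+1).+1); last by rewrite subnSK.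
  by rewrite exprS; ring.
have -> : y + 1 + n%:R = y + n.+1%:R by rewrite -addrA -natr1; congr (_ + _); ring.
rewrite add1n; ring.
Qed.

Lemma sum_coef_a n : (0 < n)%N -> \sum_(l < n.+1) coef_a R n l = 0.
Proof.
case: n => // n _.
have /= := iterated_differenceE n.+1 (fun=> 1) 0.
by under eq_bigr do rewrite mulr1; move=> <-; rewrite !iterated_differenceE subrr.
Qed.

Lemma is_derive_iterated_difference n (f df : R -> R) (x : R) : 0 < x ->
  (forall y : R, 0 < y -> is_derive y 1 f (df y)) ->
  is_derive x 1 (iterated_difference n f) (iterated_difference n df x).
Proof.
move=> + Hf; elim: n x => [|n IH] x x0 /=; first exact: Hf.
apply: is_deriveB; last exact: IH.
have dx1 : is_derive x 1 (fun z : R => z + 1) 1.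
  by apply: is_derive_eq; rewrite addr0.
have x10 : 0 < x + 1 by rewrite addr_gt0.
have := @is_derive1_comp _ (iterated_difference n f) (fun z : R => z + 1) x
  _ _ (IH _ x10) dx1.
by rewrite mulr1.
Qed.

(** A difference of step one is a derivative at a later point, so each difference lowers the
    exponent by one. The bound [r] on [`|k|] grows by one along with it, which produces the
    rising product. *)
Lemma iterated_difference_powR_le n (r k y : R) : 0 <= r -> `|k| <= r -> k <= 1 -> 0 < y ->
  `|iterated_difference n (@powR R ^~ k) y| <=
  (\prod_(j < n) (r + j%:R)) * y `^ (k - n%:R).
Proof.
elim: n r k y => [|n IH] r k y r0 kr k1 y0 /=.
  by rewrite big_ord0 mul1r subr0 ger0_norm// powR_ge0.
have d (z : R) : 0 < z -> is_derive z 1 (iterated_difference n (@powR R ^~ k))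
    (iterated_difference n (fun z => k * z `^ (k - 1)) z).
  move=> z0; exact: (is_derive_iterated_difference n z0
    (fun w (w0 : 0 < w) => is_derive1_powR k w0)).
have yy : y < y + 1 by rewrite ltrDl.
have [z||c] := @MVT _ (iterated_difference n (@powR R ^~ k))
   (iterated_difference n (fun z => k * z `^ (k - 1))) y (y + 1) yy.
- by rewrite in_itv/= => /andP[yz _]; apply: d; exact: lt_trans yz.
- apply: continuous_in_subspaceT => z; rewrite inE/= in_itv/= => /andP[yz _].
  apply: differentiable_continuous; apply/derivable1_diffP.
  by apply: (@ex_derive _ _ _ _ _ _ _ (d _ _)); exact: lt_le_trans yz.
rewrite in_itv/= => /andP[yc _]; rewrite [y + 1 - y](_ : _ = 1) ?mulr1; last by ring.
move=> ->; have c0 : 0 < c by exact: lt_trans yc.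
have -> : iterated_difference n (fun z => k * z `^ (k - 1)) c =
    k * iterated_difference n (@powR R ^~ (k - 1)) c.
  rewrite !iterated_differenceE mulr_sumr; apply: eq_bigr => i _; ring.
rewrite normrM big_ord_recl /= addr0 -mulrA; apply: ler_pM => //.
under eq_bigr do rewrite /bump add1n -natr1 addrCA addrC -addrA [1 + _]addrC addrA.
apply: (@le_trans _ _ ((\prod_(j < n) (r + 1 + j%:R)) * c `^ (k - 1 - n%:R))).
  apply: IH => //; [by rewrite addr_ge0| |by lra].
  by apply: le_trans (ler_normB _ _) _; rewrite normr1 lerD2r.
apply: ler_pM; rewrite ?powR_ge0//.
- by apply: prodr_ge0 => i _; rewrite !addr_ge0.
- by rewrite le_eqVlt; apply/orP; left; apply/eqP; apply: eq_bigr => i _; ring.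
have -> : k - n.+1%:R = k - 1 - n%:R by rewrite -natr1; ring.
apply: powR_base_anti => //; first exact: ltW.
by rewrite -addrA -opprD subr_le0 (le_trans k1)// lerDl.
Qed.

End finite_differences.

(** * Differences of kernels on a grid *)

Section stencil.
Context {R : realType}.
Variables alpha hlo hhi : R.
Variable L : nat.
Hypothesis alpha1 : 1 < alpha.
Hypothesis hlo_gt : alpha^-1 < hlo.
Hypothesis hhi_lt1 : hhi < 1.
Hypothesis L2 : (2 <= L)%N.

Let alpha_gt0 : 0 < alpha. Proof. exact: lt_trans alpha1. Qed.
Let alphaV0 : 0 < alpha^-1. Proof. by rewrite invr_gt0. Qed.
Let U1 : 1 <= L%:R :> R. Proof. by rewrite ler1n; apply: leq_trans L2. Qed.
Let range := in_range hlo hhi.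
Let env := envelope alpha hhi (L%:R : R).

(** The kernel of the [L]-th difference, at mesh one, of the field with constant Hurst index
    [v]. The second terms of the kernels cancel because the coefficients sum to zero. *)
Definition stencil (v x : R) : R :=
  \sum_(l < L.+1) coef_a R L l * pos_pow (l%:R - x) (v - alpha^-1).

Lemma stencilE v x :
  stencil v x = \sum_(l < L.+1) coef_a R L l * kernel_X alpha l%:R v x.
Proof.
rewrite /stencil /kernel_X; under [RHS]eq_bigr do rewrite mulrBr.
rewrite sumrB (_ : \sum_(l < L.+1) _ * pos_pow (- x) _ = 0) ?subr0//.
by rewrite -mulr_suml sum_coef_a ?mul0r// (leq_trans _ L2).
Qed.

Definition coef_mass : R := \sum_(l < L.+1) `|coef_a R L l|.

Lemma coef_mass_ge0 : 0 <= coef_mass.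
Proof. exact: sumr_ge0. Qed.

Let node (l : 'I_L.+1) : 0 <= (l%:R : R) <= L%:R.
Proof. by rewrite ler0n ler_nat -ltnS ltn_ord. Qed.

Lemma measurable_stencil v : measurable_fun [set: R] (stencil v).
Proof.
rewrite (_ : stencil v = fun x => \sum_(l < L.+1) coef_a R L l * kernel_X alpha l%:R v x).
  apply: measurable_sum => l; apply: measurable_funM => //; exact: measurable_kernel.
by apply/funext => x; exact: stencilE.
Qed.

Let sum_le (F : 'I_L.+1 -> R) (C : R) : (forall l, `|F l| <= C) ->
  `|\sum_(l < L.+1) coef_a R L l * F l| <= coef_mass * C.
Proof.
move=> FC; apply: le_trans (ler_norm_sum _ _ _) _.
by rewrite /coef_mass mulr_suml; apply: ler_sum => l _; rewrite normrM ler_wpM2l.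
Qed.

Definition stencil_size : R :=
  coef_mass * kernel_size L%:R * alpha_norm alpha env.

Definition stencil_lipschitz : R :=
  coef_mass * kernel_lipschitz alpha hlo hhi L%:R * alpha_norm alpha env.

Lemma stencil_size_ge0 : 0 <= stencil_size.
Proof. by rewrite !mulr_ge0 ?coef_mass_ge0 ?kernel_size_ge0 ?alpha_norm_ge0. Qed.

Lemma stencil_lipschitz_ge0 : 0 <= stencil_lipschitz.
Proof.
by rewrite !mulr_ge0 ?coef_mass_ge0 ?alpha_norm_ge0// kernel_lipschitz_ge0.
Qed.

Lemma Lalpha_stencil v : range v ->
  Lalpha alpha (stencil v) /\ alpha_norm alpha (stencil v) <= stencil_size.
Proof.
move=> vr; apply: (Lalpha_dominated alpha1 (measurable_stencil v)).
- by rewrite mulr_ge0 ?coef_mass_ge0 ?kernel_size_ge0.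
- exact: Lalpha_envelope.
move=> x; rewrite (ger0_norm (envelope_ge0 _ _ _ _)) -mulrA stencilE.
by apply: sum_le => l; apply: kernel_le_envelope vr.
Qed.

Lemma stencil_norm_lipschitz v1 v2 : range v1 -> range v2 ->
  alpha_norm alpha (stencil v1) <=
  alpha_norm alpha (stencil v2) + stencil_lipschitz * `|v1 - v2|.
Proof.
move=> v1r v2r; have [L1 _] := Lalpha_stencil v1r; have [L2' _] := Lalpha_stencil v2r.
apply: le_trans (alpha_norm_triangle alpha1 L1 L2') _; rewrite lerD2l.
have [|||x|_ +] := @Lalpha_dominated R alpha alpha1 (fun s => stencil v1 s - stencil v2 s)
   env (coef_mass * (kernel_lipschitz alpha hlo hhi L%:R * `|v1 - v2|)).
- by apply: measurable_funB; exact: measurable_stencil.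
- by rewrite !mulr_ge0 ?coef_mass_ge0// kernel_lipschitz_ge0.
- exact: Lalpha_envelope.
- rewrite (ger0_norm (envelope_ge0 _ _ _ _)) -mulrA !stencilE -sumrB.
  under eq_bigr do rewrite -mulrBr.
  by apply: sum_le => l; apply: kernel_lipschitz_envelope.
by move=> /le_trans; apply; rewrite le_eqVlt; apply/orP; left; apply/eqP; rewrite /stencil_lipschitz; ring.
Qed.

(** Between [L - 1] and [L - 1/2] the only node that contributes is the last one, with
    coefficient one and a power of a number at least one half. *)
Lemma stencil_norm_lower v : range v -> 4^-1 <= alpha_norm alpha (stencil v).
Proof.
move=> vr; have [Ls _] := Lalpha_stencil vr; have /andP[v1 v2] := vr.
have half0 : 0 < 2^-1 :> R by rewrite invr_gt0.
apply: (@le_trans _ _ (2^-1 * (L%:R - 2^-1 - (L%:R - 1)) `^ (alpha^-1))).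
  rewrite (_ : L%:R - 2^-1 - (L%:R - 1) = 2^-1 :> R); last by lra.
  rewrite (_ : 4^-1 = 2^-1 * 2^-1 :> R); last by lra.
  by rewrite ler_wpM2l ?(ltW half0)// ger1_powR ?half0 ?invf_le1 ?ler1n// ltW.
apply: (alpha_norm_lower alpha1) => //; first lra.
move=> x /andP[x1 x2]; rewrite /stencil big_ord_recr /= big1; last first.
  move=> l _; rewrite /pos_pow ifF ?mulr0//; apply/negbTE; rewrite -leNgt.
  apply: (@le_trans _ _ (L%:R - 1 - x)); last lra.
  by rewrite lerD2r -(natrB _ (ltnW L2)) ler_nat subn1 -ltnS prednK// (ltn_trans _ L2).
rewrite add0r /coef_a subnn binn expr0 !mul1r /pos_pow ifT; last lra.
rewrite ger0_norm ?powR_ge0//; apply: (@le_trans _ _ (2^-1 `^ (v - alpha^-1))).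
  by rewrite ger1_powR ?half0 ?invf_le1 ?ler1n//; move: v1 v2 hhi_lt1 alphaV0; lra.
rewrite ge0_ler_powR ?nnegrE ?(ltW half0)//; last lra.
  by move: v1 hlo_gt; lra.
by lra.
Qed.

(** Before time -1 the stencil is an iterated difference of a power. *)
Lemma stencil_tail_bound v x : range v -> x <= - 1 ->
  `|stencil v x| <= (\prod_(j < L) (1 + j%:R)) * (- x) `^ (- (L%:R - (v - alpha^-1))).
Proof.
move=> /andP[v1 v2] x1; have k1 : v - alpha^-1 <= 1.
  by move: v1 v2 hhi_lt1 alphaV0; lra.
have := @iterated_difference_powR_le R L 1 (v - alpha^-1) (- x) ler01 _ k1 _.
rewrite iterated_differenceE opprB.
rewrite (_ : stencil v x = \sum_(l < L.+1) coef_a R L l * (- x + l%:R) `^ (v - alpha^-1)).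
  apply; last by lra.
  by rewrite ger0_norm//; move: v1 hlo_gt; lra.
apply: eq_bigr => l _; rewrite /pos_pow ifT; first by rewrite addrC.
by rewrite subr_gt0 (le_lt_trans x1)// (lt_le_trans _ (ler0n _ _))//; lra.
Qed.

Definition stencil_far (m v x : R) : R := if x <= - m then stencil v x else 0.
Definition stencil_near (m v x : R) : R := if x <= - m then 0 else stencil v x.

Lemma stencil_split m v x : stencil v x = stencil_near m v x + stencil_far m v x.
Proof. by rewrite /stencil_near /stencil_far; case: ifP; rewrite ?add0r ?addr0. Qed.

Definition tail_const : R := \prod_(j < L) (1 + j%:R).

Lemma tail_const_ge0 : 0 <= tail_const.
Proof. by apply: prodr_ge0 => j _; rewrite addr_ge0. Qed.

(** The decay exponent [L - (v - alpha^-1)] yields a norm of order [m^(- (L - v))], and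
    [v < 1]. *)
Lemma Lalpha_stencil_far m v : 1 <= m -> range v ->
  Lalpha alpha (stencil_far m v) /\
  alpha_norm alpha (stencil_far m v) <= tail_const * m `^ (- (L%:R - 1)).
Proof.
move=> m1 vr; have /andP[v1 v2] := vr; have m0 : 0 < m by exact: lt_le_trans m1.
have L2R : 2 <= L%:R :> R by rewrite ler_nat.
have aqE : alpha * (L%:R - (v - alpha^-1)) = alpha * (L%:R - v) + 1.
  by field; rewrite gt_eqF.
have Lv : 1 <= L%:R - v by move: v2 hhi_lt1 L2R; lra.
have aLv : 1 <= alpha * (L%:R - v).
  by rewrite -[leLHS]mulr1 ler_pM ?ler01// ltW.
have [||||x xm|x xm|Lf Nf] := @Lalpha_tail R alpha alpha1 (stencil_far m v) tail_const
   (L%:R - (v - alpha^-1)) m.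
- by apply: measurable_if_le => //; exact: measurable_stencil.
- exact: tail_const_ge0.
- exact: m0.
- by rewrite aqE; move: aLv; lra.
- by rewrite /stencil_far xm; apply: stencil_tail_bound => //; lra.
- by rewrite /stencil_far ifF//; apply/negbTE; rewrite -ltNge.
split => //; apply: le_trans Nf _; rewrite aqE addrK.
apply: ler_pM; rewrite ?mulr_ge0 ?powR_ge0 ?tail_const_ge0//.
  rewrite ler_piMr ?tail_const_ge0//.
  have i1 : (alpha * (L%:R - v))^-1 <= 1 by rewrite invf_le1// (lt_le_trans ltr01).
  have i0 : 0 <= (alpha * (L%:R - v))^-1 by rewrite invr_ge0 (le_trans ler01).
  apply: (@le_trans _ _ (1 `^ alpha^-1)); last by rewrite powR1.
  by rewrite ge0_ler_powR// ?nnegrE// ltW.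
by rewrite ler_powR//; move: v1 v2 hhi_lt1; lra.
Qed.

Lemma Lalpha_stencil_near m v : range v ->
  Lalpha alpha (stencil_near m v) /\
  alpha_norm alpha (stencil_near m v) <= stencil_size.
Proof.
move=> vr; have [Ls Ns] := Lalpha_stencil vr.
have [||//|x|Ln Nn] := @Lalpha_dominated R alpha alpha1 (stencil_near m v) (stencil v) 1.
- by apply: measurable_if_le => //; exact: measurable_stencil.
- by [].
- by rewrite /stencil_near mul1r; case: ifP; rewrite ?normr0.
by split => //; apply: le_trans Nn _; rewrite mul1r.
Qed.

Lemma stencil_near_eq0 m v x : x <= - m \/ L%:R <= x -> stencil_near m v x = 0.
Proof.
rewrite /stencil_near => -[->//|Lx]; case: ifP => // _.
rewrite /stencil big1// => l _; rewrite /pos_pow ifF ?mulr0//.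
by apply/negbTE; rewrite -leNgt subr_le0 (le_trans _ Lx)// ler_nat -ltnS.
Qed.

(** Self-similarity: the increments on the grid of mesh [N^-1] have kernels obtained
    from a single profile by translation and dilation. *)
Definition rescale (phi : R -> R) (v : R) (N k : nat) (s : R) : R :=
  N%:R `^ (- (v - alpha^-1)) * phi (N%:R * s + - k%:R).

Lemma increment_kernelE v N k s : (0 < N)%N ->
  \sum_(l < L.+1) coef_a R L l * kernel_X alpha ((k + l)%:R / N%:R) v s =
  rescale (stencil v) v N k s.
Proof.
move=> N0; have NR : 0 < N%:R :> R by rewrite ltr0n.
rewrite /rescale /stencil mulr_sumr.
rewrite /kernel_X; under [LHS]eq_bigr do rewrite mulrBr.
rewrite sumrB (_ : \sum_(l < L.+1) _ * pos_pow (- s) _ = 0) ?subr0; last first.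
  by rewrite -mulr_suml sum_coef_a ?mul0r// (leq_trans _ L2).
apply: eq_bigr => l _; rewrite [RHS]mulrCA; congr (_ * _).
rewrite (_ : l%:R - _ = N%:R * ((k + l)%:R / N%:R - s)).
  by rewrite pos_powM// mulrA -powRD ?(gt_eqF NR) ?implybT// addNr powRr0 mul1r.
by rewrite natrD; field; rewrite gt_eqF.
Qed.

Lemma Lalpha_rescale phi v N k : (0 < N)%N -> Lalpha alpha phi ->
  Lalpha alpha (rescale phi v N k) /\
  alpha_norm alpha (rescale phi v N k) = N%:R `^ (- v) * alpha_norm alpha phi.
Proof.
move=> N0 Lp; have NR : 0 < N%:R :> R by rewrite ltr0n.
have [Lr Nr] := alpha_norm_affine alpha1 (N%:R `^ (- (v - alpha^-1))) (- k%:R) NR Lp.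
split; [exact: Lr|rewrite /rescale Nr; congr (_ * _)].
rewrite ger0_norm ?powR_ge0// -powRD ?(gt_eqF NR) ?implybT//.
by congr (_ `^ _); ring.
Qed.

End stencil.

(** * Expectations of real random variables *)

Section expectation_tools.
Context {R : realType} d (T : measurableType d) (P : probability T R).
Implicit Types (X Y : {RV P >-> R}) (f g : T -> R).

Local Notation integ f := (P.-integrable setT (EFin \o f)).
Local Notation "'Ex' f" := (Rintegral P setT f) (at level 10).

Lemma ge0_integral_finite f (c : R) : measurable_fun setT f -> (forall w, 0 <= f w) ->
  (\int[P]_w (f w)%:E <= c%:E)%E -> integ f /\ Ex f <= c.
Proof.
move=> mf f0 fc.
have fi : integ f.
  apply/integrableP; split; first exact/measurable_EFinP.
  under eq_integral do rewrite /= ger0_norm//.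
  by apply: le_lt_trans fc (ltry _).
split => //; rewrite -lee_fin /Rintegral fineK//.
exact: (integrable_fin_num measurableT fi).
Qed.

Lemma integrable_EFin f : integ f -> (\int[P]_w (f w)%:E = (Ex f)%:E)%E.
Proof.
by move=> fi; rewrite /Rintegral fineK//; exact: (integrable_fin_num measurableT fi).
Qed.

Lemma integrable_dominated f g : measurable_fun setT f -> integ g ->
  (forall w, `|f w| <= g w) -> integ f.
Proof.
move=> mf gi fg; apply: (le_integrable measurableT _ _ gi).
- exact/measurable_EFinP.
- by move=> w _; rewrite lee_fin (le_trans (fg w))// ler_norm.
Qed.

Lemma integrable_cst (c : R) : integ (fun=> c).
Proof. exact: finite_measure_integrable_cst. Qed.

Lemma Ex_cst (c : R) : Ex (fun=> c) = c.
Proof. by rewrite /Rintegral integral_cst//= probability_setT mule1. Qed.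

Lemma integrable_scale (c : R) f : integ f -> integ (fun w => c * f w).
Proof. by move=> fi; have := integrableZl measurableT c fi. Qed.

Lemma Ex_scale (c : R) f : integ f -> Ex (fun w => c * f w) = c * Ex f.
Proof. by move=> fi; rewrite RintegralZl. Qed.

Lemma integrable_add f g : integ f -> integ g -> integ (fun w => f w + g w).
Proof. by move=> fi gi; have := integrableD measurableT fi gi. Qed.

Lemma Ex_add f g : integ f -> integ g -> Ex (fun w => f w + g w) = Ex f + Ex g.
Proof. by move=> fi gi; rewrite RintegralD. Qed.

Lemma measurable_sumr (I : Type) (r : seq I) (A : pred I) (F : I -> T -> R) :
  (forall i, A i -> measurable_fun setT (F i)) ->
  measurable_fun setT (fun w => \sum_(i <- r | A i) F i w).
Proof.
move=> mF; rewrite (_ : (fun w => _) =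
    (fun w => \sum_(i <- r) (if A i then F i w else 0))).
  by apply: measurable_sum => i; case Ai : (A i) => //; exact: mF.
by apply/funext => w; rewrite big_mkcond.
Qed.

Lemma integrable_sumr (I : Type) (r : seq I) (A : pred I) (F : I -> T -> R) :
  (forall i, A i -> integ (F i)) -> integ (fun w => \sum_(i <- r | A i) F i w).
Proof.
move=> Fi; elim: r => [|i r IH].
  rewrite (_ : (fun w => _) = (fun=> 0)); first exact: integrable_cst.
  by apply/funext => w; rewrite big_nil.
have consE : (fun w => \sum_(j <- i :: r | A j) F j w) =
    (fun w => if A i then F i w + \sum_(j <- r | A j) F j w
              else \sum_(j <- r | A j) F j w).
  by apply/funext => w; rewrite big_cons.
rewrite consE; case Ai: (A i) => //.
by apply: integrable_add => //; exact: Fi.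
Qed.

Lemma Ex_sumr (I : Type) (r : seq I) (A : pred I) (F : I -> T -> R) :
  (forall i, A i -> integ (F i)) ->
  Ex (fun w => \sum_(i <- r | A i) F i w) = \sum_(i <- r | A i) Ex (F i).
Proof.
move=> Fi; elim: r => [|i r IH].
  rewrite (_ : (fun w => _) = (fun=> 0)) ?Ex_cst ?big_nil//.
  by apply/funext => w; rewrite big_nil.
have consE : (fun w => \sum_(j <- i :: r | A j) F j w) =
    (fun w => if A i then F i w + \sum_(j <- r | A j) F j w
              else \sum_(j <- r | A j) F j w).
  by apply/funext => w; rewrite big_cons.
rewrite consE big_cons; case Ai: (A i) => //.
by rewrite Ex_add ?IH//; [exact: Fi|exact: integrable_sumr].
Qed.

Lemma Ex_le f g : integ f -> integ g -> (forall w, f w <= g w) -> Ex f <= Ex g.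
Proof. by move=> fi gi fg; apply: le_Rintegral. Qed.

Lemma Ex_ge0 f : (forall w, 0 <= f w) -> 0 <= Ex f.
Proof. by move=> f0; apply: Rintegral_ge0. Qed.

(** By uniqueness of product measures, independence identifies the distribution of the pair
    with the product of the two distributions; Tonelli's theorem concludes. *)
Lemma independent_integralM X Y (f g : R -> R) :
  (forall A B, measurable A -> measurable B ->
    P (X @^-1` A `&` Y @^-1` B) = (P (X @^-1` A) * P (Y @^-1` B))%E) ->
  measurable_fun setT f -> measurable_fun setT g ->
  (forall x, 0 <= f x) -> (forall x, 0 <= g x) ->
  (\int[P]_w (f (X w) * g (Y w))%:E =
   \int[P]_w (f (X w))%:E * \int[P]_w (g (Y w))%:E)%E.
Proof.
move=> ind mf mg f0 g0.
have mXY : measurable_fun setT (fun w => (X w, Y w) : R * R).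
  exact: measurable_fun_pair.
pose joint := measure_function_pushforward__canonical__measure_function_Measure P mXY.
pose h (z : R * R) := (f z.1 * g z.2)%:E.
have mh : measurable_fun setT h.
  apply/measurable_EFinP; apply: measurable_funM.
    exact: (measurableT_comp mf measurable_fst).
  exact: (measurableT_comp mg measurable_snd).
have h0 z : (0 <= h z)%E by rewrite lee_fin mulr_ge0.
have jointE A : measurable A -> (distribution P X \x distribution P Y)%E A = joint A.
  apply: product_measure_unique => A1 A2 mA1 mA2.
  exact: ind.
transitivity (\int[joint]_z h z)%E.
  by rewrite ge0_integral_pushforward// preimage_setT.
transitivity (\int[distribution P X \x distribution P Y]_z h z)%E.
  by apply: eq_measure_integral => A mA _; rewrite -jointE.
rewrite fubini_tonelli1// /fubini_F /h /=.
transitivity (\int[distribution P X]_x ((f x)%:E * \int[distribution P Y]_y (g y)%:E))%E.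
  apply: eq_integral => x _; under eq_integral do rewrite EFinM.
  rewrite ge0_integralZl_EFin//; first by move=> y _; rewrite lee_fin.
  exact/measurable_EFinP.
rewrite ge0_integralZr//; last 3 first.
- exact/measurable_EFinP.
- by move=> x _; rewrite lee_fin.
- by apply: integral_ge0 => y _; rewrite lee_fin.
by congr (_ * _)%E; rewrite ge0_integral_distribution//; exact/measurable_EFinP.
Qed.

End expectation_tools.

(** * Averages of weakly dependent variables *)

Section averages.
Context {R : realType} (I : finType) (A : {set I}).
Hypothesis A0 : (0 < #|A|)%N.
Let n : R := #|A|%:R.
Let n_gt0 : 0 < n. Proof. by rewrite ltr0n. Qed.

Lemma average_sqr_le (x : I -> R) :
  (n^-1 * \sum_(k in A) x k) ^+ 2 <= n^-1 * \sum_(k in A) x k ^+ 2.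
Proof.
set m := n^-1 * \sum_(k in A) x k.
have sumx : \sum_(k in A) x k = n * m by rewrite /m mulrA divff ?mul1r// gt_eqF.
have : 0 <= \sum_(k in A) (x k - m) ^+ 2 by apply: sumr_ge0 => k _; exact: sqr_ge0.
have -> : \sum_(k in A) (x k - m) ^+ 2 =
    \sum_(k in A) x k ^+ 2 - 2 * m * \sum_(k in A) x k + n * m ^+ 2.
  under eq_bigr do rewrite sqrrB.
  rewrite big_split sumrB /= sumr_const -[X in _ + X]mulr_natl -/n; congr (_ - _ + _).
  by rewrite mulr_sumr; apply: eq_bigr => k _; ring.
by rewrite sumx ler_pdivlMl//; nra.
Qed.

Lemma average_pow4_le (x : I -> R) :
  (n^-1 * \sum_(k in A) x k) ^+ 4 <= n^-1 * \sum_(k in A) x k ^+ 4.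
Proof.
rewrite -[4%N]/(2 * 2)%N exprM; apply: (@le_trans _ _ ((n^-1 * \sum_(k in A) x k ^+ 2) ^+ 2)).
  rewrite ler_sqr ?nnegrE ?sqr_ge0 ?average_sqr_le// mulr_ge0 ?invr_ge0 ?(ltW n_gt0)//.
  by apply: sumr_ge0 => k _; exact: sqr_ge0.
by apply: le_trans (average_sqr_le _) _; under eq_bigr do rewrite -exprM.
Qed.

Lemma average_le (x : I -> R) (C : R) : (forall k, k \in A -> x k <= C) ->
  n^-1 * \sum_(k in A) x k <= C.
Proof.
move=> xC; rewrite ler_pdivrMl//; apply: le_trans (ler_sum _ xC) _.
by rewrite sumr_const -mulr_natl.
Qed.

Lemma average_ge (x : I -> R) (C : R) : (forall k, k \in A -> C <= x k) ->
  C <= n^-1 * \sum_(k in A) x k.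
Proof.
move=> xC; rewrite ler_pdivlMl//; apply: le_trans (ler_sum _ xC).
by rewrite sumr_const -mulr_natl.
Qed.

End averages.

Section weakly_dependent_averages.
Context {R : realType} d (T : measurableType d) (P : probability T R).
Context (I : finType) (A : {set I}).
Hypothesis A0 : (0 < #|A|)%N.
Let n : R := #|A|%:R.
Let n_gt0 : 0 < n. Proof. by rewrite ltr0n. Qed.

Local Notation integ f := (P.-integrable setT (EFin \o f)).
Local Notation "'Ex' f" := (Rintegral P setT f) (at level 10).

Lemma integrable_product (f g : T -> R) : measurable_fun setT f -> measurable_fun setT g ->
  integ (fun w => f w ^+ 2) -> integ (fun w => g w ^+ 2) -> integ (fun w => f w * g w).
Proof.
move=> mf mg f2 g2.
apply: (@integrable_dominated _ _ _ P _ (fun w => f w ^+ 2 + g w ^+ 2)).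
- exact: measurable_funM.
- exact: integrable_add.
- by move=> w; rewrite ler_norml; apply/andP; split; nra.
Qed.

Lemma integrable_of_sqr (f : T -> R) : measurable_fun setT f ->
  integ (fun w => f w ^+ 2) -> integ f.
Proof.
move=> mf f2; apply: (@integrable_dominated _ _ _ P _ (fun w => 1 + f w ^+ 2)) => //.
- by apply: integrable_add => //; exact: integrable_cst.
- by move=> w; rewrite ler_norml; apply/andP; split; nra.
Qed.

Lemma measurable_center (f : T -> R) (c : R) :
  measurable_fun setT f -> measurable_fun setT (fun w => f w - c).
Proof. by move=> mf; apply: measurable_funB. Qed.

Lemma integrable_sqr_center (f : T -> R) (c : R) : measurable_fun setT f ->
  integ (fun w => f w ^+ 2) -> integ (fun w => (f w - c) ^+ 2).
Proof.
move=> mf f2; apply: (@integrable_dominated _ _ _ P _ (fun w => 2 * f w ^+ 2 + 2 * c ^+ 2)).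
- by apply: measurable_funX; exact: measurable_center.
- by apply: integrable_add; [exact: integrable_scale|exact: integrable_cst].
- by move=> w; rewrite ger0_norm ?sqr_ge0//; have := sqr_ge0 (f w + c); nra.
Qed.

Lemma Ex_sqr_center (f : T -> R) : measurable_fun setT f ->
  integ (fun w => f w ^+ 2) ->
  Ex (fun w => (f w - Ex f) ^+ 2) <= Ex (fun w => f w ^+ 2).
Proof.
move=> mf f2; have fi := integrable_of_sqr mf f2; set c := Ex f.
have -> : (fun w => (f w - c) ^+ 2) = (fun w => f w ^+ 2 + ((- 2 * c) * f w + c ^+ 2)).
  by apply/funext => w; ring.
rewrite Ex_add//; last first.
  by apply: integrable_add; [exact: integrable_scale|exact: integrable_cst].
rewrite Ex_add//; [|exact: integrable_scale|exact: integrable_cst].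
by rewrite Ex_scale// Ex_cst -/c; have := sqr_ge0 c; nra.
Qed.

(** The covariances of the pairs that are not [near] vanish, and there are at most [m * n]
    other pairs among [n^2], each with covariance at most [S]. *)
Lemma variance_sparse_average (y : I -> T -> R) (near : rel I) (m : nat) (S : R) :
  (forall k, measurable_fun setT (y k)) ->
  (forall k, integ (fun w => y k w ^+ 2)) ->
  (forall k, k \in A -> Ex (fun w => y k w ^+ 2) <= S) ->
  (forall k k', k \in A -> k' \in A -> ~~ near k k' ->
    Ex (fun w => y k w * y k' w) = Ex (y k) * Ex (y k')) ->
  (forall k, k \in A -> (#|[set k' in A | near k k']| <= m)%N) ->
  Ex (fun w => (n^-1 * \sum_(k in A) (y k w - Ex (y k))) ^+ 2) <= m%:R / n * S.
Proof.
move=> my y2 yS yind nearm.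
have yi k : integ (y k) by exact: integrable_of_sqr.
pose c k w := y k w - Ex (y k).
have mc k : measurable_fun setT (c k) by exact: measurable_center.
have c2 k : integ (fun w => c k w ^+ 2) by exact: integrable_sqr_center.
have cc k k' : integ (fun w => c k w * c k' w) by exact: integrable_product.
have cS k : k \in A -> Ex (fun w => c k w ^+ 2) <= S.
  by move=> kA; apply: le_trans (yS _ kA); exact: Ex_sqr_center.
have cov k k' : k \in A -> k' \in A -> Ex (fun w => c k w * c k' w) <= (near k k')%:R * S.
  move=> kA k'A; case nkk' : (near k k'); rewrite ?mul1r ?mul0r.
    (* The Cauchy-Schwarz inequality, in the form of the arithmetic mean. *)
    apply: (@le_trans _ _ (Ex (fun w => 2^-1 * (c k w ^+ 2 + c k' w ^+ 2)))).
      apply: Ex_le => //; first by apply: integrable_scale; exact: integrable_add.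
      by move=> w; have := sqr_ge0 (c k w - c k' w); nra.
    rewrite Ex_scale; last exact: integrable_add.
    by rewrite Ex_add// ler_pdivrMl// mulr_natl mulr2n lerD ?cS.
  have -> : (fun w => c k w * c k' w) = (fun w => y k w * y k' w +
      ((- Ex (y k')) * y k w + ((- Ex (y k)) * y k' w + Ex (y k) * Ex (y k')))).
    by apply/funext => w; rewrite /c; ring.
  rewrite Ex_add; [|exact: integrable_product|]; last first.
    apply: integrable_add; first exact: integrable_scale.
    by apply: integrable_add; [exact: integrable_scale|exact: integrable_cst].
  rewrite Ex_add; [|exact: integrable_scale|]; last first.
    by apply: integrable_add; [exact: integrable_scale|exact: integrable_cst].
  rewrite Ex_add; [|exact: integrable_scale|exact: integrable_cst].
  rewrite yind ?nkk'// Ex_cst !Ex_scale//; lra.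
have -> : (fun w => (n^-1 * \sum_(k in A) (y k w - Ex (y k))) ^+ 2) =
    (fun w => n^-1 ^+ 2 * \sum_(k in A) \sum_(k' in A) c k w * c k' w).
  apply/funext => w; rewrite exprMn; congr (_ * _); rewrite expr2 mulr_suml.
  by apply: eq_bigr => k _; rewrite mulr_sumr.
rewrite Ex_scale; last first.
  by apply: integrable_sumr => k _; apply: integrable_sumr => k' _.
rewrite Ex_sumr; last by move=> k _; apply: integrable_sumr => k' _.
have S0 : 0 <= S.
  have [k kA] : exists k, k \in A by apply/set0Pn; rewrite -card_gt0.
  by apply: le_trans (yS _ kA); apply: Ex_ge0 => w; exact: sqr_ge0.
apply: (@le_trans _ _ (n^-1 ^+ 2 * \sum_(k in A) (m%:R * S))); last first.
  rewrite sumr_const -[X in _ * X]mulr_natl -/n le_eqVlt; apply/orP; left; apply/eqP.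
  by field; rewrite gt_eqF.
rewrite ler_wpM2l ?sqr_ge0//; apply: ler_sum => k kA.
rewrite Ex_sumr//; apply: (@le_trans _ _ (\sum_(k' in A) (near k k')%:R * S)).
  by apply: ler_sum => k' k'A; exact: cov.
rewrite -mulr_suml ler_wpM2r// -natr_sum ler_nat; apply: leq_trans (nearm _ kA).
rewrite -sum1_card big_mkcond [X in (_ <= X)%N]big_mkcond /=; apply: leq_sum => k' _.
by rewrite inE; case: (k' \in A) => //=; case: (near k k').
Qed.

(** Replacing each variable by a shorter-range one costs the mean square of the error. *)
Lemma variance_approximated_average (x y z : I -> T -> R) (near : rel I) (m : nat) (S Z : R) :
  (forall k, measurable_fun setT (x k)) ->
  (forall k, measurable_fun setT (y k)) ->
  (forall k, integ (fun w => y k w ^+ 2)) ->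
  (forall k, integ (fun w => z k w ^+ 2)) ->
  (forall k w, `|x k w - y k w| <= z k w) ->
  (forall k, k \in A -> Ex (fun w => y k w ^+ 2) <= S) ->
  (forall k, k \in A -> Ex (fun w => z k w ^+ 2) <= Z) ->
  (forall k k', k \in A -> k' \in A -> ~~ near k k' ->
    Ex (fun w => y k w * y k' w) = Ex (y k) * Ex (y k')) ->
  (forall k, k \in A -> (#|[set k' in A | near k k']| <= m)%N) ->
  let U w := n^-1 * \sum_(k in A) (x k w - Ex (x k)) in
  [/\ measurable_fun setT U, integ (fun w => U w ^+ 2) &
  Ex (fun w => U w ^+ 2) <= 2 * (m%:R / n * S) + 2 * Z].
Proof.
move=> mx my y2 z2 xyz yS zZ yind nearm U.
pose e k w := x k w - y k w.
have me k : measurable_fun setT (e k) by exact: measurable_funB.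
have e2z k w : e k w ^+ 2 <= z k w ^+ 2.
  have := xyz k w; rewrite ler_norml => /andP[h1 h2]; rewrite /e.
  have : 0 <= z k w by apply: le_trans (xyz k w).
  by nra.
have e2 k : integ (fun w => e k w ^+ 2).
  apply: (@integrable_dominated _ _ _ P _ (fun w => z k w ^+ 2)) => //.
    exact: measurable_funX.
  by move=> w; rewrite ger0_norm ?sqr_ge0.
have yi k : integ (y k) by exact: integrable_of_sqr.
have ei k : integ (e k) by exact: integrable_of_sqr.
have xE k : Ex (x k) = Ex (y k) + Ex (e k).
  by rewrite -Ex_add//; congr (Ex _); apply/funext => w; rewrite /e; ring.
pose V w := n^-1 * \sum_(k in A) (y k w - Ex (y k)).
pose W w := n^-1 * \sum_(k in A) (e k w - Ex (e k)).
have UVW w : U w = V w + W w.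
  rewrite /U /V /W -mulrDr -big_split; congr (_ * _); apply: eq_bigr => k _ /=.
  by rewrite xE /e; ring.
have mavg (f : I -> T -> R) (c : I -> R) : (forall k, measurable_fun setT (f k)) ->
    measurable_fun setT (fun w => n^-1 * \sum_(k in A) (f k w - c k)).
  move=> mf; apply: measurable_funM => //; apply: measurable_sumr => k _.
  exact: measurable_center.
have iavg (f : I -> T -> R) (c : I -> R) : (forall k, measurable_fun setT (f k)) ->
    (forall k, integ (fun w => f k w ^+ 2)) ->
    integ (fun w => (n^-1 * \sum_(k in A) (f k w - c k)) ^+ 2).
  move=> mf f2; apply: (@integrable_dominated _ _ _ P _
      (fun w => n^-1 * \sum_(k in A) (f k w - c k) ^+ 2)).
  - by apply: measurable_funX; exact: mavg.
  - by apply: integrable_scale; apply: integrable_sumr => k _; exact: integrable_sqr_center.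
  - by move=> w; rewrite ger0_norm ?sqr_ge0//; exact: average_sqr_le.
have U2le w : U w ^+ 2 <= 2 * V w ^+ 2 + 2 * W w ^+ 2.
  by rewrite UVW; have := sqr_ge0 (V w - W w); nra.
have mU : measurable_fun setT U by exact: mavg.
have VWi : integ (fun w => 2 * V w ^+ 2 + 2 * W w ^+ 2).
  by apply: integrable_add; apply: integrable_scale; exact: iavg.
have U2i : integ (fun w => U w ^+ 2).
  apply: (@integrable_dominated _ _ _ P _ _ _ VWi) => //; first exact: measurable_funX.
  by move=> w; rewrite ger0_norm ?sqr_ge0.
split => //.
apply: le_trans (Ex_le U2i VWi U2le) _.
rewrite Ex_add; [|by apply: integrable_scale; exact: iavg..].
rewrite !Ex_scale; [|exact: iavg..].
rewrite lerD// ler_wpM2l//; first exact: (variance_sparse_average my y2 yS yind nearm).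
apply: (@le_trans _ _ (Ex (fun w => n^-1 * \sum_(k in A) (e k w - Ex (e k)) ^+ 2))).
  apply: Ex_le; [exact: iavg| |by move=> w; exact: average_sqr_le].
  by apply: integrable_scale; apply: integrable_sumr => k _; exact: integrable_sqr_center.
rewrite Ex_scale; last by apply: integrable_sumr => k _; exact: integrable_sqr_center.
rewrite Ex_sumr; last by move=> k _; exact: integrable_sqr_center.
apply: average_le => // k kA; apply: le_trans (Ex_sqr_center (me k) (e2 k)) _.
apply: le_trans (zZ _ kA); apply: Ex_le => //.
Qed.

End weakly_dependent_averages.

(** * Stable integrals *)

Section subadditivity.
Context {R : realType}.

(** For a number in the unit interval the power [g] is at least the identity; this is applied
    to the proportions of [x] and [y] in their sum. *)
Lemma powR_subadditive (x y g : R) : 0 <= x -> 0 <= y -> 0 < g <= 1 ->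
  (x + y) `^ g <= x `^ g + y `^ g.
Proof.
move=> x0 y0 /andP[g0 g1].
have [s0|s0] := leP (x + y) 0.
  have -> : x + y = 0 by apply/eqP; rewrite eq_le s0 addr_ge0.
  by rewrite powR0 ?gt_eqF// addr_ge0 ?powR_ge0.
have part z : 0 <= z -> z <= x + y -> z / (x + y) * (x + y) `^ g <= z `^ g.
  move=> z0 zs; have [->|zn0] := eqVneq z 0; first by rewrite !mul0r powR_ge0.
  have zp : 0 < z by rewrite lt_neqAle eq_sym zn0.
  rewrite {2}(_ : z = z / (x + y) * (x + y)); last by rewrite divfK// gt_eqF.
  rewrite [X in _ <= X]powRM ?divr_ge0 ?(ltW s0)// ler_wpM2r ?powR_ge0//.
  by rewrite ger1_powR// divr_gt0//= ler_pdivrMr// mul1r.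
have -> : (x + y) `^ g = x / (x + y) * (x + y) `^ g + y / (x + y) * (x + y) `^ g.
  by rewrite -mulrDl -mulrDl divff ?mul1r// gt_eqF.
by rewrite lerD// part// ?lerDl ?lerDr.
Qed.

Lemma normr_powR_subadditive (a b g : R) : 0 < g <= 1 ->
  `|a + b| `^ g <= `|a| `^ g + `|b| `^ g.
Proof.
move=> g01; have /andP[g0 _] := g01.
apply: le_trans (powR_subadditive _ _ g01) => //.
by rewrite ge0_ler_powR ?nnegrE ?addr_ge0// ?(ltW g0)// ler_normD.
Qed.

Lemma normr_powR_diff (a b g : R) : 0 < g <= 1 ->
  `| `|a| `^ g - `|b| `^ g | <= `|a - b| `^ g.
Proof.
move=> g01; rewrite ler_norml; apply/andP; split.
  rewrite lerNl opprB lerBlDr distrC.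
  by apply: le_trans (normr_powR_subadditive _ _ g01); rewrite subrK.
rewrite lerBlDr.
by apply: le_trans (normr_powR_subadditive _ _ g01); rewrite subrK.
Qed.

End subadditivity.

Section stable_integrals.
Context {R : realType} d (T : measurableType d) (P : probability T R).
Variables (alpha : R) (SI : (R -> R) -> {RV P >-> R}).
Hypothesis alpha12 : 1 < alpha < 2.
Hypothesis HSI : is_stable_integral alpha SI.

Let alpha1 : 1 < alpha. Proof. by case/andP: alpha12. Qed.

Local Notation integ f := (P.-integrable setT (EFin \o f)).
Local Notation "'Ex' f" := (Rintegral P setT f) (at level 10).

Lemma measurable_norm_powR (f : T -> R) (g : R) : measurable_fun setT f ->
  measurable_fun setT (fun w => `|f w| `^ g).
Proof.
move=> mf; apply: (measurableT_comp (@measurable_powR R g)).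
exact: measurableT_comp.
Qed.

Lemma stable_integral_moment (f : R -> R) (g : R) : Lalpha alpha f -> 0 < g <= 1 ->
  (\int[P]_w (`|SI f w| `^ g)%:E = (stable_moment alpha g * alpha_norm alpha f `^ g)%:E)%E.
Proof.
move=> Lf g01; apply: SaS_moment => //; first exact: alpha_norm_ge0.
exact: (stable_integral_law HSI Lf).
Qed.

Lemma stable_integral_moment_ae (Y : T -> R) (f : R -> R) (g : R) :
  measurable_fun setT Y -> {ae P, forall w, Y w = SI f w} ->
  Lalpha alpha f -> 0 < g <= 1 ->
  integ (fun w => `|Y w| `^ g) /\
  Ex (fun w => `|Y w| `^ g) = stable_moment alpha g * alpha_norm alpha f `^ g.
Proof.
move=> mY Yf Lf g01.
have E : (\int[P]_w (`|Y w| `^ g)%:E =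
    (stable_moment alpha g * alpha_norm alpha f `^ g)%:E)%E.
  rewrite -(stable_integral_moment Lf g01); apply: ge0_ae_eq_integral => //.
  - by apply/measurable_EFinP; exact: measurable_norm_powR.
  - by apply/measurable_EFinP; exact: measurable_norm_powR.
  - by apply: filterS Yf => w -> _.
have [|||i _] := @ge0_integral_finite R d T P (fun w => `|Y w| `^ g)
    (stable_moment alpha g * alpha_norm alpha f `^ g).
- exact: measurable_norm_powR.
- by move=> w; exact: powR_ge0.
- by rewrite E.
by split => //; rewrite /Rintegral E.
Qed.

Lemma stable_integral_sum (n : nat) (c : 'I_n -> R) (f : 'I_n -> R -> R) :
  (forall i, Lalpha alpha (f i)) ->
  Lalpha alpha (fun s => \sum_(i < n) c i * f i s) /\
  {ae P, forall w, SI (fun s => \sum_(i < n) c i * f i s) w = \sum_(i < n) c i * SI (f i) w}.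
Proof.
elim: n c f => [|n IH] c f Lf.
  have L0 : Lalpha alpha (fun s : R => \sum_(i < 0) c i * f i s).
    rewrite (_ : (fun s => _) = (fun=> 0 : R)); last by apply/funext => s; rewrite big_ord0.
    have a1 : (1 <= alpha%:E)%E by rewrite lee_fin ltW.
    by have [] := @Lfun_submod_closed _ _ R (@lebesgue_measure R) _ a1.
  split => //.
  (* Linearity with null coefficients shows that the integral of zero vanishes almost surely. *)
  have := stable_integral_linear HSI 0 0 L0 L0; apply: filterS => w.
  move=> E; rewrite [RHS]big_ord0; move: E; rewrite !mul0r addr0 => E.
  rewrite -[RHS]E; congr (SI _ w).
  by apply/funext => s; rewrite big_ord0 !mul0r addr0.
have [Ln En] := IH (fun i => c (widen_ord (leqnSn n) i))
  (fun i => f (widen_ord (leqnSn n) i)) (fun i => Lf _).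
have -> : (fun s => \sum_(i < n.+1) c i * f i s) =
   (fun s => 1 * (\sum_(i < n) c (widen_ord (leqnSn n) i) * f (widen_ord (leqnSn n) i) s) +
     c ord_max * f ord_max s).
  by apply/funext => s; rewrite big_ord_recr mul1r.
split; first exact: LalphaZD.
have := stable_integral_linear HSI 1 (c ord_max) Ln (Lf ord_max).
by apply: filterS2 En => w E ->; rewrite mul1r E big_ord_recr.
Qed.

Lemma stable_integral_independent (f g : R -> R) (phi psi : R -> R) :
  Lalpha alpha f -> Lalpha alpha g -> (forall s, f s = 0 \/ g s = 0) ->
  measurable_fun setT phi -> measurable_fun setT psi ->
  (forall x, 0 <= phi x) -> (forall x, 0 <= psi x) ->
  (\int[P]_w (phi (SI f w) * psi (SI g w))%:E =
   \int[P]_w (phi (SI f w))%:E * \int[P]_w (psi (SI g w))%:E)%E.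
Proof.
move=> Lf Lg fg mphi mpsi phi0 psi0; apply: independent_integralM => // A B mA mB.
pose F (i : 'I_2) := if i == ord0 then f else g.
have LF i : Lalpha alpha (F i) by rewrite /F; case: ifP.
have dis i j : i != j -> ae_disjoint_supports (F i) (F j).
  move=> ij; apply: aeW => s; rewrite /F.
  case: (eqVneq i ord0) => i0; case: (eqVneq j ord0) => j0.
  - by move: ij; rewrite i0 j0 eqxx.
  - exact: fg.
  - by case: (fg s) => h; [right|left].
  - exfalso; move: ij i0 j0; rewrite -!val_eqE /=.
    by have := ltn_ord i; have := ltn_ord j; lia.
have mB' (i : 'I_2) : measurable (if i == ord0 then A else B) by case: ifP.
have := stable_integral_scattered HSI LF dis mB'.
rewrite big_ord_recl big_ord1 /= => <-.
congr (P _); apply/seteqP; split => w /=.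
  move=> [wA wB] i _; rewrite /F.
  by case: (eqVneq i ord0) => _.
by move=> h; split; [exact: (h ord0)|exact: (h (lift ord0 ord0))].
Qed.

End stable_integrals.

(** * Increments and their frozen versions *)

Section increments.
Context {R : realType} d (T : measurableType d) (P : probability T R).
Variables (alpha : R) (SI : (R -> R) -> {RV P >-> R}).
Hypothesis alpha12 : 1 < alpha < 2.
Hypothesis HSI : is_stable_integral alpha SI.
Variable X : R -> R -> {RV P >-> R}.
Hypothesis HX : is_field_X alpha SI X.
Variables (H : R -> R) (hlo hhi : R).
Hypotheses (hlo_gt : alpha^-1 < hlo) (hhi_lt1 : hhi < 1).
Hypothesis Hrange : forall t : R, 0 <= t <= 1 -> hlo <= H t <= hhi.
Variables (cH rho : R).
Hypothesis cH0 : 0 <= cH.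
Hypothesis rho01 : 0 < rho <= 1.
Hypothesis Hholder : forall t1 t2 : R, 0 <= t1 <= 1 -> 0 <= t2 <= 1 ->
  `|H t1 - H t2| <= cH * `|t1 - t2| `^ rho.
Variable beta : R.
Hypothesis beta14 : 0 < beta <= 4^-1.
Variable L : nat.
Hypothesis L2 : (2 <= L)%N.

Let alpha1 : 1 < alpha. Proof. by case/andP: alpha12. Qed.
Let b2 : 0 < beta * 2 <= 1. Proof. by move: beta14; lra. Qed.
Let b4 : 0 < beta * 4 <= 1. Proof. by move: beta14; lra. Qed.

Local Notation integ f := (P.-integrable setT (EFin \o f)).
Local Notation "'Ex' f" := (Rintegral P setT f) (at level 10).

Definition grid_H (M k : nat) : R := H (k%:R / M%:R).

(** The increment at [k / M] of the field whose Hurst index is frozen at [H (k / M)]; the kernel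
    of the near part starts [m] mesh steps before [k / M]. *)
Definition near_increment (m : R) (M k : nat) : {RV P >-> R} :=
  SI (rescale alpha (stencil_near alpha L m (grid_H M k)) (grid_H M k) M k).
Definition far_increment (m : R) (M k : nat) : {RV P >-> R} :=
  SI (rescale alpha (stencil_far alpha L m (grid_H M k)) (grid_H M k) M k).
Definition frozen_increment m M k (w : T) : R :=
  near_increment m M k w + far_increment m M k w.

Section fixed_index.
Variables (m : R) (M k : nat).
Hypotheses (m1 : 1 <= m) (M0 : (0 < M)%N) (kM : (k + L <= M)%N).

Let MR : 0 < M%:R :> R. Proof. by rewrite ltr0n. Qed.

Lemma grid_point (l : nat) : (l <= L)%N -> 0 <= ((k + l)%:R / M%:R : R) <= 1.
Proof.
move=> lL; rewrite divr_ge0//= ler_pdivrMr// mul1r ler_nat.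
by apply: leq_trans kM; rewrite leq_add2l.
Qed.

Let v := grid_H M k.

Lemma grid_in_range : in_range hlo hhi v.
Proof. by apply: Hrange; have := grid_point (leq0n L); rewrite addn0. Qed.

Let vr := grid_in_range.

Lemma measurable_frozen : measurable_fun setT (frozen_increment m M k).
Proof. exact: measurable_funD. Qed.

Let LalphaS := (Lalpha_stencil alpha1 hlo_gt hhi_lt1 L2 vr).
Let LalphaN := (Lalpha_stencil_near alpha1 hlo_gt hhi_lt1 L2 m vr).
Let LalphaF := (Lalpha_stencil_far alpha1 hlo_gt hhi_lt1 L2 m1 vr).
Let rescaled phi (Lp : Lalpha alpha phi) := Lalpha_rescale alpha1 v k M0 Lp.

Lemma frozen_incrementE : {ae P, forall w,
  frozen_increment m M k w = SI (rescale alpha (stencil alpha L v) v M k) w}.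
Proof.
have := stable_integral_linear HSI 1 1 (rescaled LalphaN.1).1 (rescaled LalphaF.1).1.
apply: filterS => w; rewrite !mul1r /frozen_increment => <-; congr (SI _ w).
apply/funext => s; rewrite !mul1r /rescale -mulrDr; congr (_ * _).
exact: esym (stencil_split _ _ _ _ _).
Qed.

Lemma frozen_moment (g : R) : 0 < g <= 1 ->
  integ (fun w => `|frozen_increment m M k w| `^ g) /\
  Ex (fun w => `|frozen_increment m M k w| `^ g) =
    stable_moment alpha g * (M%:R `^ (- v) * alpha_norm alpha (stencil alpha L v)) `^ g.
Proof.
move=> g01; have [L1 N1] := rescaled LalphaS.1; rewrite -N1.
exact: (stable_integral_moment_ae alpha12 HSI measurable_frozen frozen_incrementE L1 g01).
Qed.

Let part_moment phi C : Lalpha alpha phi -> alpha_norm alpha phi <= C ->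
  integ (fun w => (`|SI (rescale alpha phi v M k) w| `^ beta) ^+ 2) /\
  Ex (fun w => (`|SI (rescale alpha phi v M k) w| `^ beta) ^+ 2) <=
    stable_moment alpha (beta * 2) * (M%:R `^ (- v) * C) `^ (beta * 2).
Proof.
move=> Lp pC; have [L1 N1] := rescaled Lp.
have -> : (fun w => (`|SI (rescale alpha phi v M k) w| `^ beta) ^+ 2) =
    (fun w => `|SI (rescale alpha phi v M k) w| `^ (beta * 2)).
  by apply/funext => w; rewrite powRrM powR_mulrn// powR_ge0.
have [||i ->] := @stable_integral_moment_ae _ _ _ P alpha SI alpha12 HSI
  (SI (rescale alpha phi v M k)) _ (beta * 2) _ _ L1 b2.
- by [].
- exact: aeW.
split => //; rewrite ler_wpM2l ?(ltW (stable_moment_gt0 alpha12 b2))//.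
have C0 : 0 <= C by exact: le_trans (alpha_norm_ge0 _ _) pC.
have g0 : 0 <= beta * 2 by case/andP: b2 => /ltW.
rewrite N1; apply: ge0_ler_powR => //.
- by rewrite nnegrE mulr_ge0 ?powR_ge0 ?alpha_norm_ge0.
- by rewrite nnegrE mulr_ge0 ?powR_ge0.
- by rewrite ler_wpM2l ?powR_ge0.
Qed.

Lemma near_moment :
  integ (fun w => (`|near_increment m M k w| `^ beta) ^+ 2) /\
  Ex (fun w => (`|near_increment m M k w| `^ beta) ^+ 2) <=
    stable_moment alpha (beta * 2) *
    (M%:R `^ (- v) * stencil_size alpha hhi L) `^ (beta * 2).
Proof. exact: part_moment LalphaN.1 LalphaN.2. Qed.

Lemma far_moment :
  integ (fun w => (`|far_increment m M k w| `^ beta) ^+ 2) /\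
  Ex (fun w => (`|far_increment m M k w| `^ beta) ^+ 2) <=
    stable_moment alpha (beta * 2) *
    (M%:R `^ (- v) * (tail_const L * m `^ (- (L%:R - 1)))) `^ (beta * 2).
Proof. exact: part_moment LalphaF.1 LalphaF.2. Qed.

(** The Lipschitz constant of the kernels in the Hurst index, times the Hoelder constant of
    [H] over [L] mesh steps. *)
Definition freezing_const : R :=
  coef_mass L * (kernel_lipschitz alpha hlo hhi 1 * (cH * L%:R)) *
  alpha_norm alpha (envelope alpha hhi 1).

Let u (l : nat) : R := (k + l)%:R / M%:R.
Let vl (l : nat) : R := H (u l).
Let D (s : R) := \sum_(l < L.+1) coef_a R L l *
  (kernel_X alpha (u l) (vl l) s - kernel_X alpha (u l) v s).

Let ul (l : 'I_L.+1) : 0 <= u l <= 1.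
Proof. by apply: grid_point; rewrite -ltnS. Qed.

Let vlr (l : 'I_L.+1) : in_range hlo hhi (vl l).
Proof. exact: Hrange. Qed.

Let dv (l : 'I_L.+1) : `|vl l - v| <= cH * L%:R * M%:R `^ (- rho).
Proof.
have u0 : 0 <= (k%:R / M%:R : R) <= 1 by have := grid_point (leq0n L); rewrite addn0.
apply: le_trans (Hholder (ul l) u0) _; rewrite -mulrA ler_wpM2l//.
have -> : u l - k%:R / M%:R = l%:R / M%:R.
  by rewrite /u natrD mulrDl addrAC subrr add0r.
have /andP[r0 r1] := rho01.
rewrite ger0_norm ?divr_ge0// powRM ?invr_ge0// -powR_inv1// -powRrM mulN1r.
rewrite ler_wpM2r ?powR_ge0//.
apply: (@le_trans _ _ (L%:R `^ rho)).
  by rewrite ge0_ler_powR ?nnegrE ?ler_nat ?(ltW r0)// -ltnS.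
by rewrite ler1_powR// ler1n (leq_trans _ L2).
Qed.

Let LalphaD : Lalpha alpha D /\ alpha_norm alpha D <= freezing_const * M%:R `^ (- rho).
Proof.
have U1 : 1 <= (1 : R) by [].
have [|||x|LD ND] := @Lalpha_dominated R alpha alpha1 D (envelope alpha hhi 1)
  (coef_mass L * (kernel_lipschitz alpha hlo hhi 1 * (cH * L%:R * M%:R `^ (- rho)))).
- apply: measurable_sum => l; apply: measurable_funM => //.
  by apply: measurable_funB; exact: measurable_kernel.
- by rewrite !mulr_ge0 ?powR_ge0 ?coef_mass_ge0// kernel_lipschitz_ge0.
- exact: Lalpha_envelope.
- rewrite (ger0_norm (envelope_ge0 _ _ _ _)).
  apply: le_trans (ler_norm_sum _ _ _) _; rewrite /coef_mass !mulr_suml.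
  apply: ler_sum => l _; rewrite normrM -!mulrA ler_wpM2l//.
  apply: le_trans (kernel_lipschitz_envelope alpha1 hlo_gt hhi_lt1 U1 x (ul l) (vlr l) vr) _.
  rewrite -!mulrA ler_wpM2l ?kernel_lipschitz_ge0// !mulrA ler_wpM2r ?envelope_ge0//.
split => //; apply: le_trans ND _; rewrite /freezing_const.
by rewrite le_eqVlt; apply/orP; left; apply/eqP; ring.
Qed.

Let Y := LMSM X H.

Lemma measurable_incr_d : measurable_fun setT (incr_d Y L M k).
Proof.
rewrite /incr_d; apply: measurable_sumr => l _.
by apply: measurable_funM => //; exact: measurable_funP.
Qed.

Let incr_d_error_ae : {ae P, forall w, incr_d Y L M k w - frozen_increment m M k w = SI D w}.
Proof.
have U1 : 1 <= (1 : R) by [].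
have Lk l := Lalpha_kernel alpha1 hlo_gt hhi_lt1 U1 (ul l) (vlr l).
have Lk' l := Lalpha_kernel alpha1 hlo_gt hhi_lt1 U1 (ul l) vr.
have [L1 E1] := stable_integral_sum alpha12 HSI (fun l => coef_a R L l) Lk.
have [L3 E2] := stable_integral_sum alpha12 HSI (fun l => coef_a R L l) Lk'.
have EX : {ae P, forall w, forall l : 'I_L.+1, X (u l) (vl l) w =
    SI (kernel_X alpha (u l) (vl l)) w}.
  apply: filter_forall => l.
  apply: (field_X_version HX).
  split; rewrite /= in_itv/=; first exact: ul.
  have /andP[h1 h2] := vlr l.
  by rewrite (lt_le_trans hlo_gt h1) (le_lt_trans h2 hhi_lt1).
have E3 := stable_integral_linear HSI 1 (-1) L1 L3.
have E4 := frozen_incrementE.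
have E0 : {ae P, forall w, incr_d Y L M k w =
    SI (fun s => \sum_(l < L.+1) coef_a R L l * kernel_X alpha (u l) (vl l) s) w}.
  move: E1 EX; apply: filterS2 => w e1 ex; rewrite e1.
  by apply: eq_bigr => l _; congr (_ * _); exact: ex.
move: E0 E3 E4; apply: filterS3 => w e0 e3 e4; rewrite e0.
rewrite e4; have -> : rescale alpha (stencil alpha L v) v M k =
    (fun s => \sum_(l < L.+1) coef_a R L l * kernel_X alpha (u l) v s).
  by apply/funext => s; rewrite increment_kernelE.
have -> : D = (fun s => 1 * (\sum_(l < L.+1) coef_a R L l * kernel_X alpha (u l) (vl l) s) +
    (-1) * (\sum_(l < L.+1) coef_a R L l * kernel_X alpha (u l) v s)).
  apply/funext => s; rewrite mul1r mulN1r -sumrB; apply: eq_bigr => l _; ring.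
by rewrite e3; ring.
Qed.

(** The error is the integral of the difference of two kernels whose Hurst indices differ by
    [O(M^(- rho))]. It is not rescaled with the mesh, unlike the increment itself: this is
    where [rho] has to exceed the Hurst function. *)
Lemma freezing_error :
  integ (fun w => `|incr_d Y L M k w - frozen_increment m M k w| `^ (beta * 4)) /\
  Ex (fun w => `|incr_d Y L M k w - frozen_increment m M k w| `^ (beta * 4)) <=
   stable_moment alpha (beta * 4) * (freezing_const * M%:R `^ (- rho)) `^ (beta * 4).
Proof.
have mE : measurable_fun setT (fun w => incr_d Y L M k w - frozen_increment m M k w).
  by apply: measurable_funB; [exact: measurable_incr_d|exact: measurable_frozen].
have [i ->] := stable_integral_moment_ae alpha12 HSI mE incr_d_error_ae LalphaD.1 b4.
split => //; rewrite ler_wpM2l ?(ltW (stable_moment_gt0 alpha12 b4))//.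
have C0 := le_trans (alpha_norm_ge0 alpha D) LalphaD.2.
have g0 : 0 <= beta * 4 by case/andP: b4 => /ltW.
apply: ge0_ler_powR => //; last exact: LalphaD.2.
by rewrite nnegrE alpha_norm_ge0.
Qed.

End fixed_index.

End increments.

(** * Power variations around their means *)

(** The shift [k' + r - k] injects these indices into [0, ..., 2 r]. *)
Lemma card_near (K : nat) (A : {set 'I_K}) (r : nat) (k : 'I_K) :
  (#|[set k' in A | (k <= k' + r)%N && (k' <= k + r)%N]| <= r.*2.+1)%N.
Proof.
set S := [set _ in _ | _]%SET; rewrite cardE.
have inj : uniq (map (fun k' : 'I_K => (k' + r - k)%N) (enum S)).
  rewrite map_inj_in_uniq ?enum_uniq// => i j.
  rewrite !mem_enum !inE => /andP[_ /andP[h1 h2]] /andP[_ /andP[h3 h4]] e.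
  by apply: val_inj => /=; lia.
have := uniq_leq_size inj (s2 := iota 0 r.*2.+1).
rewrite size_map size_iota; apply => i /mapP[j].
rewrite mem_enum inE => /andP[_ /andP[h1 h2]] ->.
by rewrite mem_iota /=; lia.
Qed.

Section power_variation.
Context {R : realType} d (T : measurableType d) (P : probability T R).
Variables (alpha : R) (SI : (R -> R) -> {RV P >-> R}).
Hypothesis alpha12 : 1 < alpha < 2.
Hypothesis HSI : is_stable_integral alpha SI.
Variable X : R -> R -> {RV P >-> R}.
Hypothesis HX : is_field_X alpha SI X.
Variables (H : R -> R) (hlo hhi : R).
Hypotheses (hlo_gt : alpha^-1 < hlo) (hhi_lt1 : hhi < 1).
Hypothesis Hrange : forall t : R, 0 <= t <= 1 -> hlo <= H t <= hhi.
Variables (cH rho : R).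
Hypothesis cH0 : 0 <= cH.
Hypothesis rho01 : 0 < rho <= 1.
Hypothesis Hholder : forall t1 t2 : R, 0 <= t1 <= 1 -> 0 <= t2 <= 1 ->
  `|H t1 - H t2| <= cH * `|t1 - t2| `^ rho.
Variable beta : R.
Hypothesis beta14 : 0 < beta <= 4^-1.
Variable L : nat.
Hypothesis L2 : (2 <= L)%N.

Let alpha1 : 1 < alpha. Proof. by case/andP: alpha12. Qed.
Let b1 : 0 < beta <= 1. Proof. by move: beta14; lra. Qed.
Let b2 : 0 < beta * 2 <= 1. Proof. by move: beta14; lra. Qed.

Local Notation integ f := (P.-integrable setT (EFin \o f)).
Local Notation "'Ex' f" := (Rintegral P setT f) (at level 10).

(** The moment of order [beta] of the frozen increment. *)
Definition expected_power (M k : nat) : R := stable_moment alpha beta *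
  (M%:R `^ (- grid_H H M k) * alpha_norm alpha (stencil alpha L (grid_H H M k))) `^ beta.

Definition mean_power_var (M : nat) (I : set R) : R :=
  #|nu L M I|%:R^-1 * \sum_(k in nu L M I) expected_power M k.

Variables (M m : nat) (I : set R) (hmin : R).
Hypotheses (LM : (L <= M)%N) (m1 : (1 <= m)%N).
Hypothesis nu_gt0 : (0 < #|nu L M I|)%N.
Hypothesis Hmin : forall k : 'I_(M - L).+1, k \in nu L M I -> hmin <= grid_H H M k.

Let M0 : (0 < M)%N. Proof. by apply: leq_trans LM; apply: leq_trans L2. Qed.
Let m1R : 1 <= m%:R :> R. Proof. by rewrite ler1n. Qed.
Let kM (k : 'I_(M - L).+1) : (k + L <= M)%N.
Proof. by rewrite addnC -leq_subRL// -ltnS. Qed.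
Let n : R := #|nu L M I|%:R.
Let n_gt0 : 0 < n. Proof. by rewrite ltr0n. Qed.

Let y (k : 'I_(M - L).+1) (w : T) := `|near_increment alpha SI H L m%:R M k w| `^ beta.
Let z (k : 'I_(M - L).+1) (w : T) := `|far_increment alpha SI H L m%:R M k w| `^ beta.
Let x (k : 'I_(M - L).+1) (w : T) := `|frozen_increment alpha SI H L m%:R M k w| `^ beta.
(* The near parts at indices further apart integrate over disjoint intervals of time, hence
   are independent. *)
Let near (k k' : 'I_(M - L).+1) := (k <= k' + (m + L))%N && (k' <= k + (m + L))%N.

Let near_disjoint (k k' : 'I_(M - L).+1) : ~~ near k k' -> forall s,
  rescale alpha (stencil_near alpha L m%:R (grid_H H M k)) (grid_H H M k) M k s = 0 \/
  rescale alpha (stencil_near alpha L m%:R (grid_H H M k')) (grid_H H M k') M k' s = 0.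
Proof.
move=> nkk s.
wlog lt : k k' nkk / (k + (m + L) < k')%N => [hw|].
  move: (nkk); rewrite negb_and -!ltnNge => /orP[] h; last exact: hw.
  have /hw/(_ h) : ~~ near k' k by move: nkk; rewrite /near andbC.
  by case; [right|left].
have ltR : k%:R + (m%:R + L%:R) <= k'%:R :> R by rewrite -!natrD ler_nat ltnW.
have [le|lt'] := leP (M%:R * s - k'%:R) (- m%:R).
  by right; rewrite /rescale stencil_near_eq0 ?mulr0//; left.
left; rewrite /rescale stencil_near_eq0 ?mulr0//; right.
by move: lt' ltR; lra.
Qed.

Let my k : measurable_fun setT (y k).
Proof. by apply: measurable_norm_powR. Qed.

Let y2 k : integ (fun w => y k w ^+ 2).
Proof.
exact: (near_moment alpha12 HSI hlo_gt hhi_lt1 Hrange beta14 L2 m%:R M0 (kM k)).1.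
Qed.

Let uncorrelated k k' : ~~ near k k' ->
  Ex (fun w => y k w * y k' w) = Ex (y k) * Ex (y k').
Proof.
move=> nkk.
have yi j : integ (y j) by apply: integrable_of_sqr.
have Lk (j : 'I_(M - L).+1) := (Lalpha_rescale alpha1 (grid_H H M j) j M0 (Lalpha_stencil_near alpha1 hlo_gt hhi_lt1
  L2 m%:R (grid_in_range Hrange M0 (kM j))).1).1.
have mp : measurable_fun setT (fun r : R => `|r| `^ beta).
  exact: (measurableT_comp (@measurable_powR R beta) (@normr_measurable R setT)).
have p0 (r : R) : 0 <= `|r| `^ beta by exact: powR_ge0.
have E := stable_integral_independent alpha12 HSI (Lk k) (Lk k') (near_disjoint nkk) mp mp p0 p0.
have yyi : integ (fun w => y k w * y k' w) by exact: integrable_product.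
apply: EFin_inj; rewrite -(integrable_EFin yyi) EFinM.
transitivity (\int[P]_w (y k w)%:E * \int[P]_w (y k' w)%:E)%E; first exact: E.
congr (_ * _)%E; exact: integrable_EFin.
Qed.

Definition variance_bound : R := stable_moment alpha (beta * 2) *
  (M%:R `^ (- hmin) * stencil_size alpha hhi L) `^ (beta * 2).
Definition far_bound : R := stable_moment alpha (beta * 2) *
  (M%:R `^ (- hmin) * (tail_const L * m%:R `^ (- (L%:R - 1)))) `^ (beta * 2).

Let scale_le (k : 'I_(M - L).+1) (C : R) : k \in nu L M I -> 0 <= C ->
  stable_moment alpha (beta * 2) * (M%:R `^ (- grid_H H M k) * C) `^ (beta * 2) <=
  stable_moment alpha (beta * 2) * (M%:R `^ (- hmin) * C) `^ (beta * 2).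
Proof.
move=> kI C0; apply: ler_wpM2l; first exact: ltW (stable_moment_gt0 alpha12 b2).
have g0 : 0 <= beta * 2 by case/andP: b2 => /ltW.
apply: ge0_ler_powR => //; rewrite ?nnegrE ?mulr_ge0 ?powR_ge0//.
by rewrite ler_wpM2r// ler_powR ?ler1n// lerN2 Hmin.
Qed.

(** [A] is the average of the freezing errors and [B] the centred average of the frozen
    increments. The moments of order four of [A] and two of [B] exist because
    [beta * 4 <= 1 < alpha]. *)
Lemma power_variation_approximation : exists A B : T -> R,
  [/\ forall w, 0 <= A w,
      integ (fun w => A w ^+ 4) /\ Ex (fun w => A w ^+ 4) <=
        stable_moment alpha (beta * 4) *
        (freezing_const alpha hlo hhi cH L * M%:R `^ (- rho)) `^ (beta * 4),
      integ (fun w => B w ^+ 2) /\ Ex (fun w => B w ^+ 2) <=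
        2 * ((m + L).*2.+1%:R / n * variance_bound) + 2 * far_bound,
      measurable_fun setT A /\ measurable_fun setT B &
      forall w, `|power_var (LMSM X H) L beta M I w - mean_power_var M I| <= A w + `|B w|].
Proof.
have z2 (k : 'I_(M - L).+1) := far_moment alpha12 HSI hlo_gt hhi_lt1 Hrange beta14 L2 m1R M0 (kM k).
have yS := fun k : 'I_(M - L).+1 => (near_moment alpha12 HSI hlo_gt hhi_lt1 Hrange beta14 L2 m%:R M0 (kM k)).2.
have xm (k : 'I_(M - L).+1) := frozen_moment alpha12 HSI hlo_gt hhi_lt1 Hrange L2 m1R M0 (kM k) b1.
have mfro (k : 'I_(M - L).+1) := measurable_frozen alpha SI H L m%:R M k.
have mx k : measurable_fun setT (x k) by apply: measurable_norm_powR; exact: mfro.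
have xyz k w : `|x k w - y k w| <= z k w.
  apply: le_trans (normr_powR_diff _ _ b1) _.
  by rewrite /frozen_increment addrAC subrr add0r.
have [||mB B2 EB] := @variance_approximated_average R d T P _ (nu L M I) nu_gt0 x y z near
  (m + L).*2.+1 variance_bound far_bound mx my y2 (fun k => (z2 k).1) xyz _ _
  (fun k k' _ _ => @uncorrelated k k') (fun k _ => card_near (nu L M I) (m + L) k).
- by move=> k kI; apply: le_trans (yS k) _; apply: scale_le => //; exact: stencil_size_ge0.
- move=> k kI; apply: le_trans (z2 k).2 _; apply: scale_le => //.
  by rewrite mulr_ge0 ?powR_ge0 ?tail_const_ge0.
pose e (k : 'I_(M - L).+1) w := incr_d (LMSM X H) L M k w - frozen_increment alpha SI H L m%:R M k w.
have fe (k : 'I_(M - L).+1) := freezing_error alpha12 HSI HX hlo_gt hhi_lt1 Hrange cH0 rho01 Hholder beta14 L2 m1R M0 (kM k).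
have me k : measurable_fun setT (e k).
  by apply: measurable_funB; [exact: measurable_incr_d|exact: mfro].
pose A w := n^-1 * \sum_(k in nu L M I) `|e k w| `^ beta.
have mA : measurable_fun setT A.
  apply: measurable_funM => //; apply: measurable_sumr => k _.
  exact: measurable_norm_powR.
exists A, (fun w => n^-1 * \sum_(k in nu L M I) (x k w - Ex (x k))); split => //.
- move=> w; rewrite mulr_ge0 ?invr_ge0 ?(ltW n_gt0)//.
  by apply: sumr_ge0 => k _; exact: powR_ge0.
- have e4 k : (fun w => `|e k w| `^ (beta * 4)) = (fun w => (`|e k w| `^ beta) ^+ 4).
    by apply/funext => w; rewrite powRrM powR_mulrn// powR_ge0.
  have ie k : integ (fun w => (`|e k w| `^ beta) ^+ 4) by rewrite -e4; exact: (fe k).1.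
  have ia : integ (fun w => n^-1 * \sum_(k in nu L M I) (`|e k w| `^ beta) ^+ 4).
    by apply: integrable_scale; apply: integrable_sumr => k _.
  have Aa w : A w ^+ 4 <= n^-1 * \sum_(k in nu L M I) (`|e k w| `^ beta) ^+ 4.
    exact: average_pow4_le.
  have iA : integ (fun w => A w ^+ 4).
    apply: (integrable_dominated _ ia); first exact: measurable_funX.
    by move=> w; rewrite ger0_norm// exprn_even_ge0.
  split => //; apply: le_trans (Ex_le iA ia Aa) _.
  rewrite Ex_scale; last by apply: integrable_sumr => k _.
  rewrite Ex_sumr//; apply: average_le => // k _; rewrite -e4.
  exact: (fe k).2.
- move=> w; rewrite /power_var /mean_power_var -/n -mulrBr -sumrB.
  have -> : n^-1 * \sum_(k in nu L M I) (`|incr_d (LMSM X H) L M k w| `^ beta - expected_power M k) =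
    n^-1 * \sum_(k in nu L M I) (`|incr_d (LMSM X H) L M k w| `^ beta - x k w) +
    n^-1 * \sum_(k in nu L M I) (x k w - Ex (x k)).
    rewrite -mulrDr -big_split; congr (_ * _); apply: eq_bigr => k _ /=.
    by rewrite (xm k).2 /expected_power; ring.
  apply: le_trans (ler_normD _ _) _; rewrite lerD2r.
  rewrite normrM ger0_norm ?invr_ge0 ?(ltW n_gt0)// /A ler_wpM2l ?invr_ge0 ?(ltW n_gt0)//.
  apply: le_trans (ler_norm_sum _ _ _) _; apply: ler_sum => k _.
  exact: normr_powR_diff.
Qed.

End power_variation.

(** * Sums over the grid points of an interval *)

Section grid.
Context {R : realType}.
Variables (L : nat) (a b : R).
Hypotheses (a0 : 0 <= a) (ab : a < b) (b1 : b <= 1).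
Hypothesis L1 : (1 <= L)%N.
Let I : set R := `[a, b]%classic.

Lemma in_nu (M : nat) (k : 'I_(M - L).+1) :
  (k \in nu L M I) = (a <= k%:R / M%:R <= b).
Proof.
rewrite /nu finset.in_set; apply/idP/idP => [/set_mem|h].
  by rewrite /I /= in_itv.
by apply: mem_set; rewrite /I /= in_itv.
Qed.

Lemma card_nu_le (M : nat) : (0 < M)%N ->
  #|nu L M I|%:R <= M%:R * (b - a) + 2.
Proof.
move=> M0; have MR : 0 < M%:R :> R by rewrite ltr0n.
set p := Num.truncn (M%:R * a); set q := Num.truncn (M%:R * (b - a) + 1).
have Ma0 : 0 <= M%:R * a by rewrite mulr_ge0.
have q0 : 0 <= M%:R * (b - a) + 1 by rewrite addr_ge0// mulr_ge0// subr_ge0 ltW.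
have qP : (q%:R <= M%:R * (b - a) + 1) by rewrite /q; have /andP[] := truncn_itv q0.
have pP : p%:R <= M%:R * a < p.+1%:R by rewrite /p; exact: truncn_itv.
have bounds (k : 'I_(M - L).+1) : k \in nu L M I -> (p <= k < p + q.+1)%N.
  rewrite in_nu => /andP[h1 h2].
  have k1 : M%:R * a <= k%:R by rewrite mulrC -ler_pdivlMr.
  have k2 : k%:R <= M%:R * b by rewrite mulrC -ler_pdivrMr.
  have /andP[p1 p2] := pP.
  apply/andP; split; first by rewrite -(ler_nat R) (le_trans p1).
  rewrite addnS ltnS -leq_subLR /q truncn_ge_nat//.
  have pk : (p <= k)%N by rewrite -(ler_nat R) (le_trans p1).
  rewrite natrB//; move: p2; rewrite -natr1 => p2; lra.
apply: (@le_trans _ _ q.+1%:R); last by rewrite -natr1; lra.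
rewrite ler_nat cardE.
have inj : uniq (map (fun k : 'I_(M - L).+1 => (k - p)%N) (enum (nu L M I))).
  rewrite map_inj_in_uniq ?enum_uniq// => i j; rewrite !mem_enum => /bounds hi /bounds hj e.
  by apply: val_inj => /=; move: e hi hj; clear; lia.
have := uniq_leq_size inj (s2 := iota 0 q.+1); rewrite size_map size_iota; apply.
by move=> i /mapP[j]; rewrite mem_enum => /bounds hj ->; rewrite mem_iota /=; move: hj; clear; lia.
Qed.

(** The loss [L] comes from the indices above [M - L], which have no increment, and the loss 1
    from rounding. *)
Lemma card_nu_sub_ge (M : nat) (a' b' : R) : (L <= M)%N -> a <= a' -> a' <= b' -> b' <= b ->
  M%:R * (b' - a') - (L%:R + 1) <=
  #|[set k in nu L M I | a' <= k%:R / M%:R <= b']|%:R.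
Proof.
move=> LM aa ab' bb; have M0 : (0 < M)%N by exact: leq_trans LM.
have MR : 0 < M%:R :> R by rewrite ltr0n.
have [neg|pos] := leP (M%:R * (b' - a') - L%:R) 0.
  by apply: (@le_trans _ _ 0) => //; lra.
set j := Num.truncn (M%:R * (b' - a') - L%:R).
have /andP[j1 j2] : j%:R <= M%:R * (b' - a') - L%:R < j.+1%:R by exact: truncn_itv (ltW pos).
have Ma0 : 0 <= M%:R * a' by rewrite mulr_ge0// (le_trans a0).
set p := Num.truncn (M%:R * a').
have /andP[p1 p2] : p%:R <= M%:R * a' < p.+1%:R by exact: truncn_itv Ma0.
apply: (@le_trans _ _ j%:R); first by move: j2; rewrite -natr1; lra.
rewrite ler_nat.
have top (i : 'I_j) : (p.+1 + i)%:R <= M%:R * b' - L%:R :> R.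
  have : (i.+1%:R <= j%:R :> R) by rewrite ler_nat.
  by rewrite natrD -!natr1; lra.
have bd (i : 'I_j) : (p.+1 + i < (M - L).+1)%N.
  rewrite ltnS leq_subRL// -(ler_nat R) natrD.
  have := top i; have : M%:R * b' <= M%:R by rewrite -[leRHS]mulr1 ler_pM2l// (le_trans bb).
  lra.
pose f (i : 'I_j) : 'I_(M - L).+1 := Ordinal (bd i).
have finj : injective f by move=> i i' /(congr1 val) /= /addnI /val_inj.
have -> : j = #|[set f i | i in 'I_j]%SET| by rewrite card_imset// card_ord.
apply: subset_leq_card; apply/fintype.subsetP => k /imsetP[i _ ->]; rewrite inE in_nu /=.
have g1 : a' <= (p.+1 + i)%:R / M%:R.
  by rewrite ler_pdivlMr// mulrC natrD (le_trans (ltW p2))// lerDl.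
have g2 : (p.+1 + i)%:R / M%:R <= b'.
  rewrite ler_pdivrMr// mulrC (le_trans (top i))// gerBl//.
by rewrite g1 g2 (le_trans aa g1) (le_trans g2 bb).
Qed.

Lemma card_nu_ge (M : nat) : (L <= M)%N ->
  M%:R * (b - a) - (L%:R + 1) <= #|nu L M I|%:R.
Proof.
move=> LM; apply: le_trans (card_nu_sub_ge LM (lexx a) (ltW ab) (lexx b)) _.
rewrite ler_nat; apply: subset_leq_card; apply/fintype.subsetP => k.
by rewrite inE => /andP[].
Qed.

Definition grid_sum (M : nat) (F : R -> R) : R :=
  \sum_(k in nu L M I) F (k%:R / M%:R).

Let active (M k : nat) : bool := (k <= M - L)%N && (a <= k%:R / M%:R <= b).

Lemma grid_sumE (M K : nat) (F : R -> R) : (M - L < K)%N ->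
  grid_sum M F = \sum_(0 <= k < K) (active M k)%:R * F (k%:R / M%:R).
Proof.
move=> MK; rewrite /grid_sum; under eq_bigl do rewrite in_nu.
rewrite -(big_mkord (fun k => a <= k%:R / M%:R <= b) (fun k => F (k%:R / M%:R))).
rewrite (big_nat_widen _ _ _ _ _ MK) big_mkcond; apply: eq_bigr => k _.
by rewrite /active ltnS andbC; case: ifP => _; rewrite ?mul1r ?mul0r.
Qed.

Lemma sum_by_parity (G : nat -> R) (K : nat) :
  \sum_(0 <= k < K.*2) G k = \sum_(0 <= j < K) (G j.*2 + G j.*2.+1).
Proof.
elim: K => [|K IH]; first by rewrite !big_geq.
by rewrite doubleS !big_nat_recr//= IH addrA.
Qed.

Lemma sum_at_most_one (A : nat -> bool) (K : nat) :
  (forall i j, A i -> A j -> i = j) -> \sum_(0 <= j < K) (A j)%:R <= 1 :> R.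
Proof.
move=> uniqA; elim: K => [|K IH]; first by rewrite big_geq.
rewrite big_nat_recr//=; case AK : (A K); last by rewrite addr0.
rewrite big_nat big1 ?add0r// => j /andP[_ jK].
by case Aj : (A j) => //; move: jK; rewrite (uniqA _ _ Aj AK) ltnn.
Qed.

Lemma sum_top (K : nat) : \sum_(0 <= j < K.+1) (K - L < j)%N%:R <= L%:R :> R.
Proof.
rewrite -natr_sum ler_nat.
have [LK|KL] := leqP L K; last first.
  have -> : (K - L = 0)%N by apply/eqP; rewrite subn_eq0 ltnW.
  rewrite big_nat_recl//= add0n; apply: leq_trans (ltnW KL).
  by rewrite -[leqRHS]muln1 -[X in (X * 1)%N]subn0 -sum_nat_const_nat; apply: leq_sum.
have := leq_subr L K; rewrite -ltnS => lt.
rewrite (big_cat_nat _ (n := (K - L).+1))//= [X in (X + _)%N]big_nat big1 ?add0n; last first.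
  by move=> j /andP[_]; rewrite ltnS => jK; rewrite ltnNge jK.
apply: (@leq_trans (\sum_((K - L).+1 <= j < K.+1) 1)%N).
  by apply: leq_sum => j _; case: (_ < _)%N.
by rewrite sum_nat_const_nat muln1 subSS subKn.
Qed.

(** Halving the mesh: a grid point [k / (2 N)] lies within half a mesh of the grid
    point [k./2 / N]. The two grids over [[a, b]] match up to the last [L] indices and
    at most one index at each end point. *)
Lemma grid_sum_double (N : nat) (F : R -> R) (e Fmax : R) : (L <= N)%N -> 0 <= e ->
  (forall t, a <= t <= b -> 0 <= F t <= Fmax) ->
  (forall t t', a <= t <= b -> a <= t' <= b -> `|t - t'| <= (2 * N%:R)^-1 ->
    `|F t' - F t| <= e * F t) ->
  `|grid_sum (2 * N) F - 2 * grid_sum N F| <=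
    e * grid_sum N F + 2 * Fmax * (L%:R + 2).
Proof.
move=> LN e0 F0 Fe; have N0 : (0 < N)%N by exact: leq_trans LN.
have NR : 0 < N%:R :> R by rewrite ltr0n.
have N2 : (2 * N)%:R = 2 * N%:R :> R by rewrite natrM.
have s1 : (N - L < N.+1)%N by rewrite ltnS leq_subr.
have s2 : (2 * N - L < N.+1.*2)%N by clear; lia.
rewrite (grid_sumE F s1) (grid_sumE F s2) sum_by_parity.
rewrite 2!mulr_sumr -sumrB.
apply: le_trans (ler_norm_sum _ _ _) _.
(* [A] and [B] mark the end points: there the even point [j / N] lies in [[a, b]] without
   the odd point that follows it, or conversely. *)
pose A (j : nat) : bool := (j%:R <= N%:R * b) && (N%:R * b < j%:R + 2^-1).
pose B (j : nat) : bool := (j%:R < N%:R * a) && (N%:R * a <= j%:R + 2^-1).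
have aI : a <= a <= b by rewrite lexx ltW.
have Fmax0 : 0 <= Fmax by have /andP[h1 h2] := F0 _ aI; exact: le_trans h2.
have uniqA : \sum_(0 <= j < N.+1) (A j)%:R <= 1 :> R.
  apply: sum_at_most_one => i j /andP[i1 i2] /andP[j1 j2].
  have ij : (i < j.+1)%N by rewrite -(ltr_nat R) -natr1; lra.
  have ji : (j < i.+1)%N by rewrite -(ltr_nat R) -natr1; lra.
  by apply/eqP; rewrite eqn_leq -ltnS ij -ltnS ji.
have uniqB : \sum_(0 <= j < N.+1) (B j)%:R <= 1 :> R.
  apply: sum_at_most_one => i j /andP[i1 i2] /andP[j1 j2].
  have ij : (i < j.+1)%N by rewrite -(ltr_nat R) -natr1; lra.
  have ji : (j < i.+1)%N by rewrite -(ltr_nat R) -natr1; lra.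
  by apply/eqP; rewrite eqn_leq -ltnS ij -ltnS ji.
apply: (@le_trans _ _ (\sum_(0 <= j < N.+1) (e * ((active N j)%:R * F (j%:R / N%:R)) +
   2 * Fmax * ((N - L < j)%N%:R + (A j)%:R + (B j)%:R)))); last first.
  rewrite big_split /= lerD2l -mulr_sumr ler_wpM2l ?mulr_ge0//.
  rewrite !big_split /=; have := sum_top N; move: uniqA uniqB; lra.
rewrite ler_sum_nat// => j /andP[_ jN].
have half (k : nat) : k%:R / (2 * N)%:R = k%:R / 2 / N%:R :> R.
  by rewrite N2 invfM mulrA.
have dbl : j.*2%:R / 2 = j%:R :> R by rewrite -muln2 natrM mulfK.
have dblS : j.*2.+1%:R / 2 = j%:R + 2^-1 :> R by rewrite -natr1 mulrDl dbl mul1r.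
rewrite !half dbl dblS.
have actE (x : R) : (a <= x / N%:R <= b) = (N%:R * a <= x <= N%:R * b).
  by rewrite ler_pdivlMr// ler_pdivrMr// ![_ * N%:R]mulrC.
have a1 : active (2 * N) j.*2 = (j.*2 <= 2 * N - L)%N && (N%:R * a <= j%:R <= N%:R * b).
  by rewrite /active half dbl actE.
have a2 : active (2 * N) j.*2.+1 =
   (j.*2.+1 <= 2 * N - L)%N && (N%:R * a <= j%:R + 2^-1 <= N%:R * b).
  by rewrite /active half dblS actE.
have a3 : active N j = (j <= N - L)%N && (N%:R * a <= j%:R <= N%:R * b).
  by rewrite /active actE.
have Fb (x : R) : N%:R * a <= x <= N%:R * b -> 0 <= F (x / N%:R) <= Fmax.
  by move=> h; apply: F0; rewrite actE.
have bad0 (c : bool) : 0 <= 2 * Fmax * c%:R by rewrite !mulr_ge0.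
have [jL|Lj] := leqP j (N - L); last first.
  rewrite a3 leqNgt Lj /= !mul0r mulr0 subr0 mulr0 add0r.
  apply: (@le_trans _ _ (2 * Fmax)); last first.
    rewrite mulrDr mulrDr mulr1; have := bad0 (A j); have := bad0 (B j); lra.
  apply: le_trans (ler_normD _ _) _.
  have term (c : bool) (x : R) : (c -> N%:R * a <= x <= N%:R * b) ->
      `|c%:R * F (x / N%:R)| <= Fmax.
    case: c => [/(_ isT)/Fb/andP[f1 f2]|_]; first by rewrite mul1r ger0_norm.
    by rewrite mul0r normr0.
  have t1 := term (active (2 * N) j.*2) j%:R.
  have t2 := term (active (2 * N) j.*2.+1) (j%:R + 2^-1).
  have -> : 2 * Fmax = Fmax + Fmax by ring.
  by rewrite lerD// ?t1 ?t2// ?a1 ?a2 => /andP[].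
have p1 : (j.*2 <= 2 * N - L)%N by move: jL LN; clear; lia.
have p2 : (j.*2.+1 <= 2 * N - L)%N by move: jL LN L1; clear; lia.
rewrite a1 a2 a3 jL p1 p2 /=.
rewrite add0r.
have cmpE (x : R) : (x / N%:R - (x + 2^-1) / N%:R) = - (2 * N%:R)^-1.
  by field; rewrite gt_eqF.
set f0 := F (j%:R / N%:R); set f1 := F ((j%:R + 2^-1) / N%:R).
have [h0|h0] := boolP (N%:R * a <= j%:R <= N%:R * b);
  have [h1|h1] := boolP (N%:R * a <= j%:R + 2^-1 <= N%:R * b); rewrite ?mul1r ?mul0r ?mulr0.
- have -> : f0 + f1 - 2 * f0 = f1 - f0 by ring.
  apply: (@le_trans _ _ (e * f0)); last first.
    by rewrite lerDl mulrDr; have := bad0 (A j); have := bad0 (B j); lra.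
  by apply: Fe; rewrite ?actE// cmpE normrN ger0_norm// invr_ge0 mulr_ge0.
- have Aj : A j.
    move: h0 h1; rewrite /A => /andP[h2 h3]; rewrite h3 /= negb_and -!ltNge => /orP[]; lra.
  have /andP[g0 g1] := Fb _ h0; rewrite -/f0 in g0 g1.
  rewrite Aj addr0 (_ : f0 - 2 * f0 = - f0); last by ring.
  rewrite normrN ger0_norm// mulrDr mulr1; have := bad0 (B j).
  by have := mulr_ge0 e0 g0; lra.
- have Bj : B j.
    move: h0 h1; rewrite /B => h0 /andP[h2 h3]; rewrite h2 andbT; move: h0.
    rewrite negb_and -!ltNge => /orP[]; lra.
  have /andP[g0 g1] := Fb _ h1; rewrite -/f1 in g0 g1.
  rewrite Bj add0r subr0 ger0_norm// mulrDr mulr1; have := bad0 (A j).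
  lra.
- by rewrite addr0 subr0 normr0 add0r mulrDr addr_ge0.
Qed.

End grid.

(** * Bias of the logarithm of the ratio of means *)

Section logarithm_bounds.
Context {R : realType}.

Lemma ln3_ge1 : 1 <= ln (3 : R).
Proof.
have h : ln (1 + (- 6^-1)) <= - 6^-1 :> R by apply: le_ln1Dx; lra.
have e : 1 + (- 6^-1) = (6 / 5)^-1 :> R by lra.
move: h; rewrite e lnV ?posrE ?lerN2; last by lra.
move=> h; apply: (@le_trans _ _ (ln ((6 / 5) ^+ 6 : R))).
  by rewrite lnXn; [move: h; rewrite -mulr_natl; lra|lra].
by rewrite ler_ln ?posrE ?exprn_gt0//; lra.
Qed.

Lemma ln2_ge_half : 2^-1 <= ln (2 : R).
Proof.
have h : ln (1 + (- 2^-1)) <= - 2^-1 :> R by apply: le_ln1Dx; lra.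
have e : 1 + (- 2^-1) = 2^-1 :> R by lra.
by move: h; rewrite e lnV ?posrE ?lerN2.
Qed.

Lemma ln2_le1 : ln (2 : R) <= 1.
Proof. by have := @le_ln1Dx R 1; rewrite (_ : 1 + 1 = 2 :> R) => [->//|]; lra. Qed.

Lemma ln_quotient_le (x y : R) : 0 < x -> 0 < y -> ln x - ln y <= (x - y) / y.
Proof.
move=> x0 y0; rewrite -ln_div ?posrE//.
have -> : x / y = 1 + (x - y) / y by field; rewrite gt_eqF.
apply: le_ln1Dx; rewrite -subr_gt0 opprK.
have -> : (x - y) / y + 1 = x / y by field; rewrite gt_eqF.
exact: divr_gt0.
Qed.

Lemma ln_near_one (x d : R) : `|x - 1| <= d -> d <= 2^-1 -> `|ln x| <= 2 * d.
Proof.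
rewrite ler_norml => /andP[x1 x2] d2; have x0 : 0 < x by lra.
rewrite ler_norml; apply/andP; split.
  have := ln_quotient_le ltr01 x0; rewrite ln1 sub0r => h.
  rewrite lerNl; apply: le_trans h _; rewrite ler_pdivrMr//; nra.
have := ln_quotient_le x0 ltr01; rewrite ln1 subr0 divr1; lra.
Qed.

End logarithm_bounds.

Section bias.
Context {R : realType}.
Variables (L : nat) (H : R -> R) (cH rho beta : R).
Variables (psi : R -> R) (plo phi pl : R).
Hypothesis L2 : (2 <= L)%N.
Hypothesis H01 : forall t, 0 <= t <= 1 -> 0 <= H t <= 1.
Hypothesis cH0 : 0 <= cH.
Hypothesis rho1 : 2^-1 <= rho <= 1.
Hypothesis Hholder : forall t1 t2 : R, 0 <= t1 <= 1 -> 0 <= t2 <= 1 ->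
  `|H t1 - H t2| <= cH * `|t1 - t2| `^ rho.
Hypothesis beta14 : 0 < beta <= 4^-1.
Hypothesis plo0 : 0 < plo.
Hypothesis psiP : forall t, 0 <= t <= 1 -> plo <= psi (H t) <= phi.
Hypothesis pl0 : 0 <= pl.
Hypothesis psiL : forall t1 t2, 0 <= t1 <= 1 -> 0 <= t2 <= 1 ->
  `|psi (H t1) - psi (H t2)| <= pl * `|H t1 - H t2| `^ beta.

Definition admissible (a b : R) (M : nat) : Prop :=
  [/\ 0 <= a, a < b, b <= 1, (3 <= M)%N &
   4 * (L%:R + 1) * M%:R^-1 * (ln M%:R) ^+ 2 <= b - a].

(** The mean of the [beta]-th power of an increment at time [t], as a function of the mesh. *)
Definition weight (M : nat) (t : R) : R := psi (H t) * M%:R `^ (- (beta * H t)).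

Definition weight_mean (a b : R) (M : nat) : R :=
  #|nu L M `[a, b]%classic|%:R^-1 * grid_sum L a b M (weight M).

(** The inverse of the proportion of grid points whose weight is comparable to the
    largest. *)
Definition gain (a b : R) (M : nat) : R := Num.max 1 ((b - a) * (ln M%:R) ^+ 2).

Let b0 : 0 < beta. Proof. by case/andP: beta14. Qed.

Section one_grid.
Variables (a b : R) (M : nat).
Hypothesis adm : admissible a b M.

Let a0 : 0 <= a. Proof. by case: adm. Qed.
Let ab : a < b. Proof. by case: adm. Qed.
Let b1 : b <= 1. Proof. by case: adm. Qed.
Let M3 : (3 <= M)%N. Proof. by case: adm. Qed.
Let M0 : (0 < M)%N. Proof. exact: leq_trans M3. Qed.
Let MR : 0 < M%:R :> R. Proof. by rewrite ltr0n. Qed.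
Let LR : 2 <= L%:R :> R. Proof. by rewrite ler_nat. Qed.
Let lam0 : 0 < b - a. Proof. by rewrite subr_gt0. Qed.
Let lam1 : b - a <= 1. Proof. by move: a0 b1; lra. Qed.
Let Mlam : M%:R * (b - a) <= M%:R. Proof. by rewrite ler_piMr. Qed.

Let ln1 : 1 <= ln M%:R :> R.
Proof.
apply: le_trans ln3_ge1 _; by rewrite ler_ln ?posrE// (ler_nat R 3).
Qed.

Let sep : 4 * (L%:R + 1) * (ln M%:R) ^+ 2 <= M%:R * (b - a).
Proof.
case: adm => _ _ _ _; rewrite mulrAC ler_pdivrMr// => h.
by rewrite [leRHS]mulrC.
Qed.

Let lnsq (c : R) : c <= ln M%:R -> 0 <= c -> c ^+ 2 <= (ln M%:R) ^+ 2.
Proof. by move=> h c0; rewrite ler_sqr ?nnegrE// (le_trans c0). Qed.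

Let bigM (c : R) : c <= ln M%:R -> 0 <= c -> 12 * c ^+ 2 <= M%:R.
Proof.
move=> h c0; have h3 := lnsq h c0; have h2 := sep; have h1 := LR.
 apply: le_trans Mlam; apply: le_trans h2.
have h4 : 12 <= 4 * (L%:R + 1) :> R by lra.
by rewrite ler_pM ?sqr_ge0.
Qed.

Let ln3M (n : nat) : (3 ^+ n : R) <= M%:R -> n%:R <= ln (M%:R : R).
Proof.
move=> h; apply: (@le_trans _ _ (ln (3 ^+ n : R))).
  rewrite lnXn; last lra.
  by rewrite -[ln 3 *+ n]mulr_natl -[leLHS]mulr1 ler_wpM2l// ln3_ge1.
by rewrite ler_ln ?posrE ?exprn_gt0//; lra.
Qed.

Lemma admissible_ln : 3 <= ln (M%:R : R).
Proof.
have h2 : 2 <= ln (M%:R : R).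
  by apply: ln3M; have := bigM ln1 ler01; rewrite !exprS expr0; lra.
by apply: ln3M; have := bigM h2 (ler0n _ _); rewrite !exprS expr0; lra.
Qed.

Lemma admissible_size : 4 * (L%:R + 1) <= M%:R * (b - a) /\ (L <= M)%N.
Proof.
have h : 4 * (L%:R + 1) <= M%:R * (b - a).
  have l1 : 1 <= ln (M%:R : R) ^+ 2 by have := lnsq ln1 ler01; rewrite expr1n.
  by apply: le_trans sep; rewrite -[leLHS]mulr1 ler_wpM2l// mulr_ge0// addr_ge0.
split => //; rewrite -(ler_nat R).
by move: h LR Mlam; lra.
Qed.

Let LM : (L <= M)%N. Proof. by case: admissible_size. Qed.

Lemma admissible_card :
  3 / 4 * (M%:R * (b - a)) <= #|nu L M `[a, b]%classic|%:R <= 2 * (M%:R * (b - a)).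
Proof.
have [h _] := admissible_size; have := LR.
have := card_nu_ge a0 ab b1 (ltnW L2) LM; have := card_nu_le L a0 ab M0.
by move=> h1 h2 h3; apply/andP; split; lra.
Qed.

Lemma admissible_double : admissible a b (2 * M).
Proof.
split => //; first by rewrite (leq_trans M3)// leq_pmull.
have l3 := admissible_ln.
have e : ln ((2 * M)%:R : R) = ln 2 + ln M%:R by rewrite natrM lnM ?posrE.
have l2 : ln ((2 * M)%:R : R) ^+ 2 <= 2 * (ln M%:R) ^+ 2.
  by rewrite e; have := @ln2_le1 R; have := @ln2_ge_half R; move: l3; nra.
case: adm => _ _ _ _ h; apply: le_trans h.
rewrite (_ : 4 * (L%:R + 1) * (2 * M)%:R^-1 * ln (2 * M)%:R ^+ 2 =
    4 * (L%:R + 1) * M%:R^-1 * (2^-1 * ln (2 * M)%:R ^+ 2)); last first.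
  by rewrite natrM; field; rewrite gt_eqF.
by rewrite ler_wpM2l ?ler_pdivrMl// mulr_ge0 ?invr_ge0// mulr_ge0// addr_ge0.
Qed.

Let hmin := min_on H `[a, b]%classic.

Let I01 t : a <= t <= b -> 0 <= t <= 1.
Proof. by move=> /andP[h1 h2]; rewrite (le_trans a0)// (le_trans h2). Qed.

Let has_infH : has_inf (H @` `[a, b]%classic).
Proof.
split; first by exists (H a); exists a => //=; rewrite in_itv/= lexx ltW.
exists 0 => y [t /=]; rewrite in_itv/= => tI <-.
by have /andP[] := H01 (I01 tI).
Qed.

Lemma min_on_le t : a <= t <= b -> hmin <= H t.
Proof.
move=> tI; apply: ge_inf; first by case: has_infH.
by exists t => //=; rewrite in_itv.
Qed.

Lemma min_on_near (e : R) : 0 < e -> exists2 t, a <= t <= b & H t <= hmin + e.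
Proof.
move=> e0; have [y [t /=]] := inf_adherent e0 has_infH.
by rewrite in_itv/= => tI <- h; exists t => //; exact: ltW.
Qed.

Lemma min_on_range : 0 <= hmin <= 1.
Proof.
apply/andP; split.
  apply: lb_le_inf; first by case: has_infH.
  by move=> y [t /=]; rewrite in_itv/= => tI <-; have /andP[] := H01 (I01 tI).
have aI : a <= a <= b by rewrite lexx ltW.
by apply: le_trans (min_on_le aI) _; have /andP[] := H01 (I01 aI).
Qed.

Lemma min_on_oscillation t : a <= t <= b -> H t - hmin <= cH * (b - a) `^ rho.
Proof.
move=> tI; rewrite lerBlDr addrC -lerBlDr.
apply: lb_le_inf; first by case: has_infH.
move=> y [s /=]; rewrite in_itv/= => sI <-; rewrite lerBlDr addrC -lerBlDr.
apply: le_trans (ler_norm _) _; apply: le_trans (Hholder (I01 tI) (I01 sI)) _.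
rewrite ler_wpM2l// ge0_ler_powR ?nnegrE ?(ltW lam0)//; last first.
  by rewrite ler_norml; move: tI sI => /andP[t1 t2] /andP[s1 s2]; apply/andP; split; lra.
by case/andP: rho1 => h _; apply: le_trans h.
Qed.

Lemma weight_gt0 t : a <= t <= b -> 0 < weight M t.
Proof.
move=> /I01/psiP/andP[h _]; rewrite /weight mulr_gt0 ?powR_gt0//.
exact: lt_le_trans h.
Qed.

Lemma weight_le t : a <= t <= b -> weight M t <= phi * M%:R `^ (- (beta * hmin)).
Proof.
move=> tI; have /andP[h1 h2] := psiP (I01 tI); rewrite /weight.
apply: ler_pM; rewrite ?powR_ge0//; first by rewrite (le_trans (ltW plo0)).
by rewrite ler_powR ?ler1n// lerN2 ler_wpM2l ?(ltW b0)// min_on_le.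
Qed.

Lemma weight_mean_ge_sup (hsup : R) : (forall t, 0 <= t <= 1 -> H t <= hsup) ->
  plo * M%:R `^ (- (beta * hsup)) <= weight_mean a b M.
Proof.
move=> Hs; have /andP[c1 _] := admissible_card.
have c0 : (0 < #|nu L M `[a, b]%classic|)%N.
  by rewrite -(ltr_nat R); apply: lt_le_trans c1; rewrite !mulr_gt0.
apply: average_ge => // k; rewrite in_nu => kI.
have /andP[h1 h2] := psiP (I01 kI); rewrite /weight.
apply: ler_pM; rewrite ?powR_ge0 ?(ltW plo0)//.
by rewrite ler_powR ?ler1n// lerN2 ler_wpM2l ?(ltW b0)// Hs// I01.
Qed.

Definition gain_const : R := 3 / 8 * plo * expR (- (beta * (1 + cH))).

Lemma gain_const_gt0 : 0 < gain_const.
Proof. by rewrite /gain_const !mulr_gt0 ?expR_gt0. Qed.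

Lemma gain_ge1 : 1 <= gain a b M.
Proof. by rewrite /gain le_max lexx. Qed.

(** Within [(ln M)^-2] of a near minimum, the Hoelder condition with [rho >= 1/2] keeps [H]
    within a multiple of [1 / ln M] of [h], hence the weights within a constant factor of the
    largest. These points make up a fraction [1 / gain] of the grid. *)
Lemma weight_mean_ge :
  gain_const * M%:R `^ (- (beta * hmin)) / gain a b M <= weight_mean a b M.
Proof.
have l3 := admissible_ln; have lp : 0 < ln (M%:R : R) by move: l3; lra.
set lM := ln M%:R in l3 lp *.
set dl := lM ^- 2; have dl0 : 0 < dl by rewrite invr_gt0 exprn_gt0.
have [t0 tI tm] : exists2 t, a <= t <= b & H t <= hmin + lM^-1.
  by apply: min_on_near; rewrite invr_gt0.
pose a' := Num.max a (t0 - dl); pose b' := Num.min b (t0 + dl).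
have /andP[ta tb] := tI.
have w : Num.min (b - a) dl <= b' - a'.
  rewrite /a' /b'; case: (leP a (t0 - dl)) => h1; case: (leP b (t0 + dl)) => h2;
    rewrite ge_min; apply/orP; by [left; lra|right; lra].
have sepd : 4 * (L%:R + 1) <= M%:R * dl.
  rewrite /dl ler_pdivlMr ?exprn_gt0//; apply: le_trans sep _.
  exact: Mlam.
have [sepl _] := admissible_size.
have sepm : 4 * (L%:R + 1) <= M%:R * Num.min (b - a) dl by case: (leP (b - a) dl).
have m0 : 0 < Num.min (b - a) dl by rewrite lt_min lam0.
have ab' : a' <= b' by have := le_trans (ltW m0) w; rewrite subr_ge0.
have aa : a <= a' by rewrite /a' le_max lexx.
have bb : b' <= b by rewrite /b' ge_min lexx.
have cnt := card_nu_sub_ge a0 b1 (ltnW L2) LM aa ab' bb.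
set S := [set k in nu L M _ | _]%SET in cnt.
have cnt2 : 3 / 4 * (M%:R * Num.min (b - a) dl) <= #|S|%:R.
  apply: le_trans cnt; have : M%:R * Num.min (b - a) dl <= M%:R * (b' - a') by rewrite ler_pM2l.
  by move: sepm; lra.
have /andP[nl nu_le] := admissible_card.
have n0 : 0 < #|nu L M `[a, b]%classic|%:R :> R by apply: lt_le_trans nl; rewrite !mulr_gt0.
pose low := plo * (M%:R `^ (- (beta * hmin)) * expR (- (beta * (1 + cH)))).
have low0 : 0 <= low by rewrite /low !mulr_ge0 ?powR_ge0 ?expR_ge0// ltW.
have Slow k : k \in S -> low <= weight M (k%:R / M%:R).
  rewrite inE in_nu => /andP[kI /andP[k1 k2]].
  have /andP[h1 _] := psiP (I01 kI); rewrite /low /weight.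
  apply: ler_pM => //; rewrite ?mulr_ge0 ?powR_ge0 ?expR_ge0// ?(ltW plo0)//.
  have dt : `|k%:R / M%:R - t0| <= dl.
    rewrite ler_norml; apply/andP; split.
      have : t0 - dl <= k%:R / M%:R by apply: le_trans k1; rewrite /a' le_max lexx orbT.
      lra.
    have : k%:R / M%:R <= t0 + dl by apply: le_trans k2 _; rewrite /b' ge_min lexx orbT.
    lra.
  have /andP[r0 r1] := rho1.
  have dr : dl `^ rho <= lM^-1.
    rewrite /dl -exprVn -powR_mulrn ?invr_ge0 ?(ltW lp)// -powRrM.
    apply: (@le_trans _ _ (lM^-1 `^ 1)); last by rewrite powRr1// invr_ge0 ltW.
    by apply: ger_powR; [rewrite invr_gt0 lp invf_le1//; move: l3; lra|lra].
  have Hk : H (k%:R / M%:R) <= hmin + (1 + cH) / lM.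
    have h2 : `|H (k%:R / M%:R) - H t0| <= cH * lM^-1.
      apply: le_trans (Hholder (I01 kI) (I01 tI)) _; rewrite ler_wpM2l//.
      apply: le_trans dr; rewrite ge0_ler_powR ?nnegrE ?(ltW dl0)//; lra.
    have := le_trans (ler_norm _) h2; rewrite mulrDl mul1r; move: tm; lra.
  rewrite /powR (gt_eqF MR) -expRD ler_expR -/lM.
  have : beta * H (k%:R / M%:R) * lM <= beta * (hmin + (1 + cH) / lM) * lM.
    by rewrite ler_wpM2r ?(ltW lp)// ler_wpM2l// ltW.
  have -> : beta * (hmin + (1 + cH) / lM) * lM = beta * hmin * lM + beta * (1 + cH).
    by field; rewrite gt_eqF.
  lra.
rewrite /weight_mean /grid_sum ler_pdivlMl//.
apply: (@le_trans _ _ (\sum_(k in S) weight M (k%:R / M%:R))); last first.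
  rewrite [leLHS]big_mkcond [leRHS]big_mkcond; apply: ler_sum => k _.
  rewrite [k \in S]inE; case: ifPn => [/andP[->]//|_].
  by case: ifPn => // ; rewrite in_nu => /weight_gt0/ltW.
apply: (@le_trans _ _ (\sum_(k in S) low)); last exact: ler_sum.
rewrite sumr_const -[low *+ _]mulr_natl.
apply: (@le_trans _ _ (3 / 4 * (M%:R * Num.min (b - a) dl) * low)); last by rewrite ler_wpM2r.
have lM2 : 0 < lM ^+ 2 by rewrite exprn_gt0.
have gE : Num.min (b - a) dl = (b - a) / gain a b M.
  rewrite /gain -/lM; have [h|h] := leP 1 ((b - a) * lM ^+ 2).
    rewrite min_r; first by rewrite /dl; field; rewrite !gt_eqF.
    by rewrite /dl -ler_pdivrMr// ?div1r in h.
  rewrite divr1 min_l// /dl -[_^-1]div1r ler_pdivlMr//; exact: ltW.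
have g0 : 0 < gain a b M by apply: lt_le_trans gain_ge1.
apply: (@le_trans _ _ (2 * (M%:R * (b - a)) * (gain_const * M%:R `^ (- (beta * hmin)) / gain a b M))).
  rewrite ler_wpM2r// mulr_ge0 ?invr_ge0 ?(ltW g0)// mulr_ge0 ?powR_ge0// ltW//.
  exact: gain_const_gt0.
rewrite gE /gain_const /low le_eqVlt; apply/orP; left; apply/eqP.
by field; rewrite gt_eqF.
Qed.

End one_grid.

Let rho0 : 0 < rho. Proof. by case/andP: rho1 => h _; apply: lt_le_trans h; rewrite invr_gt0. Qed.
Let phi0 : 0 < phi.
Proof.
have /psiP/andP[h1 h2] : 0 <= (0 : R) <= 1 by rewrite lexx ler01.
exact: lt_le_trans plo0 (le_trans h1 h2).
Qed.

Definition weight_modulus : R :=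
  let Cp := pl * cH `^ beta / plo in
  let Cu := beta * cH * (8 / 3) in
  let Cq := Cu * (expR Cu + 1) in
  Cp * (1 + Cq) + Cq.

Lemma weight_modulus_ge0 : 0 <= weight_modulus.
Proof.
have Cu0 : 0 <= beta * cH * (8 / 3) by rewrite !mulr_ge0// ltW.
have Cp0 : 0 <= pl * cH `^ beta / plo by rewrite !mulr_ge0 ?powR_ge0 ?invr_ge0// ltW.
have Cq0 : 0 <= beta * cH * (8 / 3) * (expR (beta * cH * (8 / 3)) + 1).
  by rewrite mulr_ge0// addr_ge0// expR_ge0.
by rewrite /weight_modulus addr_ge0// mulr_ge0// addr_ge0.
Qed.

(** The factor [N^(- beta * H t)] varies like [N^(- rho) * ln N]; the logarithm is absorbed by
    weakening the exponent to [beta * rho]. *)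
Lemma weight_relative_modulus (N : nat) (t t' : R) : (3 <= N)%N ->
  0 <= t <= 1 -> 0 <= t' <= 1 -> `|t - t'| <= N%:R^-1 ->
  `|weight N t' - weight N t| <= weight_modulus * N%:R `^ (- (beta * rho)) * weight N t.
Proof.
move=> N3 tI t'I tt'; have NR : 0 < N%:R :> R by rewrite ltr0n (leq_trans _ N3).
have N1 : 1 <= N%:R :> R by rewrite ler1n (leq_trans _ N3).
have lnN : 0 <= ln (N%:R : R) by exact: ln_ge0.
have /andP[r0 r1] := rho1; have /andP[_ b14] := beta14.
have dH : `|H t' - H t| <= cH * N%:R `^ (- rho).
  rewrite distrC; apply: le_trans (Hholder tI t'I) _; rewrite ler_wpM2l//.
  rewrite powRN -[X in X^-1]/(_) -powR_inv1 ?powR_ge0// -powRrM mulrC powRrM powR_inv1 ?(ltW NR)//.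
  by rewrite ge0_ler_powR ?nnegrE ?invr_ge0 ?(ltW NR)// ltW.
set Nb := N%:R `^ (- (beta * rho)).
have Nb0 : 0 <= Nb by exact: powR_ge0.
have Nb1 : Nb <= 1 by rewrite -(powRr0 N%:R) ler_powR// oppr_le0 mulr_ge0// ltW.
have /andP[pt pt2] := psiP tI.
have pt0 : 0 < psi (H t) by exact: lt_le_trans pt.
pose Cp := pl * cH `^ beta / plo; pose Cu := beta * cH * (8 / 3).
have Cu0 : 0 <= Cu by rewrite !mulr_ge0// ltW.
have Cp0 : 0 <= Cp by rewrite !mulr_ge0 ?powR_ge0 ?invr_ge0// ltW.
pose Cq := Cu * (expR Cu + 1).
have Cq0 : 0 <= Cq by rewrite mulr_ge0// addr_ge0// expR_ge0.
have P1 : `|psi (H t') - psi (H t)| <= Cp * Nb * psi (H t).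
  apply: le_trans (psiL t'I tI) _.
  apply: (@le_trans _ _ (pl * (cH `^ beta * Nb))).
    rewrite ler_wpM2l// /Nb mulrC -mulrN [_ * - rho]mulrC powRrM mulrC -powRM ?powR_ge0//.
    by rewrite ge0_ler_powR ?nnegrE ?mulr_ge0 ?powR_ge0// ltW.
  rewrite -[leLHS]mulr1 /Cp.
  rewrite [leRHS](_ : _ = pl * (cH `^ beta * Nb) * (psi (H t) / plo)); last first.
    by field; rewrite gt_eqF.
  by rewrite ler_wpM2l ?mulr_ge0 ?powR_ge0// ler_pdivlMr// mul1r.
pose u := - (beta * (H t' - H t)) * ln N%:R.
have pw : N%:R `^ (- (beta * H t')) = N%:R `^ (- (beta * H t)) * expR u.
  by rewrite /powR (gt_eqF NR) -expRD /u; congr expR; ring.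
have uN : `|u| <= Cu * Nb.
  rewrite /u normrM normrN normrM (ger0_norm (ltW b0)) (ger0_norm lnN).
  have lnb : ln (N%:R : R) <= 8 / 3 * N%:R `^ (rho * (1 - beta)).
    have e0 : 3 / 8 <= rho * (1 - beta) by move: r0 b14; nra.
    apply: le_trans (ln_le_powR NR (_ : 0 < rho * (1 - beta))) _; first lra.
    rewrite ler_wpM2r ?powR_ge0// -[8 / 3]invrK lef_pV2 ?posrE; lra.
  apply: (@le_trans _ _ (beta * (cH * N%:R `^ (- rho)) * (8 / 3 * N%:R `^ (rho * (1 - beta))))).
    by apply: ler_pM => //; rewrite ?mulr_ge0 ?(ltW b0)// ler_wpM2l ?(ltW b0).
  have -> : Nb = N%:R `^ (- rho) * N%:R `^ (rho * (1 - beta)).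
    by rewrite -powRD ?(gt_eqF NR) ?implybT// /Nb; congr (_ `^ _); ring.
  by rewrite /Cu le_eqVlt; apply/orP; left; apply/eqP; ring.
have Q1 : `|expR u - 1| <= Cq * Nb.
  rewrite -expR0; apply: le_trans (expR_diff_le _ _) _; rewrite subr0 expR0.
  rewrite /Cq mulrAC; apply: ler_pM; rewrite ?addr_ge0 ?expR_ge0// lerD2r ler_expR.
  apply: le_trans (ler_norm _) _; apply: le_trans uN _.
  by rewrite -[leRHS]mulr1 ler_wpM2l.
rewrite /weight pw; set q := N%:R `^ _.
have q0 : 0 <= q by exact: powR_ge0.
have -> : psi (H t') * (q * expR u) - psi (H t) * q =
   q * ((psi (H t') - psi (H t)) * (1 + (expR u - 1)) + psi (H t) * (expR u - 1)) by ring.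
rewrite normrM (ger0_norm q0) [psi (H t) * q]mulrC mulrCA ler_wpM2l//.
apply: le_trans (ler_normD _ _) _; rewrite !normrM (ger0_norm (ltW pt0)).
have e1 : `|1 + (expR u - 1)| <= 1 + Cq.
  apply: le_trans (ler_normD _ _) _; rewrite normr1 lerD2l.
  by apply: le_trans Q1 _; rewrite -[leRHS]mulr1 ler_wpM2l.
rewrite (_ : weight_modulus * Nb * psi (H t) =
   Cp * Nb * psi (H t) * (1 + Cq) + psi (H t) * (Cq * Nb)); last first.
  by rewrite /weight_modulus -/Cp -/Cu -/Cq; ring.
by apply: lerD; [exact: ler_pM|rewrite ler_wpM2l// ltW].
Qed.

Section two_grids.
Variables (a b : R) (N : nat).
Hypothesis adm : admissible a b N.

Let adm2 := admissible_double adm.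
Let a0 : 0 <= a. Proof. by case: adm. Qed.
Let ab : a < b. Proof. by case: adm. Qed.
Let b1 : b <= 1. Proof. by case: adm. Qed.
Let lam0 : 0 < b - a. Proof. by rewrite subr_gt0. Qed.
Let N3 : (3 <= N)%N. Proof. by case: adm. Qed.
Let NR : 0 < N%:R :> R. Proof. by rewrite ltr0n (leq_trans _ N3). Qed.
Let N1 : 1 <= N%:R :> R. Proof. by rewrite ler1n (leq_trans _ N3). Qed.
Let lnN3 := admissible_ln adm.
Let LN := (admissible_size adm).2.
Let h := min_on H `[a, b]%classic.
Let n1 : R := #|nu L N `[a, b]%classic|%:R.
Let n2 : R := #|nu L (2 * N) `[a, b]%classic|%:R.
Let s1 := grid_sum L a b N (weight N).
Let s2 := grid_sum L a b (2 * N) (weight N).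
Let s2' := grid_sum L a b (2 * N) (weight (2 * N)).
Let eps := ln (ln (N%:R : R)) / ln N%:R.

Let I01 t : a <= t <= b -> 0 <= t <= 1.
Proof. by move=> /andP[h1 h2]; rewrite (le_trans a0)// (le_trans h2). Qed.

Let n1_ge : 3 / 4 * (N%:R * (b - a)) <= n1.
Proof. by case/andP: (admissible_card adm). Qed.
Let n1_gt0 : 0 < n1. Proof. by apply: lt_le_trans n1_ge; rewrite !mulr_gt0. Qed.
Let n2_gt0 : 0 < n2.
Proof.
case/andP: (admissible_card adm2) => c _; apply: lt_le_trans c.
by rewrite !mulr_gt0// ltr0n muln_gt0 (leq_trans _ N3).
Qed.

Let sum_gt0 (M K : nat) : (0 < #|nu L M `[a, b]%classic|)%N -> admissible a b K ->
  0 < grid_sum L a b M (weight K).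
Proof.
move=> /card_gt0P[k kI] admK; rewrite /grid_sum (bigD1 k)//=; apply: ltr_wpDr.
  by apply: sumr_ge0 => j /andP[]; rewrite in_nu => /(weight_gt0 admK)/ltW.
by move: kI; rewrite in_nu => /(weight_gt0 admK).
Qed.

Let s1_gt0 : 0 < s1. Proof. by apply: sum_gt0 => //; rewrite -(ltr_nat R). Qed.
Let s2_gt0 : 0 < s2. Proof. by apply: sum_gt0 => //; rewrite -(ltr_nat R). Qed.
Let s2'_gt0 : 0 < s2'. Proof. by apply: sum_gt0 => //; rewrite -(ltr_nat R). Qed.

Let g0 : 0 < gain a b N. Proof. by apply: lt_le_trans (gain_ge1 a b N). Qed.
Let lamN0 : 0 < N%:R * (b - a). Proof. by rewrite mulr_gt0. Qed.

Definition mesh_const : R := 4 / 3 * (L%:R + 2) * (phi / gain_const + 1).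

(** The relative error of [2 * grid_sum L a b N F] as an approximation of
    [grid_sum L a b (2 * N) F]: the modulus of continuity of the weights over half a mesh,
    and the share of the unmatched points near the ends. *)
Definition mesh_error : R := weight_modulus * N%:R `^ (- (beta * rho)) +
  mesh_const * (gain a b N / (N%:R * (b - a))).

Let halving (t t' : R) : `|t - t'| <= (2 * N%:R)^-1 -> `|t - t'| <= (N%:R : R)^-1.
Proof.
by move=> hh; apply: le_trans hh _; rewrite lef_pV2 ?posrE ?mulr_gt0//; move: NR; lra.
Qed.

Let sum_ratio : `|s2 / (2 * s1) - 1| <= mesh_error.
Proof.
set e := weight_modulus * N%:R `^ (- (beta * rho)).
have e0 : 0 <= e by rewrite mulr_ge0 ?weight_modulus_ge0 ?powR_ge0.
have gc0 := gain_const_gt0.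
have key := @grid_sum_double R L a b ab (ltnW L2) N (weight N) e
  (phi * N%:R `^ (- (beta * h))) LN e0 _ _.
have {key} : `|s2 - 2 * s1| <= e * s1 + 2 * (phi * N%:R `^ (- (beta * h))) * (L%:R + 2).
  apply: key.
  - by move=> t tI; rewrite (ltW (weight_gt0 adm tI))/= weight_le.
  - move=> t t' tI t'I /halving tt'.
    by apply: weight_relative_modulus => //; exact: I01.
have lowR : gain_const * N%:R `^ (- (beta * h)) / gain a b N <= n1^-1 * s1.
  exact: (weight_mean_ge adm).
have Fm : N%:R `^ (- (beta * h)) <= gain a b N / gain_const * (4 / 3 / (N%:R * (b - a))) * s1.
  move: lowR; rewrite ler_pdivrMr// -ler_pdivlMl// => /le_trans; apply.
  rewrite [leLHS](_ : _ = gain a b N / gain_const * s1 * n1^-1); last by ring.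
  rewrite [leRHS](_ : _ = gain a b N / gain_const * s1 * (4 / 3 / (N%:R * (b - a)))); last by ring.
  rewrite ler_wpM2l ?mulr_ge0 ?invr_ge0 ?(ltW g0) ?(ltW gc0) ?(ltW s1_gt0)//.
  rewrite -[4 / 3 / _]invrK lef_pV2 ?posrE ?invr_gt0 ?divr_gt0//.
  by rewrite invfM invrK invf_div.
move=> key; have -> : s2 / (2 * s1) - 1 = (s2 - 2 * s1) / (2 * s1).
  by field; rewrite gt_eqF.
rewrite normrM (ger0_norm (_ : 0 <= (2 * s1)^-1)) ?invr_ge0 ?mulr_ge0 ?(ltW s1_gt0)//.
rewrite ler_pdivrMr ?mulr_gt0//; apply: le_trans key _.
have c1 : 0 <= phi * (L%:R + 2) * 2 by rewrite !mulr_ge0 ?addr_ge0 ?(ltW phi0).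
have := ler_wpM2l c1 Fm.
have es0 : 0 <= e * s1 by rewrite mulr_ge0// ltW.
have t0 : 0 <= 4 / 3 * (L%:R + 2) * (gain a b N / (N%:R * (b - a))) * (2 * s1).
  by rewrite !mulr_ge0 ?addr_ge0 ?invr_ge0 ?(ltW g0) ?(ltW lamN0) ?(ltW s1_gt0) ?(ltW NR) ?(ltW lam0).
rewrite /mesh_error -/e /mesh_const.
have -> : (e + 4 / 3 * (L%:R + 2) * (phi / gain_const + 1) * (gain a b N / (N%:R * (b - a)))) * (2 * s1)
  = e * s1 + e * s1 + phi * (L%:R + 2) * 2 * (gain a b N / gain_const * (4 / 3 / (N%:R * (b - a))) * s1)
   + 4 / 3 * (L%:R + 2) * (gain a b N / (N%:R * (b - a))) * (2 * s1).
  by field; rewrite !gt_eqF.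
have -> : 2 * (phi * N%:R `^ (- (beta * h))) * (L%:R + 2) =
  phi * (L%:R + 2) * 2 * N%:R `^ (- (beta * h)) by ring.
lra.
Qed.

Let card_ratio : `|n2 / (2 * n1) - 1| <= mesh_error.
Proof.
have gc0 := gain_const_gt0.
have cardE (M : nat) : #|nu L M `[a, b]%classic|%:R = grid_sum L a b M (fun=> 1) :> R.
  by rewrite /grid_sum sumr_const.
have key : `|n2 - 2 * n1| <= 0 * n1 + 2 * 1 * (L%:R + 2).
  rewrite /n2 /n1 !cardE; apply: grid_sum_double => //; first exact: ltnW.
    by move=> t _; rewrite ler01 lexx.
  by move=> t t' _ _ _; rewrite subrr normr0 mul0r.
have -> : n2 / (2 * n1) - 1 = (n2 - 2 * n1) / (2 * n1) by field; rewrite gt_eqF.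
rewrite normrM (ger0_norm (_ : 0 <= (2 * n1)^-1)) ?invr_ge0 ?mulr_ge0 ?(ltW n1_gt0)//.
rewrite ler_pdivrMr ?mulr_gt0//; apply: le_trans key _; rewrite mul0r add0r mulr1.
apply: (@le_trans _ _ (4 / 3 * (L%:R + 2) * (1 / (N%:R * (b - a))) * (2 * n1))).
  rewrite [leRHS](_ : _ = 2 * (L%:R + 2) * (4 / 3 * n1 / (N%:R * (b - a)))); last by ring.
  rewrite -[leLHS]mulr1 ler_wpM2l ?mulr_ge0 ?addr_ge0// ler_pdivlMr// mul1r.
  by move: n1_ge; lra.
rewrite ler_wpM2r ?mulr_ge0 ?(ltW n1_gt0)// /mesh_error.
rewrite -[leLHS]add0r lerD ?mulr_ge0 ?weight_modulus_ge0 ?powR_ge0//.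
apply: ler_pM; rewrite ?mulr_ge0 ?addr_ge0 ?invr_ge0 ?(ltW lamN0)//.
  rewrite /mesh_const ler_peMr ?mulr_ge0 ?addr_ge0// lerDr.
  by rewrite mulr_ge0 ?invr_ge0 ?(ltW phi0) ?(ltW gc0).
by rewrite ler_wpM2r ?invr_ge0 ?(ltW lamN0)// gain_ge1.
Qed.

(** The relative loss, when the mesh is halved, of the weight at [t] compared with a weight at
    the minimum of [H]. *)
Let defect (t : R) : R := 1 - 2 `^ (- (beta * (H t - h))).
Let defect_sum := grid_sum L a b (2 * N) (fun t => defect t * weight N t).

Let weight_doubled t : weight (2 * N) t = 2 `^ (- (beta * H t)) * weight N t.
Proof. by rewrite /weight natrM powRM ?(ltW NR)//; ring. Qed.

Let defect_bounds t : a <= t <= b -> 0 <= defect t <= beta * (H t - h) /\ defect t <= 1.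
Proof.
move=> tI; have Hh : 0 <= H t - h by rewrite subr_ge0 (min_on_le adm).
have bH : 0 <= beta * (H t - h) by rewrite mulr_ge0// ltW.
have l2 : 0 <= ln (2 : R) by rewrite ln_ge0// ler1n.
rewrite /defect; split; last by rewrite lerBlDr lerDl powR_ge0.
rewrite /powR (gt_eqF (_ : 0 < 2))// mulNr subr_ge0 expR_le1 oppr_le0 mulr_ge0//=.
apply: le_trans (one_minus_expN_le _) _.
by rewrite ler_piMr// ln2_le1.
Qed.

Let doubled_sumE : s2' = 2 `^ (- (beta * h)) * (s2 - defect_sum).
Proof.
rewrite /s2' /s2 /defect_sum /grid_sum -sumrB mulr_sumr; apply: eq_bigr => k _.
rewrite weight_doubled /defect.
have -> : 2 `^ (- (beta * H (k%:R / (2 * N)%:R))) =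
    2 `^ (- (beta * h)) * 2 `^ (- (beta * (H (k%:R / (2 * N)%:R) - h))) :> R.
  by rewrite -powRD ?(gt_eqF (_ : 0 < (2 : R))) ?implybT//; congr (_ `^ _); ring.
by ring.
Qed.

Let doubled_sum_ge : s2 / 2 <= s2'.
Proof.
rewrite /s2 /s2' /grid_sum mulr_suml; apply: ler_sum => k; rewrite in_nu => kI.
rewrite weight_doubled mulrC ler_wpM2r//; first by rewrite ltW// (weight_gt0 adm).
have /andP[h0 h1] := H01 (I01 kI); have /andP[_ b4] := beta14.
rewrite -[leLHS]powR_inv1// ler_powR ?ler1n// lerN2.
by rewrite -[leRHS]mulr1 ler_pM ?(ltW b0)//; move: b4; lra.
Qed.

Let defect_sum_oscillation : defect_sum <= cH * (b - a) `^ rho * s2.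
Proof.
rewrite /defect_sum /s2 /grid_sum mulr_sumr; apply: ler_sum => k; rewrite in_nu => kI.
rewrite ler_wpM2r//; first by rewrite ltW// (weight_gt0 adm).
have [/andP[_ d] _] := defect_bounds kI; apply: le_trans d _.
apply: le_trans (min_on_oscillation adm kI).
have Hh : 0 <= H (k%:R / (2 * N)%:R) - h by rewrite subr_ge0 (min_on_le adm).
by rewrite ler_piMl//; move: beta14; lra.
Qed.

Let eps_gt0 : 0 < eps.
Proof.
rewrite divr_gt0//; last by move: lnN3; lra.
by apply: ln_gt0; move: lnN3; lra.
Qed.

Let eps_ge : (ln (N%:R : R))^-1 <= 2 * eps.
Proof.
have l0 : 0 < ln (N%:R : R) by move: lnN3; lra.
rewrite /eps mulrA -[leLHS]mul1r ler_wpM2r ?invr_ge0 ?(ltW l0)//.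
have : ln (2 : R) <= ln (ln N%:R) by rewrite ler_ln ?posrE//; move: lnN3; lra.
by have := @ln2_ge_half R; lra.
Qed.

(** Points where [H] exceeds its minimum by more than a multiple of
    [ln (ln N) / ln N] carry a share of the weight that is negligible. *)
Let defect_sum_concentration : defect_sum <= (3 + 16 * phi / gain_const) * eps * s2.
Proof.
have gc0 := gain_const_gt0; set lN := ln (N%:R : R).
have l0 : 0 < lN by move: lnN3; rewrite -/lN; lra.
have pt t : a <= t <= b -> defect t * weight N t <=
    3 * eps * weight N t + phi * N%:R `^ (- (beta * h)) * lN ^- 3.
  move=> tI; have [/andP[d0 d1] d2] := defect_bounds tI.
  have w0 := ltW (weight_gt0 adm tI).
  have Nh0 : 0 <= phi * N%:R `^ (- (beta * h)) by rewrite mulr_ge0 ?powR_ge0// ltW.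
  have [le|gt] := leP (beta * (H t - h)) (3 * eps).
    rewrite -[leLHS]addr0 lerD//; last by rewrite mulr_ge0 ?invr_ge0 ?exprn_ge0 ?(ltW l0).
    by rewrite ler_wpM2r// (le_trans d1).
  apply: (@le_trans _ _ (weight N t)); first by rewrite ler_piMl.
  have e0 : 0 <= 3 * eps * weight N t.
    by apply: mulr_ge0 => //; apply: mulr_ge0 => //; exact: ltW.
  rewrite -[leLHS]add0r lerD//.
  have /andP[p1 p2] := psiP (I01 tI).
  rewrite /weight -mulrA; apply: ler_pM; rewrite ?powR_ge0//.
    by rewrite (le_trans (ltW plo0)).
  have -> : lN ^- 3 = N%:R `^ (- (3 * eps)).
    rewrite -powR_invn ?(ltW l0)// /powR (gt_eqF l0) (gt_eqF NR); congr expR.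
    by rewrite /eps -/lN; field; rewrite gt_eqF.
  rewrite -powRD ?(gt_eqF NR) ?implybT// ler_powR//; move: gt; lra.
have sumle : defect_sum <= 3 * eps * s2 + n2 * (phi * N%:R `^ (- (beta * h)) * lN ^- 3).
  rewrite /defect_sum /s2 /grid_sum mulr_sumr.
  rewrite (_ : n2 * _ = \sum_(k in nu L (2 * N) `[a, b]%classic)
     phi * N%:R `^ (- (beta * h)) * lN ^- 3); last by rewrite sumr_const -[RHS]mulr_natl.
  rewrite -big_split; apply: ler_sum => k; rewrite in_nu => kI; exact: pt.
apply: le_trans sumle _.
rewrite [leRHS](_ : _ = 3 * eps * s2 + 16 * phi / gain_const * eps * s2); last by ring.
rewrite lerD2l.
have l2N : ln ((2 * N)%:R : R) <= 2 * lN.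
  rewrite natrM lnM ?posrE//; have := @ln2_le1 R; move: lnN3; rewrite -/lN; lra.
have l2N0 : 0 <= ln ((2 * N)%:R : R).
  by apply: ln_ge0; rewrite ler1n muln_gt0 (leq_trans _ N3).
have g2 : gain a b (2 * N) <= 4 * lN ^+ 2.
  rewrite /gain ge_max; apply/andP; split; first by move: lnN3; rewrite -/lN; nra.
  have : ln ((2 * N)%:R : R) ^+ 2 <= 4 * lN ^+ 2.
    by rewrite (_ : 4 * lN ^+ 2 = (2 * lN) ^+ 2); [rewrite ler_sqr ?nnegrE//; lra|ring].
  have : b - a <= 1 by move: a0 b1; lra.
  by have := sqr_ge0 (ln ((2 * N)%:R : R)); move: lam0; nra.
have low : gain_const * (2 * N)%:R `^ (- (beta * h)) / gain a b (2 * N) <= n2^-1 * s2.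
  apply: le_trans (weight_mean_ge adm2) _.
  rewrite /weight_mean ler_wpM2l ?invr_ge0 ?(ltW n2_gt0)//.
  apply: ler_sum => k; rewrite in_nu => kI; rewrite weight_doubled ler_piMl//.
    by rewrite ltW// (weight_gt0 adm).
  have /andP[h0 _] := H01 (I01 kI).
  by rewrite -[leRHS](powRr0 2) ler_powR ?ler1n// oppr_le0 mulr_ge0// ltW.
have half : N%:R `^ (- (beta * h)) <= 2 * (2 * N)%:R `^ (- (beta * h)).
  rewrite natrM powRM ?(ltW NR)// mulrA ler_peMl ?powR_ge0//.
  have /andP[h0 h1] := min_on_range adm.
  have : 2^-1 <= 2 `^ (- (beta * h)) :> R.
    rewrite -[leLHS]powR_inv1// ler_powR ?ler1n// lerN2.
    by rewrite -[leRHS]mulr1 ler_pM ?(ltW b0)//; move: beta14; lra.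
  lra.
have g20 : 0 < gain a b (2 * N) by apply: lt_le_trans (gain_ge1 _ _ _).
have n2N : n2 * N%:R `^ (- (beta * h)) <= 8 * lN ^+ 2 / gain_const * s2.
  rewrite -ler_pdivlMl//; apply: le_trans half _.
  move: low; rewrite ler_pdivrMr// -ler_pdivlMl// => low.
  apply: (@le_trans _ _ (2 * (gain_const^-1 * (n2^-1 * s2 * (4 * lN ^+ 2))))).
    rewrite ler_wpM2l//; apply: le_trans low _; rewrite ler_wpM2l ?invr_ge0 ?(ltW gc0)//.
    by rewrite ler_wpM2l// mulr_ge0 ?invr_ge0 ?(ltW n2_gt0) ?(ltW s2_gt0).
  by rewrite le_eqVlt; apply/orP; left; apply/eqP; ring.
rewrite (_ : n2 * _ = phi * lN ^- 3 * (n2 * N%:R `^ (- (beta * h)))); last by ring.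
apply: (@le_trans _ _ (phi * lN ^- 3 * (8 * lN ^+ 2 / gain_const * s2))).
  by rewrite ler_wpM2l// mulr_ge0 ?invr_ge0 ?exprn_ge0 ?(ltW l0) ?(ltW phi0).
rewrite (_ : phi * lN ^- 3 * (8 * lN ^+ 2 / gain_const * s2) =
   8 * phi / gain_const * lN^-1 * s2); last by field; rewrite !gt_eqF.
rewrite ler_wpM2r ?(ltW s2_gt0)//.
rewrite (_ : 16 * phi / gain_const * eps = 8 * phi / gain_const * (2 * eps)); last by ring.
by rewrite ler_wpM2l ?eps_ge// !mulr_ge0 ?invr_ge0 ?(ltW phi0) ?(ltW gc0).
Qed.

Definition bias_const : R := 2 * (cH + (3 + 16 * phi / gain_const)).

(** The logarithm splits into the defect, the ratio of the sums of the same weights over the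
    two grids and the ratio of the cardinals; [mesh_error] bounds the relative
    deviation of each of these ratios from 2. *)
Lemma log_ratio_bias : mesh_error <= 2^-1 ->
  `|ln (weight_mean a b N / weight_mean a b (2 * N)) - beta * h * ln 2| <=
  4 * mesh_error + bias_const * Num.min ((b - a) `^ rho) (ln (ln (N%:R : R)) / ln N%:R).
Proof.
move=> me2; have gc0 := gain_const_gt0.
have p2 : 0 < 2 `^ (- (beta * h)) :> R by exact: powR_gt0.
have E : ln (weight_mean a b N / weight_mean a b (2 * N)) - beta * h * ln 2 =
    (ln (2 `^ (- (beta * h)) * s2) - ln s2') - ln (s2 / (2 * s1)) + ln (n2 / (2 * n1)).
  rewrite /weight_mean -/s1 -/n1 -/s2' -/n2 ln_div ?posrE ?mulr_gt0 ?invr_gt0//.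
  rewrite !(ln_div, lnM) ?posrE ?mulr_gt0 ?invr_gt0// ln_powR !lnV ?posrE//; ring.
rewrite E; apply: le_trans (ler_normD _ _) _.
have c2 := ln_near_one card_ratio me2.
apply: (@le_trans _ _ (bias_const * Num.min ((b - a) `^ rho) eps + 2 * mesh_error + 2 * mesh_error)); last by rewrite -/eps; lra.
rewrite lerD//; apply: le_trans (ler_normB _ _) _; rewrite lerD//; last exact: ln_near_one.
have defect_ge0 : 0 <= defect_sum.
  apply: sumr_ge0 => k; rewrite in_nu => kI.
  by have [/andP[d0 _] _] := defect_bounds kI; rewrite mulr_ge0// ltW// (weight_gt0 adm).
have s2'le : s2' <= 2 `^ (- (beta * h)) * s2.
  by rewrite doubled_sumE ler_wpM2l ?(ltW p2)// lerBlDr lerDl.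
rewrite ger0_norm ?subr_ge0 ?ler_ln ?posrE ?mulr_gt0//.
apply: le_trans (ln_quotient_le _ s2'_gt0) _; first by rewrite mulr_gt0.
have -> : 2 `^ (- (beta * h)) * s2 - s2' = 2 `^ (- (beta * h)) * defect_sum.
  by rewrite doubled_sumE; ring.
have p1 : 2 `^ (- (beta * h)) <= 1 :> R.
  have /andP[h0 h1] := min_on_range adm.
  by rewrite -[leRHS](powRr0 2) ler_powR ?ler1n// oppr_le0 mulr_ge0// ltW.
have dm : defect_sum <= (cH + (3 + 16 * phi / gain_const)) * Num.min ((b - a) `^ rho) eps * s2.
  have K0 : 0 <= 3 + 16 * phi / gain_const.
    by rewrite addr_ge0// !mulr_ge0 ?invr_ge0 ?(ltW phi0) ?(ltW gc0).
  have m0 : 0 <= Num.min ((b - a) `^ rho) eps by rewrite le_min powR_ge0 ltW.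
  case: (leP ((b - a) `^ rho) eps) => _.
    apply: le_trans defect_sum_oscillation _; rewrite ler_wpM2r ?(ltW s2_gt0)//.
    by rewrite ler_wpM2r ?powR_ge0// lerDl.
  apply: le_trans defect_sum_concentration _; rewrite ler_wpM2r ?(ltW s2_gt0)//.
  by rewrite ler_wpM2r ?(ltW eps_gt0)// lerDr.
rewrite ler_pdivrMr//; apply: (@le_trans _ _ defect_sum); first by rewrite ler_piMl.
apply: le_trans dm _.
rewrite /bias_const [leRHS](_ : _ = (cH + (3 + 16 * phi / gain_const)) * Num.min ((b - a) `^ rho) eps * (2 * s2')); last by ring.
rewrite ler_wpM2l//; last by move: doubled_sum_ge; lra.
by rewrite mulr_ge0 ?le_min ?powR_ge0 ?(ltW eps_gt0)// addr_ge0// addr_ge0// !mulr_ge0 ?invr_ge0 ?(ltW phi0) ?(ltW gc0).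
Qed.

End two_grids.
End bias.

(** * Moment interpolation, truncation and rates *)

Section moment_interpolation.
Context {R : realType} d (T : measurableType d) (P : probability T R).

Local Notation integ f := (P.-integrable setT (EFin \o f)).
Local Notation "'Ex' f" := (Rintegral P setT f) (at level 10).

Lemma powR_interpolation (x dl p q : R) : 0 <= x -> 0 < dl -> 0 < p <= q ->
  x `^ p <= dl `^ p + dl `^ (p - q) * x `^ q.
Proof.
move=> x0 d0 /andP[p0 pq]; have [xd|/ltW dx] := leP x dl.
  rewrite -[leLHS]addr0 lerD ?mulr_ge0 ?powR_ge0//.
  by rewrite ge0_ler_powR ?nnegrE// ltW.
have x1 : 0 < x by exact: lt_le_trans dx.
rewrite -[leLHS]add0r lerD ?powR_ge0//.
have -> : x `^ p = x `^ (p - q) * x `^ q.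
  by rewrite -powRD ?(gt_eqF x1) ?implybT// subrK.
by rewrite ler_wpM2r ?powR_ge0//; apply: powR_base_anti; rewrite ?subr_le0.
Qed.

(** A substitute for Jensen's inequality, losing a factor of two. *)
Lemma Ex_powR_le (f : T -> R) (dl p q : R) : measurable_fun setT f -> (forall w, 0 <= f w) ->
  0 < dl -> 0 < p <= q -> integ (fun w => f w `^ q) -> Ex (fun w => f w `^ q) <= dl `^ q ->
  integ (fun w => f w `^ p) /\ Ex (fun w => f w `^ p) <= 2 * dl `^ p.
Proof.
move=> mf f0 d0 pq iq Eq.
have bnd w : f w `^ p <= dl `^ p + dl `^ (p - q) * f w `^ q by exact: powR_interpolation.
have ib : integ (fun w => dl `^ p + dl `^ (p - q) * f w `^ q).
  by apply: integrable_add; [exact: integrable_cst|exact: integrable_scale].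
have ip : integ (fun w => f w `^ p).
  apply: (integrable_dominated _ ib); first exact: (measurableT_comp (@measurable_powR R p)).
  by move=> w; rewrite ger0_norm ?powR_ge0.
split => //; apply: le_trans (Ex_le ip ib bnd) _.
rewrite Ex_add; [|exact: integrable_cst|exact: integrable_scale].
rewrite Ex_cst Ex_scale// (_ : 2 * dl `^ p = dl `^ p + dl `^ (p - q) * dl `^ q); last first.
  by rewrite -powRD ?(gt_eqF d0) ?implybT// subrK; ring.
by rewrite lerD2l ler_wpM2l ?powR_ge0.
Qed.

End moment_interpolation.

Section truncated_logarithm.
Context {R : realType}.
Variable beta : R.
Hypothesis beta0 : 0 < beta.

Let ln2p : 0 < ln (2 : R). Proof. by have := @ln2_ge_half R; lra. Qed.
Let low : R := 2 `^ (beta / 2).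
Let high : R := 2 `^ beta.

Let low_gt0 : 0 < low. Proof. exact: powR_gt0. Qed.
Let high_gt0 : 0 < high. Proof. exact: powR_gt0. Qed.
Let low_high : low <= high. Proof. by rewrite ler_powR ?ler1n//; move: beta0; lra. Qed.

Let trunc_bounds (x : R) : low <= trunc_T beta x <= high.
Proof. by rewrite /trunc_T -/low -/high le_min ge_min lexx low_high le_max lexx orbT. Qed.

Definition truncated_exponent (x : R) : R := beta^-1 * log2 (trunc_T beta x).

Let exponentE (x : R) : truncated_exponent x = ln (trunc_T beta x) / (beta * ln 2).
Proof. by rewrite /truncated_exponent /log2; field; rewrite !gt_eqF. Qed.

Let bl0 : 0 < beta * ln 2. Proof. exact: mulr_gt0. Qed.

Lemma truncated_exponent_range x : 2^-1 <= truncated_exponent x <= 1.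
Proof.
have /andP[l u] := trunc_bounds x; have t0 : 0 < trunc_T beta x by exact: lt_le_trans l.
rewrite exponentE ler_pdivlMr// ler_pdivrMr// mul1r -ler_ln ?posrE// in l *.
rewrite -ler_ln ?posrE// in u.
move: l u; rewrite /low /high !ln_powR => l u; apply/andP; split => //.
by apply: le_trans l; rewrite le_eqVlt; apply/orP; left; apply/eqP; ring.
Qed.

Lemma truncated_exponent_error x h : 0 < x -> 2^-1 <= h <= 1 ->
  `|truncated_exponent x - h| <= `|ln x - beta * h * ln 2| / (beta * ln 2).
Proof.
move=> x0 /andP[h1 h2]; have /andP[l u] := trunc_bounds x.
have t0 : 0 < trunc_T beta x by exact: lt_le_trans l.
rewrite exponentE.
have -> : ln (trunc_T beta x) / (beta * ln 2) - h =
    (ln (trunc_T beta x) - beta * h * ln 2) / (beta * ln 2).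
  by field; rewrite !gt_eqF.
rewrite normrM (ger0_norm (_ : 0 <= (beta * ln 2)^-1)) ?invr_ge0 ?(ltW bl0)//.
rewrite ler_wpM2r ?invr_ge0 ?(ltW bl0)//.
have hl : ln low <= beta * h * ln 2.
  rewrite ln_powR ler_wpM2r ?(ltW ln2p)// ler_wpM2l ?(ltW beta0)//.
have hu : beta * h * ln 2 <= ln high.
  by rewrite ln_powR ler_wpM2r ?(ltW ln2p)// ler_piMr// ltW.
rewrite /trunc_T -/low -/high.
case: (leP x low) => xl.
  rewrite (min_r low_high); have lx : ln x <= ln low by rewrite ler_ln ?posrE.
  rewrite ler0_norm ?subr_le0// ler0_norm ?subr_le0; last exact: le_trans hl.
  by rewrite lerN2 lerD2r.
case: (leP high x) => xu //.
have lx : ln high <= ln x by rewrite ler_ln ?posrE.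
rewrite ger0_norm ?subr_ge0// ger0_norm ?subr_ge0; last exact: le_trans lx.
by rewrite lerD2r.
Qed.

End truncated_logarithm.

Section rate.
Context {R : realType}.
Variables (L : nat) (beta : R).
Hypotheses (L2 : (2 <= L)%N) (beta0 : 0 < beta).

Let B : R := beta * (L%:R - 1).
Let B0 : 0 < B. Proof. by rewrite mulr_gt0// subr_gt0 ltr1n. Qed.

(** The exponent reached by the second moment, in units of [N * lambda(I)]. *)
Definition variance_exponent : R := B / (1 + 2 * B).

Lemma variance_exponent_range : 0 < variance_exponent < 2^-1.
Proof.
have d0 : 0 < 1 + 2 * B by move: B0; lra.
by rewrite /variance_exponent divr_gt0//= ltr_pdivrMr//; move: B0; lra.
Qed.

Lemma Lambda_expE (p : R) : Lambda_exp L beta p = 2 * B / ((p + 4) * B + 2 * (p + 1)).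
Proof. by rewrite /Lambda_exp /B -!mulrA. Qed.

Lemma Lambda_exp_bounds (p : R) : 0 < p <= 4 ->
  [/\ 0 <= Lambda_exp L beta p, Lambda_exp L beta p <= 2^-1,
     (p + 4) * Lambda_exp L beta p <= 2 &
     p * Lambda_exp L beta p <= Num.min p 2 * variance_exponent].
Proof.
move=> /andP[p0 p4]; rewrite Lambda_expE.
have d0 : 0 < (p + 4) * B + 2 * (p + 1) by rewrite addr_gt0// mulr_gt0//; lra.
have e0 : 0 < 1 + 2 * B by move: B0; lra.
have pB : 0 < p * B by rewrite mulr_gt0.
split.
- by rewrite divr_ge0 ?(ltW d0)// mulr_ge0// ltW.
- rewrite ler_pdivrMr//; move: B0 p0 pB; lra.
- rewrite mulrA ler_pdivrMr//; move: B0 p0 pB; lra.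
have pp : p * B <= 4 * B by rewrite ler_wpM2r// ltW.
set D := (p + 4) * B + _ in d0 *; set r := Num.min p 2.
have -> : p * (2 * B / D) = p * 2 * B * (1 + 2 * B) / (D * (1 + 2 * B)).
  by field; rewrite !gt_eqF.
have -> : r * variance_exponent = r * B * D / (D * (1 + 2 * B)).
  by rewrite /variance_exponent; field; rewrite !gt_eqF.
rewrite ler_wpM2r ?invr_ge0 ?mulr_ge0 ?(ltW d0) ?(ltW e0)// /r /D.
have [p2|p2] := leP p 2.
  rewrite (_ : p * 2 * B * (1 + 2 * B) = p * B * (2 + 4 * B)); last by ring.
  by rewrite ler_wpM2l ?(ltW pB)//; move: p0 pB; lra.
rewrite (_ : p * 2 * B * (1 + 2 * B) = 2 * B * (p + 2 * (p * B))); last by ring.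
have key : p + 2 * (p * B) <= (p + 4) * B + 2 * (p + 1).
  by rewrite [(p + 4) * B]mulrDl; move: p0 pp B0; lra.
by apply: ler_wpM2l => //; rewrite mulr_ge0 ?(ltW B0).
Qed.

(** By [Lambda_exp_bounds], the exponent of [N] in the bound is weaker than the one that the
    second moment gives, and the powers of [l] and [lam] in the bound dominate the factor
    [Num.max 1 (lam * l ^+ 2)]. *)
Lemma variance_rate_le (N lam l p : R) : 1 <= N -> 0 < lam <= 1 -> 1 <= N * lam -> 1 <= l ->
  0 < p <= 4 ->
  (Num.max 1 (lam * l ^+ 2) * (N * lam) `^ (- variance_exponent)) `^ (Num.min p 2) <=
  N `^ (- (p * Lambda_exp L beta p)) * l `^ (8 * (1 - Lambda_exp L beta p))
    * lam `^ (- (4 * (1 - Lambda_exp L beta p)))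
    * Num.max (lam ^+ 2) (N `^ (- ((p + 4) * Lambda_exp L beta p))).
Proof.
move=> N1 /andP[lam0 lam1] Nl l1 p04; have [L0 Lh L4 Lv] := Lambda_exp_bounds p04.
have /andP[p0 p4] := p04.
set La := Lambda_exp L beta p in L0 Lh L4 Lv *; set r := Num.min p 2.
have r0 : 0 < r by rewrite lt_min p0 ltr0n.
have r2 : r <= 2 by rewrite ge_min lexx orbT.
have N0 : 0 < N by exact: lt_le_trans N1.
have l0 : 0 < l by exact: lt_le_trans l1.
set g := Num.max 1 _.
have g1 : 1 <= g by rewrite le_max lexx.
have g0 : 0 <= g by exact: le_trans g1.
rewrite (powRM _ g0 (powR_ge0 _ _)) -powRrM.
have t1 : (N * lam) `^ (- variance_exponent * r) <= N `^ (- (p * La)) * lam `^ (- (p * La)).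
  rewrite -powRM ?(ltW N0) ?(ltW lam0)// ler_powR// mulNr lerN2 [leRHS]mulrC.
  exact: Lv.
have t2 : g `^ r * lam `^ (- (p * La)) <= l `^ (8 * (1 - La)) * lam `^ (- (4 * (1 - La))) * lam ^+ 2.
  rewrite -[leRHS]mulrA (_ : lam `^ (- (4 * (1 - La))) * lam ^+ 2 = lam `^ (4 * La - 2)); last first.
    rewrite -powR_mulrn ?(ltW lam0)// -powRD ?(gt_eqF lam0) ?implybT//.
    by congr (_ `^ _); ring.
  have lL : 1 <= l `^ (8 * (1 - La)).
    by rewrite -[leLHS](powRr0 l) ler_powR//; move: Lh; lra.
  rewrite /g; case: (leP 1 (lam * l ^+ 2)) => gl.
    rewrite powRM ?exprn_ge0 ?(ltW l0) ?(ltW lam0)// -powR_mulrn ?(ltW l0)// -powRrM.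
    rewrite mulrAC mulrC; apply: ler_pM; rewrite ?mulr_ge0 ?powR_ge0//.
      by rewrite ler_powR//; move: r2 Lh; lra.
    rewrite -powRD ?(gt_eqF lam0) ?implybT//; apply: ger_powR; first by rewrite lam0.
    by move: L4 r0; lra.
  rewrite powR1 mul1r -[leLHS]mul1r; apply: ler_pM; rewrite ?powR_ge0//.
  apply: ger_powR; first by rewrite lam0.
  by move: L4; lra.
apply: (@le_trans _ _ (g `^ r * (N `^ (- (p * La)) * lam `^ (- (p * La))))).
  by rewrite ler_wpM2l ?powR_ge0.
apply: (@le_trans _ _ (N `^ (- (p * La)) * (l `^ (8 * (1 - La)) * lam `^ (- (4 * (1 - La))) * lam ^+ 2))).
  by rewrite mulrCA ler_wpM2l ?powR_ge0.
rewrite [leLHS](_ : _ = N `^ (- (p * La)) * l `^ (8 * (1 - La)) *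
  lam `^ (- (4 * (1 - La))) * lam ^+ 2); last by ring.
by rewrite ler_wpM2l ?mulr_ge0 ?powR_ge0// le_max lexx.
Qed.

End rate.

(** * From moments of the parts to moments of the error *)

Section error_moments.
Context {R : realType} d (T : measurableType d) (P : probability T R).

Local Notation integ f := (P.-integrable setT (EFin \o f)).
Local Notation "'Ex' f" := (Rintegral P setT f) (at level 10).

Let scaled_moment (E : T -> R) (c C A x q p : R) : measurable_fun setT E ->
  (forall w, 0 <= E w) -> 0 <= c -> 0 < C -> 0 < x -> 0 < p <= q ->
  integ (fun w => E w `^ q) -> Ex (fun w => E w `^ q) <= A * x `^ q ->
  c `^ q * A <= C `^ q ->
  integ (fun w => (c * E w) `^ p) /\ Ex (fun w => (c * E w) `^ p) <= 2 * (C * x) `^ p.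
Proof.
move=> mE E0 c0 C0 x0 pq iE EA cA.
have eq w : (c * E w) `^ q = c `^ q * E w `^ q by rewrite powRM.
apply: (Ex_powR_le (q := q)) => //.
- exact: measurable_funM.
- by move=> w; rewrite mulr_ge0.
- exact: mulr_gt0.
- rewrite (_ : (fun w => _) = (fun w => c `^ q * E w `^ q)); last exact/funext.
  exact: integrable_scale.
rewrite (_ : (fun w => _) = (fun w => c `^ q * E w `^ q)); last exact/funext.
rewrite Ex_scale// powRM ?(ltW C0) ?(ltW x0)//.
apply: (@le_trans _ _ (c `^ q * (A * x `^ q))); first by rewrite ler_wpM2l ?powR_ge0.
by rewrite mulrA ler_wpM2r ?powR_ge0.
Qed.

Definition error_const (C1 CA CB : R) : R := 1 + 7 * C1 * (1 + CA + CB).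

(** At each point the error is at most [7 * C1] times the largest of the seven terms. As it is at
    most one, its power [p] is at most its power [min p 2], which is used for the three terms
    of order [D]. *)
Lemma error_moment (err E1 E2 E3 E4 : T -> R) (u D mu C1 CA CB p : R) :
  measurable_fun setT err -> (forall w, 0 <= err w <= 1) ->
  0 < C1 -> 0 <= CA -> 0 <= CB -> 0 < u -> 0 < D -> 0 <= mu -> 0 < p <= 4 ->
  (forall w, err w <= C1 * (E1 w + E2 w + E3 w + E4 w + u + D + mu)) ->
  [/\ measurable_fun setT E1, forall w, 0 <= E1 w, integ (fun w => E1 w ^+ 4) &
    Ex (fun w => E1 w ^+ 4) <= CA * u ^+ 4] ->
  [/\ measurable_fun setT E2, forall w, 0 <= E2 w, integ (fun w => E2 w ^+ 2) &
    Ex (fun w => E2 w ^+ 2) <= CB * D ^+ 2] ->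
  [/\ measurable_fun setT E3, forall w, 0 <= E3 w, integ (fun w => E3 w ^+ 4) &
    Ex (fun w => E3 w ^+ 4) <= CA * u ^+ 4] ->
  [/\ measurable_fun setT E4, forall w, 0 <= E4 w, integ (fun w => E4 w ^+ 2) &
    Ex (fun w => E4 w ^+ 2) <= CB * D ^+ 2] ->
  integ (fun w => err w `^ p) /\
  Ex (fun w => err w `^ p) <=
    5 * error_const C1 CA CB ^+ 4 * (mu `^ p + u `^ p + D `^ (Num.min p 2)).
Proof.
move=> merr err01 C10 CA0 CB0 u0 D0 mu0 /andP[p0 p4] bnd H1 H2 H3 H4.
set C := error_const C1 CA CB; set r := Num.min p 2; set c := 7 * C1.
have c0 : 0 < c by rewrite mulr_gt0.
have cA0 : 0 <= c * CA by rewrite mulr_ge0// ltW.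
have cB0 : 0 <= c * CB by rewrite mulr_ge0// ltW.
have CE : C = 1 + (c + c * CA + c * CB) by rewrite /C /error_const -/c; ring.
have Cge1 : 1 <= C by rewrite CE; lra.
have C0 : 0 < C by exact: lt_le_trans Cge1.
have cC : c <= C by rewrite CE; lra.
have cAC : c * (1 + CA) <= C by rewrite CE; lra.
have cBC : c * (1 + CB) <= C by rewrite CE; lra.
have r0 : 0 < r by rewrite lt_min p0 ltr0n.
have r2 : r <= 2 by rewrite ge_min lexx orbT.
have rp : r <= p by rewrite ge_min lexx.
have powC (q : R) : 0 <= q -> q <= 4 -> C `^ q <= C ^+ 4.
  by move=> q0 q4; rewrite -powR_mulrn ?(ltW C0)// ler_powR.
have quart (E : T -> R) : [/\ measurable_fun setT E, forall w, 0 <= E w, integ (fun w => E w ^+ 4) &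
    Ex (fun w => E w ^+ 4) <= CA * u ^+ 4] ->
    integ (fun w => (c * E w) `^ p) /\ Ex (fun w => (c * E w) `^ p) <= 2 * (C * u) `^ p.
  move=> [mE E0 iE EE].
  have e4 : (fun w => E w ^+ 4) = (fun w => E w `^ 4).
    by apply/funext => w; rewrite -powR_mulrn.
  apply: (scaled_moment (A := CA) (q := 4)) => //; rewrite -?e4 ?(ltW c0) ?p0//.
    by rewrite powR_mulrn// ltW.
  rewrite !powR_mulrn ?(ltW c0) ?(ltW C0)//.
  apply: (@le_trans _ _ ((c * (1 + CA)) ^+ 4)); last first.
    by rewrite lerXn2r ?nnegrE ?(ltW C0)// mulr_ge0 ?(ltW c0)// addr_ge0.
  rewrite [leRHS]exprMn ler_wpM2l ?exprn_ge0 ?(ltW c0)//.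
  apply: (@le_trans _ _ (1 + CA)); first by rewrite lerDr.
  by rewrite ler_eXnr// lerDl.
have quad (E : T -> R) : [/\ measurable_fun setT E, forall w, 0 <= E w, integ (fun w => E w ^+ 2) &
    Ex (fun w => E w ^+ 2) <= CB * D ^+ 2] ->
    integ (fun w => (c * E w) `^ r) /\ Ex (fun w => (c * E w) `^ r) <= 2 * (C * D) `^ r.
  move=> [mE E0 iE EE].
  have e2 : (fun w => E w ^+ 2) = (fun w => E w `^ 2).
    by apply/funext => w; rewrite -powR_mulrn.
  apply: (scaled_moment (A := CB) (q := 2)) => //; rewrite -?e2 ?(ltW c0) ?r0//.
    by rewrite powR_mulrn// ltW.
  rewrite !powR_mulrn ?(ltW c0) ?(ltW C0)//.
  apply: (@le_trans _ _ ((c * (1 + CB)) ^+ 2)); last first.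
    by rewrite lerXn2r ?nnegrE ?(ltW C0)// mulr_ge0 ?(ltW c0)// addr_ge0.
  rewrite [leRHS]exprMn ler_wpM2l ?exprn_ge0 ?(ltW c0)//.
  apply: (@le_trans _ _ (1 + CB)); first by rewrite lerDr.
  by rewrite ler_eXnr// lerDl.
have [i1 m1] := quart _ H1; have [i3 m3] := quart _ H3.
have [i2 m2] := quad _ H2; have [i4 m4] := quad _ H4.
have [_ E10 _ _] := H1; have [_ E20 _ _] := H2; have [_ E30 _ _] := H3; have [_ E40 _ _] := H4.
pose k := (c * u) `^ p + (c * D) `^ r + (c * mu) `^ p.
pose S w := (c * E1 w) `^ p + ((c * E2 w) `^ r + ((c * E3 w) `^ p + ((c * E4 w) `^ r + k))).
have k0 : 0 <= k by rewrite !addr_ge0 ?powR_ge0.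
have pt w : err w `^ p <= S w.
  have /andP[e0 e1] := err01 w.
  have byp x : 0 <= x -> err w <= x -> err w `^ p <= x `^ p.
    by move=> x0 ex; rewrite ge0_ler_powR ?nnegrE// ltW.
  have byr x : 0 <= x -> err w <= x -> err w `^ p <= x `^ r.
    move=> x0 ex; have [->|en0] := eqVneq (err w) 0; first by rewrite powR0 ?powR_ge0// gt_eqF.
    apply: (@le_trans _ _ (err w `^ r)).
      by apply: ger_powR; rewrite // lt_neqAle eq_sym en0 e0.
    by rewrite ge0_ler_powR ?nnegrE// ltW.
  have P1 := powR_ge0 (c * E1 w) p; have P2 := powR_ge0 (c * E2 w) r.
  have P3 := powR_ge0 (c * E3 w) p; have P4 := powR_ge0 (c * E4 w) r.
  have P5 := powR_ge0 (c * u) p; have P6 := powR_ge0 (c * D) r; have P7 := powR_ge0 (c * mu) p.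
  have nn x : 0 <= x -> 0 <= c * x by move=> x0; rewrite mulr_ge0// ltW.
  rewrite /S /k.
  have [h|h1] := leP (err w) (c * E1 w); first by move: (byp _ (nn _ (E10 w)) h) P1 P2 P3 P4 P5 P6 P7; clear; lra.
  have [h|h2] := leP (err w) (c * E2 w); first by move: (byr _ (nn _ (E20 w)) h) P1 P2 P3 P4 P5 P6 P7; clear; lra.
  have [h|h3] := leP (err w) (c * E3 w); first by move: (byp _ (nn _ (E30 w)) h) P1 P2 P3 P4 P5 P6 P7; clear; lra.
  have [h|h4] := leP (err w) (c * E4 w); first by move: (byr _ (nn _ (E40 w)) h) P1 P2 P3 P4 P5 P6 P7; clear; lra.
  have [h|h5] := leP (err w) (c * u); first by move: (byp _ (nn _ (ltW u0)) h) P1 P2 P3 P4 P5 P6 P7; clear; lra.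
  have [h|h6] := leP (err w) (c * D); first by move: (byr _ (nn _ (ltW D0)) h) P1 P2 P3 P4 P5 P6 P7; clear; lra.
  have [h|h7] := leP (err w) (c * mu); first by move: (byp _ (nn _ mu0) h) P1 P2 P3 P4 P5 P6 P7; clear; lra.
  exfalso; have := bnd w; move: h1 h2 h3 h4 h5 h6 h7; rewrite /c; clear; lra.
have iS : integ S by do 4 apply: integrable_add => //; exact: integrable_cst.
have ie : integ (fun w => err w `^ p).
  apply: (integrable_dominated _ iS); first exact: (measurableT_comp (@measurable_powR R p)).
  by move=> w; rewrite ger0_norm ?powR_ge0.
split => //; apply: le_trans (Ex_le ie iS pt) _.
have ES : Ex S <= 2 * (C * u) `^ p + (2 * (C * D) `^ r + (2 * (C * u) `^ p + (2 * (C * D) `^ r + k))).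
  rewrite /S Ex_add//; last by do 3 apply: integrable_add => //; exact: integrable_cst.
  rewrite Ex_add//; last by do 2 apply: integrable_add => //; exact: integrable_cst.
  rewrite Ex_add//; last by apply: integrable_add => //; exact: integrable_cst.
  rewrite Ex_add//; last exact: integrable_cst.
  by rewrite Ex_cst !lerD.
apply: le_trans ES _.
have kle : k <= (C * u) `^ p + (C * D) `^ r + (C * mu) `^ p.
  have mono (y q : R) : 0 <= y -> 0 <= q -> (c * y) `^ q <= (C * y) `^ q.
    move=> y0 q0; have cy : 0 <= c * y by rewrite mulr_ge0// ltW.
    have yy : c * y <= C * y by rewrite ler_wpM2r.
    by apply: ge0_ler_powR => //; rewrite nnegrE// (le_trans cy).
  by rewrite /k !lerD ?mono// ltW.
have su : (C * u) `^ p <= C ^+ 4 * u `^ p.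
  by rewrite powRM ?(ltW C0) ?(ltW u0)// ler_wpM2r ?powR_ge0// powC// ltW.
have sm : (C * mu) `^ p <= C ^+ 4 * mu `^ p.
  by rewrite powRM ?(ltW C0)// ler_wpM2r ?powR_ge0// powC// ltW.
have sD : (C * D) `^ r <= C ^+ 4 * D `^ r.
  by rewrite powRM ?(ltW C0) ?(ltW D0)// ler_wpM2r ?powR_ge0// powC ?(ltW r0)// (le_trans r2)// ler_nat.
have z : 0 <= C ^+ 4 * mu `^ p by rewrite mulr_ge0 ?powR_ge0 ?exprn_ge0 ?(ltW C0).
rewrite [leRHS](_ : _ = 5 * (C ^+ 4 * mu `^ p) + 5 * (C ^+ 4 * u `^ p) + 5 * (C ^+ 4 * D `^ r)); last by ring.
by move: kle su sm sD z; clear; lra.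
Qed.

End error_moments.

(** * Fluctuations relative to the mean *)

Section relative_fluctuation.
Context {R : realType} d (T : measurableType d) (P : probability T R).
Variables (alpha : R) (SI : (R -> R) -> {RV P >-> R}).
Hypothesis alpha12 : 1 < alpha < 2.
Hypothesis HSI : is_stable_integral alpha SI.
Variable X : R -> R -> {RV P >-> R}.
Hypothesis HX : is_field_X alpha SI X.
Variables (H : R -> R) (hlo hhi : R).
Hypotheses (hlo_gt : alpha^-1 < hlo) (hhi_lt1 : hhi < 1).
Hypothesis Hrange : forall t : R, 0 <= t <= 1 -> hlo <= H t <= hhi.
Variables (cH rho hsup : R).
Hypothesis cH0 : 0 <= cH.
Hypothesis Hholder : forall t1 t2 : R, 0 <= t1 <= 1 -> 0 <= t2 <= 1 ->
  `|H t1 - H t2| <= cH * `|t1 - t2| `^ rho.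
Hypothesis Hsup : forall t : R, 0 <= t <= 1 -> H t <= hsup.
Hypothesis hsup_rho : hsup < rho <= 1.
Variable beta : R.
Hypothesis beta14 : 0 < beta <= 4^-1.
Variable L : nat.
Hypothesis L2 : (2 <= L)%N.

Local Notation integ f := (P.-integrable setT (EFin \o f)).
Local Notation "'Ex' f" := (Rintegral P setT f) (at level 10).

Let alpha1 : 1 < alpha. Proof. by case/andP: alpha12. Qed.
Let b1 : 0 < beta <= 1. Proof. by move: beta14; lra. Qed.
Let b0 : 0 < beta. Proof. by case/andP: beta14. Qed.
Let b2 : 0 < beta * 2 <= 1. Proof. by move: beta14; lra. Qed.
Let b4 : 0 < beta * 4 <= 1. Proof. by move: beta14; lra. Qed.
Let K1 : 0 < stable_moment alpha beta. Proof. exact: (stable_moment_gt0 alpha12 b1). Qed.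
Let K2 : 0 < stable_moment alpha (beta * 2). Proof. exact: (stable_moment_gt0 alpha12 b2). Qed.
Let K4 : 0 < stable_moment alpha (beta * 4). Proof. exact: (stable_moment_gt0 alpha12 b4). Qed.

Lemma hurst_ge_half t : 0 <= t <= 1 -> 2^-1 <= H t <= 1.
Proof.
move=> tI; have /andP[l u] := Hrange tI; apply/andP; split; last by move: hhi_lt1 u; lra.
apply: le_trans l; apply: le_trans (ltW hlo_gt).
by rewrite lef_pV2 ?posrE//; move: alpha12; lra.
Qed.

Let H01 t : 0 <= t <= 1 -> 0 <= H t <= 1.
Proof. by move/hurst_ge_half/andP => [h1 h2]; rewrite h2 andbT; lra. Qed.

Lemma holder_exponent_ge_half : 2^-1 <= rho <= 1.
Proof.
have z : 0 <= (0 : R) <= 1 by rewrite lexx ler01.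
by have := hurst_ge_half z; have := Hsup z; move: hsup_rho; lra.
Qed.

(** The function of the Hurst index that remains in [expected_power] once the power of the
    mesh is factored out. *)
Definition profile (v : R) : R :=
  stable_moment alpha beta * alpha_norm alpha (stencil alpha L v) `^ beta.
Definition profile_low : R := stable_moment alpha beta * 4^-1 `^ beta.
Definition profile_high : R := stable_moment alpha beta * stencil_size alpha hhi L `^ beta.
Definition profile_holder : R :=
  stable_moment alpha beta * stencil_lipschitz alpha hlo hhi L `^ beta.

Lemma profile_low_gt0 : 0 < profile_low.
Proof. by apply: mulr_gt0 K1 (powR_gt0 _ _); rewrite invr_gt0. Qed.

Lemma profile_bounds t : 0 <= t <= 1 -> profile_low <= profile (H t) <= profile_high.
Proof.
move=> tI; have v := Hrange tI.
have lo := stencil_norm_lower alpha1 hlo_gt hhi_lt1 L2 v.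
have [_ hi] := Lalpha_stencil alpha1 hlo_gt hhi_lt1 L2 v.
have n0 : 0 <= alpha_norm alpha (stencil alpha L (H t)) by exact: alpha_norm_ge0.
rewrite /profile_low /profile_high /profile !ler_wpM2l ?(ltW K1)//.
  by rewrite ge0_ler_powR ?nnegrE ?(ltW b0)// (le_trans n0).
by rewrite ge0_ler_powR ?nnegrE ?(ltW b0)// invr_ge0.
Qed.

Lemma profile_holder_ge0 : 0 <= profile_holder.
Proof. exact: mulr_ge0 (ltW K1) (powR_ge0 _ _). Qed.

Lemma profile_modulus t1 t2 : 0 <= t1 <= 1 -> 0 <= t2 <= 1 ->
  `|profile (H t1) - profile (H t2)| <= profile_holder * `|H t1 - H t2| `^ beta.
Proof.
move=> t1I t2I; have l0 : 0 <= stencil_lipschitz alpha hlo hhi L by exact: stencil_lipschitz_ge0.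
rewrite /profile /profile_holder -mulrBr normrM (gtr0_norm K1) -mulrA ler_wpM2l ?(ltW K1)//.
rewrite -powRM ?normr_ge0//.
set x := alpha_norm _ _; set y := alpha_norm _ (stencil _ _ (H t2)).
have x0 : 0 <= x by exact: alpha_norm_ge0.
have y0 : 0 <= y by exact: alpha_norm_ge0.
have := normr_powR_diff x y b1; rewrite (ger0_norm x0) (ger0_norm y0) => /le_trans; apply.
have xy := stencil_norm_lipschitz alpha1 hlo_gt hhi_lt1 L2 (Hrange t1I) (Hrange t2I).
have yx := stencil_norm_lipschitz alpha1 hlo_gt hhi_lt1 L2 (Hrange t2I) (Hrange t1I).
rewrite [`|H t2 - _|]distrC in yx.
have xyle : `|x - y| <= stencil_lipschitz alpha hlo hhi L * `|H t1 - H t2|.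
  by rewrite ler_distl lerBlDr xy yx.
apply: ge0_ler_powR => //; rewrite ?nnegrE ?(ltW b0)//.
by rewrite mulr_ge0.
Qed.

Lemma mean_power_varE (a b : R) (M : nat) :
  mean_power_var alpha H beta L M `[a, b]%classic = weight_mean L H beta profile a b M.
Proof.
rewrite /mean_power_var /weight_mean; congr (_ * _); apply: eq_bigr => k _.
rewrite /expected_power /weight /grid_H powRM ?powR_ge0 ?alpha_norm_ge0//.
by rewrite -powRrM /profile mulNr [H _ * beta]mulrC; ring.
Qed.

(** The size of the stochastic fluctuation of the power variation, relatively
    to its mean. *)
Definition dispersion (a b : R) (M : nat) : R :=
  gain a b M * (M%:R * (b - a)) `^ (- variance_exponent L beta).

Definition freezing_moment : R := stable_moment alpha (beta * 4) *
  freezing_const alpha hlo hhi cH L `^ (beta * 4) / profile_low ^+ 4.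

Definition variance_moment : R :=
  (gain_const cH beta profile_low) ^- 2 * (2 * stable_moment alpha (beta * 2) *
  (8 / 3 * (2 * L%:R + 3) * stencil_size alpha hhi L `^ (beta * 2) + tail_const L `^ (beta * 2))).

Lemma freezing_moment_ge0 : 0 <= freezing_moment.
Proof.
apply: mulr_ge0; first exact: mulr_ge0 (ltW K4) (powR_ge0 _ _).
by rewrite invr_ge0 exprn_ge0// ltW// profile_low_gt0.
Qed.

Lemma variance_moment_ge0 : 0 <= variance_moment.
Proof.
apply: mulr_ge0; first by rewrite invr_ge0 sqr_ge0.
apply: mulr_ge0; first exact: mulr_ge0 (ler0n _ _) (ltW K2).
apply: addr_ge0 (powR_ge0 _ _); apply: mulr_ge0 (powR_ge0 _ _).
by rewrite mulr_ge0// addr_ge0// mulr_ge0.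
Qed.

Variables (a b : R) (M : nat).
Hypothesis adm : admissible L a b M.

Let MR : 0 < M%:R :> R.
Proof. by case: adm => _ _ _ M3 _; rewrite ltr0n (leq_trans _ M3). Qed.
Let lam0 : 0 < b - a. Proof. by case: adm => _ ab _ _ _; rewrite subr_gt0. Qed.
Let x : R := M%:R * (b - a).
Let x1 : 1 <= x.
Proof.
have [h _] := admissible_size L2 adm; apply: le_trans h.
by have : 0 <= L%:R :> R by []; lra.
Qed.
Let x0 : 0 < x. Proof. exact: mulr_gt0. Qed.
Let B : R := beta * (L%:R - 1).
Let B0 : 0 < B. Proof. by rewrite mulr_gt0// subr_gt0 ltr1n. Qed.

(** The window balances the variance of the near parts against the size of the
    far ones. *)
Let window : exists2 m : nat, (1 <= m)%N &
  (m + L).*2.+1%:R / x <= 2 * (2 * L%:R + 3) * (x `^ (- variance_exponent L beta)) ^+ 2 /\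
  (m%:R `^ (- (L%:R - 1))) `^ (beta * 2) <= (x `^ (- variance_exponent L beta)) ^+ 2.
Proof.
have d0 : 0 < 1 + 2 * B by move: B0; lra.
pose th := (1 + 2 * B)^-1; pose t := x `^ th.
have th0 : 0 < th by rewrite invr_gt0.
have t1 : 1 <= t by rewrite -(powRr0 x) /t ler_powR// ltW.
have t0 : 0 < t by exact: lt_le_trans t1.
have sq : (x `^ (- variance_exponent L beta)) ^+ 2 = x `^ (th - 1).
  rewrite -powR_mulrn ?powR_ge0// -powRrM; congr (_ `^ _).
  by rewrite /variance_exponent -/B /th; field; rewrite gt_eqF.
exists (Num.truncn t).+1 => //; rewrite sq.
have /andP[tr1 tr2] := truncn_itv (ltW t0).
set m := (Num.truncn t).+1 in tr2 *.
have m2 : m%:R <= 2 * t by rewrite /m -natr1; move: tr1 t1; lra.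
have m0 : 1 <= m%:R :> R by rewrite ler1n.
split.
  have -> : x `^ (th - 1) = t / x.
    by rewrite -[x in _ / x]powRr1 ?(ltW x0)// -powRN -powRD ?(gt_eqF x0) ?implybT.
  rewrite mulrA ler_wpM2r ?invr_ge0 ?(ltW x0)//.
  apply: (@le_trans _ _ ((2 * L%:R + 3) * m%:R)).
    rewrite -addnn -natr1 !natrD; have : 0 <= L%:R :> R by [].
    by move: m0; nra.
  rewrite [leRHS](_ : _ = (2 * L%:R + 3) * (2 * t)); last by ring.
  by rewrite ler_wpM2l// addr_ge0// mulr_ge0.
rewrite -powRrM; apply: (@le_trans _ _ (t `^ (- (2 * B)))).
  rewrite (_ : - (L%:R - 1) * (beta * 2) = - (2 * B)); last by rewrite /B; ring.
  by apply: powR_base_anti; rewrite ?(ltW tr2)// oppr_le0 mulr_ge0// ltW.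
rewrite /t -powRrM (_ : th * - (2 * B) = th - 1)//.
by rewrite /th; field; rewrite gt_eqF.
Qed.

Lemma relative_fluctuation : exists E1 E2 : T -> R,
  [/\ [/\ measurable_fun setT E1, forall w, 0 <= E1 w, integ (fun w => E1 w ^+ 4) &
        Ex (fun w => E1 w ^+ 4) <= freezing_moment * (M%:R `^ (- (beta * (rho - hsup)))) ^+ 4],
      [/\ measurable_fun setT E2, forall w, 0 <= E2 w, integ (fun w => E2 w ^+ 2) &
        Ex (fun w => E2 w ^+ 2) <= variance_moment * dispersion a b M ^+ 2] &
      forall w, `|power_var (LMSM X H) L beta M `[a, b]%classic w /
                  weight_mean L H beta profile a b M - 1| <= E1 w + E2 w].
Proof.
have rho01 : 0 < rho <= 1 by have := holder_exponent_ge_half; lra.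
have [_ LM] := admissible_size L2 adm.
have /andP[n1 _] := admissible_card L2 adm.
set n : R := #|nu L M `[a, b]%classic|%:R in n1.
have n0 : 0 < n by apply: lt_le_trans n1; rewrite !mulr_gt0.
have nu0 : (0 < #|nu L M `[a, b]%classic|)%N by rewrite -(ltr_nat R).
have [m m1 [mv mf]] := window.
pose h := min_on H `[a, b]%classic.
have hm (k : 'I_(M - L).+1) : k \in nu L M `[a, b]%classic -> h <= grid_H H M k.
  by rewrite in_nu => kI; apply: (min_on_le H01 adm).
have [A [F [A0 [iA EA] [iF EF] [mA mF] bnd]]] := power_variation_approximation alpha12 HSI HX
  hlo_gt hhi_lt1 Hrange cH0 rho01 Hholder beta14 L2 LM m1 nu0 hm.
have plo0 := profile_low_gt0; have gc0 := gain_const_gt0 cH beta plo0.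
have Rsup := weight_mean_ge_sup L2 beta14 plo0 profile_bounds adm Hsup.
have Rmin := weight_mean_ge L2 H01 cH0 holder_exponent_ge_half Hholder beta14 plo0 profile_bounds adm.
set Rm := weight_mean L H beta profile a b M in Rsup Rmin *.
have R0 : 0 < Rm by apply: lt_le_trans Rsup; rewrite mulr_gt0// powR_gt0.
have Ri0 : 0 <= Rm^-1 by rewrite invr_ge0 ltW.
exists (fun w => Rm^-1 * A w), (fun w => Rm^-1 * `|F w|); split.
- have eA : (fun w => (Rm^-1 * A w) ^+ 4) = (fun w => Rm^-1 ^+ 4 * A w ^+ 4).
    by apply/funext => w; rewrite exprMn.
  split; first exact: measurable_funM.
  + by move=> w; rewrite mulr_ge0.
  + by rewrite eA; exact: integrable_scale.
  rewrite eA Ex_scale//.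
  have fc0 : 0 <= freezing_const alpha hlo hhi cH L.
    by rewrite !mulr_ge0 ?alpha_norm_ge0 ?coef_mass_ge0 ?kernel_lipschitz_ge0.
  have Rsup4 : profile_low ^+ 4 * (M%:R `^ (- (beta * hsup))) ^+ 4 <= Rm ^+ 4.
    by rewrite -exprMn lerXn2r ?nnegrE ?(ltW R0)// mulr_ge0 ?powR_ge0// ltW.
  rewrite powRM ?powR_ge0// in EA.
  rewrite exprVn ler_pdivrMl ?exprn_gt0//; apply: le_trans EA _.
  rewrite /freezing_moment.
  set q := M%:R `^ (- (beta * (rho - hsup))); set K := stable_moment alpha (beta * 4) *
    freezing_const alpha hlo hhi cH L `^ (beta * 4).
  have Kge : 0 <= K / profile_low ^+ 4 * q ^+ 4 by rewrite mulr_ge0 ?exprn_ge0 ?powR_ge0 ?freezing_moment_ge0.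
  have := ler_wpM2r Kge Rsup4; apply: le_trans.
  have -> : (M%:R `^ (- rho)) `^ (beta * 4) = (M%:R `^ (- (beta * hsup))) ^+ 4 * q ^+ 4.
    have pow4 (z : R) : (M%:R `^ z) ^+ 4 = M%:R `^ (z * 4) by rewrite powRrM powR_mulrn// powR_ge0.
    rewrite /q !pow4 -powRrM -powRD; last by rewrite (gt_eqF MR) implybT.
    by congr (_ `^ _); ring.
  rewrite le_eqVlt; apply/orP; left; apply/eqP; rewrite /K; field; by rewrite gt_eqF.
- have eF : (fun w => (Rm^-1 * `|F w|) ^+ 2) = (fun w => Rm^-1 ^+ 2 * F w ^+ 2).
    by apply/funext => w; rewrite exprMn real_normK// num_real.
  split.
  + by apply: measurable_funM => //; exact: (measurableT_comp (@normr_measurable R setT)).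
  + by move=> w; rewrite mulr_ge0.
  + by rewrite eF; exact: integrable_scale.
  rewrite eF Ex_scale//; set q := M%:R `^ (- (beta * h)); set g := gain a b M.
  set y := x `^ (- variance_exponent L beta) in mv mf.
  have g0 : 0 < g by apply: lt_le_trans (gain_ge1 _ _ _).
  have q0 : 0 < q by exact: powR_gt0.
  have sc (z : R) : 0 <= z -> (M%:R `^ (- h) * z) `^ (beta * 2) = q ^+ 2 * z `^ (beta * 2).
    move=> z0; rewrite powRM ?powR_ge0// -powRrM -powR_mulrn ?(ltW q0)// -powRrM.
    by congr (_ `^ _ * _); ring.
  have nx : (m + L).*2.+1%:R / n <= 8 / 3 * (2 * L%:R + 3) * y ^+ 2.
    apply: (@le_trans _ _ (4 / 3 * ((m + L).*2.+1%:R / x))); last first.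
      by rewrite [leRHS](_ : _ = 4 / 3 * (2 * (2 * L%:R + 3) * y ^+ 2)); [rewrite ler_wpM2l|ring].
    rewrite ler_pdivrMr// [leRHS](_ : _ = (m + L).*2.+1%:R * (4 / 3 * n / x)); last by ring.
    by rewrite ler_peMr// ler_pdivlMr// mul1r; move: n1; rewrite -ler_pdivlMl// invf_div.
  rewrite /variance_bound /far_bound !sc ?stencil_size_ge0// in EF; last first.
    by rewrite mulr_ge0 ?tail_const_ge0 ?powR_ge0.
  rewrite (powRM _ (tail_const_ge0 _) (powR_ge0 _ _)) in EF.
  have R2 : (gain_const cH beta profile_low * q / g) ^+ 2 <= Rm ^+ 2.
    have G0 : 0 <= gain_const cH beta profile_low * q / g.
      by apply: mulr_ge0 (mulr_ge0 (ltW gc0) (ltW q0)) _; rewrite invr_ge0 ltW.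
    by rewrite ler_sqr ?nnegrE// ltW.
  rewrite exprVn ler_pdivrMl ?exprn_gt0//; apply: le_trans EF _.
  set V := variance_moment; set Dd := dispersion a b M ^+ 2.
  have VD : 0 <= V * Dd by rewrite mulr_ge0 ?sqr_ge0 ?variance_moment_ge0.
  apply: le_trans (ler_wpM2r VD R2).
  set K := stable_moment alpha (beta * 2); set S := stencil_size alpha hhi L `^ (beta * 2).
  set W := tail_const L `^ (beta * 2).
  have -> : (gain_const cH beta profile_low * q / g) ^+ 2 * (V * Dd) =
      2 * K * q ^+ 2 * S * (8 / 3 * (2 * L%:R + 3) * y ^+ 2) + 2 * K * q ^+ 2 * W * y ^+ 2.
    rewrite /Dd /V /dispersion /variance_moment -/K -/S -/W -/g -/x -/y.
    by field; rewrite !gt_eqF.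
  have -> : 2 * ((m + L).*2.+1%:R / n * (K * (q ^+ 2 * S))) +
     2 * (K * (q ^+ 2 * (W * (m%:R `^ (- (L%:R - 1))) `^ (beta * 2)))) =
     2 * K * q ^+ 2 * S * ((m + L).*2.+1%:R / n) +
     2 * K * q ^+ 2 * W * (m%:R `^ (- (L%:R - 1))) `^ (beta * 2) by ring.
  have Kq : 0 <= 2 * K * q ^+ 2 by apply: mulr_ge0 (mulr_ge0 (ler0n _ _) (ltW K2)) (sqr_ge0 _).
  by rewrite lerD// ler_wpM2l// mulr_ge0 ?powR_ge0.
move=> w; have Rn0 : Rm != 0 by rewrite gt_eqF.
rewrite -mulrDr -[X in _ - X](mulVf Rn0) mulrC -mulrBr normrM.
by rewrite (ger0_norm Ri0) ler_wpM2l//; have := bnd w; rewrite mean_power_varE.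
Qed.

End relative_fluctuation.

(** * Pointwise bound on the error of the estimator *)

Lemma summand_le (R : realDomainType) (x y z : R) : 0 <= x -> 0 <= y -> 0 <= z ->
  [/\ 1 <= 1 + x + y + z, x <= 1 + x + y + z, y <= 1 + x + y + z & z <= 1 + x + y + z].
Proof. by move=> *; split; lra. Qed.

Section estimator_error.
Context {R : realType}.
Variable alpha : R.
Hypothesis alpha12 : 1 < alpha < 2.
Variables (H : R -> R) (hlo hhi : R).
Hypotheses (hlo_gt : alpha^-1 < hlo) (hhi_lt1 : hhi < 1).
Hypothesis Hrange : forall t : R, 0 <= t <= 1 -> hlo <= H t <= hhi.
Variables (cH rho hsup : R).
Hypothesis cH0 : 0 <= cH.
Hypothesis Hholder : forall t1 t2 : R, 0 <= t1 <= 1 -> 0 <= t2 <= 1 ->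
  `|H t1 - H t2| <= cH * `|t1 - t2| `^ rho.
Hypothesis Hsup : forall t : R, 0 <= t <= 1 -> H t <= hsup.
Hypothesis hsup_rho : hsup < rho <= 1.
Variable beta : R.
Hypothesis beta14 : 0 < beta <= 4^-1.
Variable L : nat.
Hypothesis L2 : (2 <= L)%N.

Let b0 : 0 < beta. Proof. by case/andP: beta14. Qed.
Let plo := profile_low alpha beta.
Let phi := profile_high alpha hhi beta L.
Let pl := profile_holder alpha hlo hhi beta L.
Let psi := profile alpha beta L.
Let plo0 : 0 < plo. Proof. exact: (profile_low_gt0 alpha12 beta14). Qed.
Let pl0 : 0 <= pl. Proof. exact: profile_holder_ge0. Qed.
Let psiP := profile_bounds alpha12 hlo_gt hhi_lt1 Hrange beta14 L2.
Let psiL := profile_modulus alpha12 hlo_gt hhi_lt1 Hrange beta14 L2.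
Let rho1 : 2^-1 <= rho <= 1.
Proof. exact: (holder_exponent_ge_half alpha12 hlo_gt hhi_lt1 Hrange Hsup hsup_rho). Qed.
Let half := hurst_ge_half alpha12 hlo_gt hhi_lt1 Hrange.
Let H01 t : 0 <= t <= 1 -> 0 <= H t <= 1.
Proof. by move/half/andP => [h1 ->]; rewrite andbT (le_trans _ h1)// invr_ge0. Qed.
Let phi0 : 0 <= phi.
Proof.
have z : 0 <= (0 : R) <= 1 by rewrite lexx ler01.
by have /andP[l u] := psiP z; apply: le_trans u; apply: le_trans l; exact: ltW.
Qed.

Let wm := weight_modulus cH beta plo pl.
Let mc := mesh_const L cH beta plo phi.
Let bc := bias_const cH beta plo phi.
Let wm0 : 0 <= wm. Proof. exact: weight_modulus_ge0. Qed.
Let pg0 : 0 <= phi / gain_const cH beta plo.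
Proof. by rewrite divr_ge0// ltW// gain_const_gt0. Qed.
Let mc0 : 0 <= mc.
Proof.
have L0 : 0 <= L%:R :> R by [].
have c0 : 0 <= 4 / 3 * (L%:R + 2) :> R by rewrite mulr_ge0// addr_ge0.
by apply: mulr_ge0 => //; exact: addr_ge0.
Qed.
Let bc0 : 0 <= bc.
Proof.
apply: mulr_ge0 => //; apply: addr_ge0 => //; apply: addr_ge0 => //.
by rewrite -mulrA; exact: mulr_ge0.
Qed.

(** The denominator [beta * ln 2] of the exponent is at least [beta / 2], and the largest
    coefficient in [log_ratio_bias] and [ln_near_one] is 4. *)
Definition error_slope : R := 8 / beta *
  (1 + weight_modulus cH beta (profile_low alpha beta) (profile_holder alpha hlo hhi beta L) +
   mesh_const L cH beta (profile_low alpha beta) (profile_high alpha hhi beta L) +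
   bias_const cH beta (profile_low alpha beta) (profile_high alpha hhi beta L)).

Let slopeE : error_slope = 8 / beta * (1 + wm + mc + bc). Proof. by []. Qed.

Lemma error_slope_gt0 : 0 < error_slope.
Proof.
rewrite slopeE; apply: mulr_gt0; first exact: divr_gt0.
by apply: ltr_wpDr bc0 (ltr_wpDr mc0 (ltr_wpDr wm0 ltr01)).
Qed.

Variables (a b : R) (N : nat).
Hypothesis adm : admissible L a b N.

Let adm2 := admissible_double L2 adm.
Let N0 : (0 < N)%N. Proof. by case: adm => _ _ _ N3 _; exact: leq_trans N3. Qed.
Let N1 : 1 <= N%:R :> R. Proof. by rewrite ler1n. Qed.
Let NR : 0 < N%:R :> R. Proof. exact: lt_le_trans N1. Qed.
Let lam0 : 0 < b - a. Proof. by case: adm => _ ab _ _ _; rewrite subr_gt0. Qed.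
Let x1 : 1 <= N%:R * (b - a).
Proof.
have [h _] := admissible_size L2 adm; apply: le_trans h.
by have : 0 <= L%:R :> R by []; lra.
Qed.
Let x0 : 0 < N%:R * (b - a). Proof. exact: mulr_gt0. Qed.
Let g1 := gain_ge1 a b N.
Let g0 : 0 < gain a b N. Proof. exact: lt_le_trans g1. Qed.
Let h := min_on H `[a, b]%classic.
Let lnN3 := admissible_ln L2 adm.
Let mu : R := Num.min ((b - a) `^ rho) (ln (ln (N%:R : R)) / ln N%:R).
Let u : R := N%:R `^ (- (beta * (rho - hsup))).
Let D : R := dispersion beta L a b N.
Let mesh := mesh_error L cH rho beta plo phi pl a b N.
Let R1 := weight_mean L H beta psi a b N.
Let R2 := weight_mean L H beta psi a b (2 * N).

Lemma rate_ge0 : 0 <= Num.min ((b - a) `^ rho) (ln (ln (N%:R : R)) / ln N%:R).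
Proof.
rewrite le_min powR_ge0/=; have l1 : 1 <= ln (N%:R : R) by apply: le_trans lnN3; rewrite ler1n.
by rewrite divr_ge0 ?ln_ge0// (le_trans _ l1).
Qed.
Let mu0 : 0 <= mu. Proof. exact: rate_ge0. Qed.
Let u0 : 0 < u. Proof. exact: powR_gt0. Qed.
Let D0 : 0 < D. Proof. by apply: mulr_gt0 => //; exact: powR_gt0. Qed.

Lemma min_hurst_range : 2^-1 <= min_on H `[a, b]%classic <= 1.
Proof.
have /andP[_ ->] := min_on_range H01 adm; rewrite andbT.
case: adm => a0 ab b1 _ _; apply: lb_le_inf; first by exists (H a), a; rewrite //= in_itv/= lexx ltW.
move=> y [t /=]; rewrite in_itv/= => /andP[h1 h2] <-.
by have /half/andP[] : 0 <= t <= 1 by rewrite (le_trans a0)// (le_trans h2).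
Qed.

Let mesh_error_le : mesh <= wm * u + mc * D.
Proof.
rewrite /mesh /mesh_error -/wm -/mc; apply: lerD; apply: ler_wpM2l => //.
  rewrite /u ler_powR// lerN2 ler_wpM2l ?(ltW b0)// lerBlDr lerDl.
  have z : 0 <= (0 : R) <= 1 by rewrite lexx ler01.
  by apply: le_trans (Hsup z); have /andP[] := H01 z.
rewrite /D /dispersion ler_wpM2l ?(ltW g0)// -[X in X^-1]powRr1 ?(ltW x0)// -powRN.
have /andP[v0 v1] := variance_exponent_range L2 b0.
by rewrite ler_powR// lerN2; move: v1; lra.
Qed.

Let mean_gt0 M : admissible L a b M -> 0 < weight_mean L H beta psi a b M.
Proof.
move=> admM; apply: lt_le_trans (weight_mean_ge_sup L2 beta14 plo0 psiP admM Hsup).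
by apply: mulr_gt0 => //; rewrite powR_gt0// ltr0n; case: admM => _ _ _ M3 _; exact: leq_trans M3.
Qed.
Let R10 : 0 < R1. Proof. exact: mean_gt0. Qed.
Let R20 : 0 < R2. Proof. exact: mean_gt0. Qed.

(** When one of the relative errors exceeds one half the bound is trivial, since both the
    estimator and the minimum lie between one half and one. Otherwise the logarithm of the
    ratio is close to that of the ratio of means. *)
Lemma estimator_error (V1 V2 : R) :
  `|truncated_exponent beta (V1 / V2) - h| <=
  error_slope * (`|V1 / R1 - 1| + `|V2 / R2 - 1| + u + D + mu).
Proof.
set r1 := V1 / R1; set r2 := V2 / R2; set e := `|_ - h|.
have e1 : e <= 1.
  have /andP[h1 h2] := min_hurst_range; have /andP[t1 t2] := truncated_exponent_range b0 (V1 / V2).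
  by rewrite /e ler_norml; apply/andP; split; move: h1 h2 t1 t2; lra.
have bi : 8 <= 8 / beta.
  by rewrite ler_peMr// invf_ge1//; move: beta14; lra.
set s := `|r1 - 1| + _ + _ + _ + _.
have meshle := mesh_error_le; have slope0 := error_slope_gt0.
have n1 := normr_ge0 (r1 - 1); have n2 := normr_ge0 (r2 - 1).
pose W := 1 + wm + mc + bc.
have Ws : `|r1 - 1| + `|r2 - 1| + (wm * u + mc * D) + bc * mu <= W * s.
  have [W1 Wwm Wmc Wbc] := summand_le wm0 mc0 bc0.
  rewrite /s 4!mulrDr addrA; apply: lerD (ler_wpM2r mu0 Wbc).
  apply: lerD (ler_wpM2r (ltW D0) Wmc); apply: lerD (ler_wpM2r (ltW u0) Wwm).
  by apply: lerD; rewrite ler_peMl.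
have wu0 : 0 <= wm * u + mc * D by apply: addr_ge0 (mulr_ge0 wm0 (ltW u0)) (mulr_ge0 mc0 (ltW D0)).
have bm0 : 0 <= bc * mu by exact: mulr_ge0.
have fallback (z : R) : 2^-1 < z -> z <= W * s -> e <= error_slope * s.
  move=> z2 zs; apply: le_trans e1 _; rewrite slopeE -/W.
  have z4 : 4 <= 8 * (W * s) by move: z2 zs; lra.
  have Ws0 : 0 <= W * s by move: z4; lra.
  have : 8 * (W * s) <= 8 / beta * W * s by rewrite -[leRHS]mulrA ler_wpM2r.
  by move: z4; lra.
move: Ws wu0 bm0; set A := wm * u + _; set B := bc * mu => Ws wu0 bm0.
have [r1h|/fallback] := leP `|r1 - 1| 2^-1; last by apply; move: Ws wu0 bm0 n2; lra.
have [r2h|/fallback] := leP `|r2 - 1| 2^-1; last by apply; move: Ws wu0 bm0 n1; lra.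
have [mh|/fallback] := leP mesh 2^-1; last first.
  by apply; apply: le_trans meshle _; move: Ws bm0 n1 n2; rewrite -/A; lra.
have pos (r : R) : `|r - 1| <= 2^-1 -> 0 < r by rewrite ler_norml; lra.
have r10 := pos _ r1h; have r20 := pos _ r2h.
have E1 : V1 = r1 * R1 by rewrite /r1 divfK// gt_eqF.
have E2 : V2 = r2 * R2 by rewrite /r2 divfK// gt_eqF.
have bias := log_ratio_bias L2 H01 cH0 rho1 Hholder beta14 plo0 psiP pl0 psiL adm mh.
have xpos : 0 < V1 / V2 by rewrite E1 E2 divr_gt0// mulr_gt0.
apply: le_trans (truncated_exponent_error b0 xpos min_hurst_range) _.
have lnE : ln (V1 / V2) - beta * h * ln 2 =
    ln r1 - ln r2 + (ln (R1 / R2) - beta * h * ln 2).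
  have lnV : ln (V1 / V2) = ln V1 - ln V2.
    by apply: ln_div; rewrite posrE ?E1 ?E2 mulr_gt0.
  have lnR : ln (R1 / R2) = ln R1 - ln R2 by apply: ln_div; rewrite posrE.
  have ln1 : ln V1 = ln r1 + ln R1 by rewrite {1}E1; apply: lnM; rewrite posrE.
  have ln2' : ln V2 = ln r2 + ln R2 by rewrite {1}E2; apply: lnM; rewrite posrE.
  by rewrite lnV lnR ln1 ln2'; ring.
have ln2h := @ln2_ge_half R.
have bl0 : 0 < beta * ln 2 by rewrite mulr_gt0// (lt_le_trans _ ln2h)// invr_gt0.
rewrite ler_pdivrMr// lnE; apply: le_trans (ler_normD _ _) _.
have l1 := ln_near_one (lexx `|r1 - 1|) r1h; have l2 := ln_near_one (lexx `|r2 - 1|) r2h.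
have l12 := ler_normB (ln r1) (ln r2).
have Z0 : 0 <= W * s by move: Ws wu0 bm0 n1 n2; lra.
apply: (@le_trans _ _ (4 * (W * s))).
  move: l1 l2 l12 bias Ws meshle wu0 bm0 n1 n2.
  rewrite -/mesh -/bc -/mu -/R1 -/R2 -/h -/B -/A; lra.
rewrite slopeE -/W (_ : 8 / beta * W * s * (beta * ln 2) = 8 * ln 2 * (W * s)).
  by rewrite ler_wpM2r//; move: ln2h; lra.
by field; rewrite gt_eqF.
Qed.

End estimator_error.

(** * Risk of the estimator *)

Section measurable_estimator.
Context {R : realType} d (T : measurableType d) (P : probability T R).
Variables (X : R -> R -> {RV P >-> R}) (H : R -> R) (L : nat) (beta : R).

Lemma measurable_power_var (M : nat) (I : set R) :
  measurable_fun setT (power_var (LMSM X H) L beta M I).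
Proof.
apply: measurable_funM => //; apply: measurable_sumr => k _.
by apply: measurable_norm_powR; exact: measurable_incr_d.
Qed.

Lemma power_var_ge0 (M : nat) (I : set R) w : 0 <= power_var (LMSM X H) L beta M I w.
Proof.
rewrite /power_var mulr_ge0 ?invr_ge0//.
by apply: sumr_ge0 => k _; exact: powR_ge0.
Qed.

Lemma measurable_H_hat (N : nat) (I : set R) :
  measurable_fun setT (H_hat (LMSM X H) L beta N I).
Proof.
have mV := measurable_power_var.
have mr : measurable_fun setT (fun w => power_var (LMSM X H) L beta N I w /
    power_var (LMSM X H) L beta (2 * N) I w).
  apply: measurable_funM; first exact: mV.
  rewrite (_ : (fun w => _) = (fun w => power_var (LMSM X H) L beta (2 * N) I w `^ (-1))).
    exact: (measurableT_comp (@measurable_powR R (-1)) (mV _ _)).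
  by apply/funext => w; rewrite powR_inv1// power_var_ge0.
have mt : measurable_fun setT (fun w => trunc_T beta (power_var (LMSM X H) L beta N I w /
    power_var (LMSM X H) L beta (2 * N) I w)).
  by apply: measurable_minr => //; exact: measurable_maxr.
apply: measurable_funM => //; apply: measurable_funM => //.
exact: (measurableT_comp (@measurable_ln R) mt).
Qed.

End measurable_estimator.

Lemma dispersion_double {R : realType} (beta : R) (L : nat) (a b : R) (N : nat) :
  (2 <= L)%N -> 0 < beta -> admissible L a b N ->
  dispersion beta L a b (2 * N) <= 4 * dispersion beta L a b N.
Proof.
move=> L2 beta0 adm; have lnN3 := admissible_ln L2 adm.
have [_ ab _ N3 _] := adm; have lam0 : 0 < b - a by rewrite subr_gt0.
have NR : 0 < N%:R :> R by rewrite ltr0n (leq_trans _ N3).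
have /andP[v0 _] := variance_exponent_range L2 beta0.
have l2 := @ln2_le1 R.
have l2N : ln ((2 * N)%:R : R) <= 2 * ln N%:R.
  by rewrite natrM lnM ?posrE//; lra.
have l2N0 : 0 <= ln ((2 * N)%:R : R) by rewrite ln_ge0// ler1n muln_gt0 (leq_trans _ N3).
rewrite /dispersion mulrA; apply: ler_pM; rewrite ?powR_ge0 ?(le_trans _ (gain_ge1 _ _ _))//.
  have : (b - a) * ln ((2 * N)%:R : R) ^+ 2 <= 4 * ((b - a) * ln (N%:R : R) ^+ 2).
    rewrite [leRHS]mulrCA ler_wpM2l ?(ltW lam0)//.
    rewrite (_ : 4 * ln (N%:R : R) ^+ 2 = (2 * ln N%:R) ^+ 2); last by ring.
    by rewrite ler_sqr ?nnegrE// mulr_ge0// (le_trans _ lnN3).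
  rewrite {1}/gain ge_max => h; apply/andP; split.
    by apply: le_trans (_ : 4 * 1 <= _); [rewrite mulr1 ler1n|rewrite ler_wpM2l ?gain_ge1].
  by apply: le_trans h _; rewrite ler_wpM2l// le_max lexx orbT.
apply: powR_base_anti; rewrite ?oppr_le0 ?(ltW v0)//; first exact: mulr_gt0.
by rewrite ler_wpM2r ?(ltW lam0)// ler_nat leq_pmull.
Qed.

Section risk.
Context {R : realType} d (T : measurableType d) (P : probability T R).
Variables (alpha : R) (SI : (R -> R) -> {RV P >-> R}).
Hypothesis alpha12 : 1 < alpha < 2.
Hypothesis HSI : is_stable_integral alpha SI.
Variable X : R -> R -> {RV P >-> R}.
Hypothesis HX : is_field_X alpha SI X.
Variables (H : R -> R) (hlo hhi : R).
Hypotheses (hlo_gt : alpha^-1 < hlo) (hhi_lt1 : hhi < 1).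
Hypothesis Hrange : forall t : R, 0 <= t <= 1 -> hlo <= H t <= hhi.
Variables (cH rho hsup : R).
Hypothesis cH0 : 0 <= cH.
Hypothesis Hholder : forall t1 t2 : R, 0 <= t1 <= 1 -> 0 <= t2 <= 1 ->
  `|H t1 - H t2| <= cH * `|t1 - t2| `^ rho.
Hypothesis Hsup : forall t : R, 0 <= t <= 1 -> H t <= hsup.
Hypothesis hsup_rho : hsup < rho <= 1.
Variable beta : R.
Hypothesis beta14 : 0 < beta <= 4^-1.
Variable L : nat.
Hypothesis L2 : (2 <= L)%N.

Local Notation integ f := (P.-integrable setT (EFin \o f)).
Local Notation "'Ex' f" := (Rintegral P setT f) (at level 10).

Let b0 : 0 < beta. Proof. by case/andP: beta14. Qed.

(** The factor 16 is the square of the loss in [dispersion_double]. *)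
Definition risk_const : R := 5 * error_const (error_slope alpha hlo hhi cH beta L)
  (freezing_moment alpha hlo hhi cH beta L) (16 * variance_moment alpha hhi cH beta L) ^+ 4.

Let slope0 : 0 < error_slope alpha hlo hhi cH beta L.
Proof. exact: (error_slope_gt0 alpha12 hlo_gt hhi_lt1 Hrange cH0 beta14 L2). Qed.
Let fm0 : 0 <= freezing_moment alpha hlo hhi cH beta L.
Proof. exact: (freezing_moment_ge0 alpha12 _ _ _ beta14). Qed.
Let vm0 : 0 <= variance_moment alpha hhi cH beta L.
Proof. exact: (variance_moment_ge0 alpha12 _ _ beta14). Qed.
Let vm16 : 0 <= 16 * variance_moment alpha hhi cH beta L.
Proof. exact: mulr_ge0. Qed.

Lemma risk_const_gt0 : 0 < risk_const.
Proof.
apply: mulr_gt0 => //; apply: exprn_gt0; apply: ltr_wpDr ltr01.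
by apply: mulr_ge0; [apply: mulr_ge0 => //; exact: ltW|apply: addr_ge0 => //; exact: addr_ge0].
Qed.

Lemma risk_bound (a b p : R) (N : nat) : admissible L a b N -> 0 < p <= 4 ->
  integ (fun w => `|H_hat (LMSM X H) L beta N `[a, b]%classic w - min_on H `[a, b]%classic| `^ p) /\
  Ex (fun w => `|H_hat (LMSM X H) L beta N `[a, b]%classic w - min_on H `[a, b]%classic| `^ p) <=
  risk_const * ((Num.min ((b - a) `^ rho) (ln (ln (N%:R : R)) / ln N%:R)) `^ p +
    (N%:R `^ (- (beta * (rho - hsup)))) `^ p + dispersion beta L a b N `^ (Num.min p 2)).
Proof.
move=> adm p04; have adm2 := admissible_double L2 adm.
have [_ ab _ N3 _] := adm; have lam0 : 0 < b - a by rewrite subr_gt0.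
have NR : 0 < N%:R :> R by rewrite ltr0n (leq_trans _ N3).
have [E1 [E2 [F1 [mE2 E20 iE2 mmE2] bnd]]] := relative_fluctuation alpha12 HSI HX hlo_gt hhi_lt1
  Hrange cH0 Hholder Hsup hsup_rho beta14 L2 adm.
have [E3 [E4 [[mE3 E30 iE3 mmE3] [mE4 E40 iE4 mmE4] bnd2]]] := relative_fluctuation alpha12 HSI HX
  hlo_gt hhi_lt1 Hrange cH0 Hholder Hsup hsup_rho beta14 L2 adm2.
set u := N%:R `^ (- (beta * (rho - hsup))) in F1 *.
set u2 := _ `^ (- (beta * (rho - hsup))) in mmE3.
set D := dispersion beta L a b N in mmE2 *.
set D2 := dispersion beta L a b (2 * N) in mmE4.
set V := variance_moment _ _ _ _ _ in mmE2 mmE4.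
have u0 : 0 < u by exact: powR_gt0.
have g0 M : 0 < gain a b M by apply: lt_le_trans (gain_ge1 _ _ _).
have D0 : 0 < D by apply: mulr_gt0 => //; rewrite powR_gt0// mulr_gt0.
have D20 : 0 <= D2 by apply: mulr_ge0; [exact: ltW|exact: powR_ge0].
have uu : u2 <= u.
  apply: powR_base_anti => //; first by rewrite ler_nat leq_pmull.
  by rewrite oppr_le0 mulr_ge0 ?(ltW b0)// subr_ge0; case/andP: hsup_rho => /ltW.
have DD : D2 ^+ 2 <= 16 * D ^+ 2.
  rewrite (_ : 16 * D ^+ 2 = (4 * D) ^+ 2); last by ring.
  have D40 : 0 <= 4 * D by rewrite mulr_ge0// ltW.
  by rewrite ler_sqr ?nnegrE//; exact: dispersion_double.
apply: (error_moment (E1 := E1) (E2 := E2) (E3 := E3) (E4 := E4)) => //.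
- apply: (measurableT_comp (@normr_measurable R setT)); apply: measurable_funB => //.
  exact: measurable_H_hat.
- move=> w; rewrite normr_ge0/= ler_norml.
  have /andP[h1 h2] := min_hurst_range alpha12 hlo_gt hhi_lt1 Hrange adm.
  have /andP[t1 t2] := truncated_exponent_range b0
    (power_var (LMSM X H) L beta N `[a, b]%classic w / power_var (LMSM X H) L beta (2 * N) `[a, b]%classic w).
  by apply/andP; split; move: h1 h2 t1 t2; rewrite /truncated_exponent /H_hat; lra.
- exact: (rate_ge0 _ L2 adm).
- move=> w; apply: le_trans (estimator_error alpha12 hlo_gt hhi_lt1 Hrange cH0 Hholder Hsup
    hsup_rho beta14 L2 adm _ _) _.
  rewrite ler_wpM2l ?(ltW slope0)// -/u -/D !lerD2r -!addrA addrA.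
  by apply: lerD; [exact: bnd|exact: bnd2].
- split => //; apply: le_trans mmE2 _; rewrite ler_wpM2r ?sqr_ge0//.
  by rewrite ler_peMl// ler1n.
- split => //; apply: le_trans mmE3 _; rewrite ler_wpM2l//.
  by rewrite lerXn2r ?nnegrE ?powR_ge0// ltW.
- split => //; apply: le_trans mmE4 _.
  rewrite -/V [leRHS](_ : _ = V * (16 * D ^+ 2)); last by ring.
  by rewrite ler_wpM2l.
Qed.

End risk.

Theorem theorem2p1 (R : realType) (d : measure_display) (T : measurableType d)
    (P : probability T R) (alpha : R) (Halpha : 1 < alpha < 2)
    (SI : (R -> R) -> {RV P >-> R}) (HSI : is_stable_integral alpha SI)
    (X : R -> R -> {RV P >-> R}) (HX : is_field_X alpha SI X)
    (H : R -> R) (hlo hhi : R) (Hlo : alpha^-1 < hlo) (Hhi : hhi < 1)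
    (Hrange : forall t : R, 0 <= t <= 1 -> hlo <= H t <= hhi)
    (cH rhoH : R)
    (Hholder : forall t1 t2 : R, 0 <= t1 <= 1 -> 0 <= t2 <= 1 ->
       `|H t1 - H t2| <= cH * `|t1 - t2| `^ rhoH)
    (Hrho : sup (H @` `[0, 1]) < rhoH <= 1)
    (beta : R) (Hbeta : 0 < beta <= 4^-1)
    (L : nat) (HL : (2 <= L)%N) :
  exists2 c : R, 0 < c &
    forall (a b : R), 0 <= a -> a < b -> b <= 1 ->
    forall N : nat, (3 <= N)%N ->
    let I := `[a, b]%classic in
    len I >= 4 * (L%:R + 1) * N%:R^-1 * (ln N%:R) ^+ 2 ->
    forall p : R, 0 < p <= 4 ->
    let Lam := Lambda_exp L beta p in
    let logN := ln (N%:R : R) in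
    (c%:E * 'E_P[fun w => (`|H_hat (LMSM X H) L beta N I w - min_on H I| `^ p)%R]
     <= ((Num.min ((ln logN / logN) `^ p) (len I `^ (p * rhoH))
         + N%:R `^ (- (p * beta * (rhoH - sup (H @` `[0, 1]))))
         + N%:R `^ (- (p * Lam)) * logN `^ (8 * (1 - Lam))
           * len I `^ (- (4 * (1 - Lam)))
           * Num.max (len I ^+ 2) (N%:R `^ (- ((p + 4) * Lam))))%R)%:E)%E.
Proof.
have hsup_ub (t : R) : 0 <= t <= 1 -> H t <= sup (H @` `[0, 1]).
  move=> tI; have Ht : (H @` `[0, 1]) (H t) by exists t; rewrite //= in_itv.
  apply: (sup_upper_bound _ Ht); split; first by exists (H t).
  by exists hhi => y [s /=]; rewrite in_itv/= => sI <-; case/andP: (Hrange s sI).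
have cH0 : 0 <= cH.
  have := @Hholder 0 1; rewrite lexx ler01 lexx => /(_ isT isT).
  by rewrite sub0r normrN normr1 powR1 mulr1; apply: le_trans.
have K0 : 0 < risk_const alpha hlo hhi cH beta L.
  exact: (risk_const_gt0 Halpha Hlo Hhi Hrange cH0 Hbeta HL).
have beta0 : 0 < beta by case/andP: Hbeta.
exists (risk_const alpha hlo hhi cH beta L)^-1; first by rewrite invr_gt0.
move=> a b a0 ab b1 N N3 I lamN p p04; cbv zeta; set logN := ln (N%:R : R).
have lenE : len I = b - a by rewrite /len /I lebesgue_measure_itv/= lte_fin ab.
rewrite lenE in lamN *.
have adm : admissible L a b N by [].
have [iE EE] := risk_bound Halpha HSI HX Hlo Hhi Hrange cH0 Hholder hsup_ub Hrho Hbeta HL adm p04.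
have /andP[p0 _] := p04; have lam0 : 0 < b - a by rewrite subr_gt0.
have lam1 : b - a <= 1 by lra.
have [size _] := admissible_size HL adm; have ln3 := admissible_ln HL adm.
rewrite expectation.unlock (integrable_EFin iE) -EFinM lee_fin ler_pdivrMl//.
apply: le_trans EE _; rewrite ler_wpM2l ?(ltW K0)//.
have minE : (Num.min ((b - a) `^ rhoH) (ln (ln (N%:R : R)) / ln N%:R)) `^ p <=
    Num.min ((ln logN / logN) `^ p) ((b - a) `^ (p * rhoH)).
  have rate0 := rate_ge0 rhoH HL adm.
  have mono (z : R) : Num.min ((b - a) `^ rhoH) (ln (ln (N%:R : R)) / ln N%:R) <= z ->
      (Num.min ((b - a) `^ rhoH) (ln (ln (N%:R : R)) / ln N%:R)) `^ p <= z `^ p.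
    by move=> mz; rewrite ge0_ler_powR ?nnegrE ?(ltW p0)// (le_trans rate0).
  rewrite le_min [p * _]mulrC powRrM; apply/andP.
  by split; apply: mono; rewrite ge_min lexx ?orbT.
apply: lerD; first (apply: lerD => //).
  rewrite -powRrM le_eqVlt; apply/orP; left; apply/eqP; congr (_ `^ _); ring.
apply: variance_rate_le => //.
- by rewrite ler1n (leq_trans _ N3).
- by rewrite lam0.
- by apply: le_trans size; have : 0 <= L%:R :> R by []; lra.
by apply: le_trans ln3; rewrite ler1n.
Qed.
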